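(* Let $D\subset\mathbb{C}^n$ be a taut convex tube domain and let $\varphi:\mathbb{D}\to D$ be a holomorphic map with boundary measure $\mu=(\mu_1,\ldots,\mu_n)$. Then $\varphi$ is a complex geodesic for $D$ if and only if there exists a map $h:\mathbb{C}\to\mathbb{C}^n$ of the form $h(\lambda)=\bar a\lambda^2+b\lambda+a$ with some $a\in\mathbb{C}^n$, $b\in\mathbb{R}^n$, such that $h\not\equiv 0$ and for every $z\in D$ the (real Borel) measure on $\mathbb{T}$ $$\bar\lambda h(\lambda)\bullet\bigl(\operatorname{Re} z\,d\mathcal{L}^{\mathbb{T}}(\lambda)-d\mu(\lambda)\bigr)$$ is negative.
   Context: Notation: $\mathbb{D}$ is the open unit disc in $\mathbb{C}$, $\mathbb{T}=\partial\mathbb{D}$, $\mathcal{L}^{\mathbb{T}}$ is Lebesgue (arc length) measure on $\mathbb{T}$ (total mass $2\pi$). For $z,w\in\mathbb{C}^n$, $z\bullet w=\sum_{j=1}^n z_jw_j$. For $a\in\mathbb{C}^n$, $\bar a$ is the coordinatewise conjugate; for $z\in\mathbb{C}^n$, $\operatorname{Re}z$ is the coordinatewise real part. A domain $D\subset\mathbb{C}^n$ is a convex tube domain if $D=\Omega+i\mathbb{R}^n$ for a convex domain $\Omega\subset\mathbb{R}^n$. A convex tube domain is taut (in the usual sense of complex analysis) if and only if its base $\Omega$ contains no real affine line. A holomorphic map $\varphi:\mathbb{D}\to D$ is a complex geodesic for $D$ if it is an isometry between the Poincaré distance on $\mathbb{D}$ and the Carathéodory pseudodistance of $D$; equivalently,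 if it has a left inverse, i.e. a holomorphic $f:D\to\mathbb{D}$ with $f\circ\varphi=\mathrm{id}_{\mathbb{D}}$. Boundary measure: for a real (finite, signed) Borel measure $\mu$ on $\mathbb{T}$ put $f_\mu(\lambda)=\frac{1}{2\pi}\int_{\mathbb{T}}\frac{\zeta+\lambda}{\zeta-\lambda}\,d\mu(\zeta)$, $\lambda\in\mathbb{D}$. If a holomorphic function $f:\mathbb{D}\to\mathbb{C}$ is of the form $f=f_\mu+i\alpha$ with $\mu$ a real Borel measure on $\mathbb{T}$ and $\alpha\in\mathbb{R}$, this representation is unique and $\mu$ is called the boundary measure of $f$. The boundary measure of a holomorphic map $\varphi=(\varphi_1,\ldots,\varphi_n)$ is the tuple $\mu=(\mu_1,\ldots,\mu_n)$ of boundary measures of its components. Every holomorphic map from $\mathbb{D}$ into a taut convex tube domain has a boundary measure. For a bounded Borel map $v=(v_1,\ldots,v_n)$ on $\mathbb{T}$ and a tuple of measures $\nu=(\nu_1,\ldots,\nu_n)$, $v\bullet d\nu$ denotes the measure $\sum_j v_j\,d\nu_j$. A real measure $\nu$ is called negative if $\nu(E)\le 0$ for every Borel set $E\subset\mathbb{T}$. For $h$ of the stated form, $\bar\lambda h(\lambda)\in\mathbb{R}^n$ for $\lambda\in\mathbb{T}$. *)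

(* Defs.v *)
From HB Require Import structures.
From mathcomp Require Import all_boot all_order all_algebra.
From mathcomp Require Import complex.
From mathcomp Require Import all_classical all_reals all_analysis.

Set Implicit Arguments.
Unset Strict Implicit.
Unset Printing Implicit Defensive.

Import Order.TTheory GRing.Theory Num.Theory.
Import numFieldNormedType.Exports.

Local Open Scope classical_set_scope.
Local Open Scope ring_scope.
Local Open Scope complex_scope.

(* The library gives R[i] its field, order and norm, but no topology; this is
   the norm topology, with R[i] as a normed space over itself. *)
HB.instance Definition _ (R : realType) := NormedModule.copy R[i] R[i]^o.

Section Domains.
Context {R : realType}.

Definition unit_disc : set R[i] := [set z | `|z| < 1].

Definition is_domain (V : normedModType R) (A : set V) : Prop :=
  [/\ open A, A !=set0 & connected A].

Definition Re_vec n (z : 'rV[R[i]]_n) : 'rV[R]_n := map_mx (@complex.Re R) z.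

Definition convex_tube_domain n (D : set 'rV[R[i]]_n) : Prop :=
  exists Omega : set 'rV[R]_n,
    [/\ is_domain Omega, convex_set Omega & D = @Re_vec n @^-1` Omega].

(* Complex differentiability at every point of A; used only for open A, so
   that values outside A are irrelevant. *)
Definition holomorphic_on (U V : normedModType R[i]) (A : set U) (f : U -> V) :
  Prop := forall z, A z -> differentiable f z.

Definition holomorphic_maps (U V : normedModType R[i]) (A : set U) (B : set V) :
  set (U -> V) := [set f | holomorphic_on A f /\ {homo f : z / A z >-> B z}].

Definition locally_uniform_cvg (U V : normedModType R[i]) (A : set U)
    (f : (U -> V)^nat) (g : U -> V) : Prop :=
  forall K : set U, compact K -> K `<=` A -> {uniform K, f @ \oo --> g}.

Definition compactly_divergent (U V : normedModType R[i]) (A : set U)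
    (B : set V) (f : (U -> V)^nat) : Prop :=
  forall (K : set U) (L : set V), compact K -> K `<=` A ->
    compact L -> L `<=` B -> \forall k \near \oo, f k @` K `&` L = set0.

(* Normality of the family of holomorphic maps from the disc to D. *)
Definition taut n (D : set 'rV[R[i]]_n) : Prop :=
  forall f : (R[i] -> 'rV[R[i]]_n)^nat,
    (forall k, holomorphic_maps unit_disc D (f k)) ->
    exists2 s : nat -> nat, increasing_seq s &
      (exists2 g, holomorphic_maps unit_disc D g &
         locally_uniform_cvg unit_disc (f \o s) g)
      \/ compactly_divergent unit_disc D (f \o s).

(* artanh of the pseudo-hyperbolic distance; the norm of R[i] takes its values
   in R[i], hence the real part *)
Definition poincare (z w : R[i]) : R :=
  let m := complex.Re `|(z - w) / (1 - conjc w * z)| in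
  ln ((1 + m) / (1 - m)) / 2.

Definition caratheodory n (D : set 'rV[R[i]]_n) (z w : 'rV[R[i]]_n) : \bar R :=
  ereal_sup [set (poincare (f z) (f w))%:E | f in holomorphic_maps D unit_disc].

Definition complex_geodesic n (D : set 'rV[R[i]]_n) (phi : R[i] -> 'rV[R[i]]_n) :
  Prop :=
  holomorphic_maps unit_disc D phi /\
  forall z w, unit_disc z -> unit_disc w ->
    caratheodory D (phi z) (phi w) = (poincare z w)%:E.

End Domains.

Section Circle.
Context (R : realType).

Definition unit_circle : set R[i] := [set z | `|z| = 1].

Definition circle_top : Type := set_type unit_circle.
HB.instance Definition _ := Topological.on circle_top.

Definition expi (t : R) : R[i] := cos t +i* sin t.

Lemma expi_circle t : expi t \in unit_circle.
Proof.
by rewrite inE /unit_circle /= normc_def /= cos2Dsin2 sqrtr1.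
Qed.

Definition angle (t : R) : circle_top := exist _ (expi t) (expi_circle t).

HB.instance Definition _ := isPointed.Build circle_top (angle 0).

Definition circle : Type := g_sigma_algebraType (@open circle_top).
HB.instance Definition _ := Measurable.on circle.

Definition circle_val (x : circle) : R[i] := set_val (x : circle_top).

Lemma continuous_expi : continuous expi.
Proof.
move=> t; apply/cvgrPdist_lt => /= e e0.
have er : e = (complex.Re e)%:C.
  by rewrite RRe_real// gtr0_real.
have e0' : 0 < complex.Re e by rewrite er in e0; rewrite ltcR in e0.
have hc := @continuous_cos R t.
have hs := @continuous_sin R t.
have e20 : 0 < complex.Re e / 2 by rewrite divr_gt0.
move/cvgrPdist_lt : hc => /(_ _ e20) hc.
move/cvgrPdist_lt : hs => /(_ _ e20) hs.
near=> u.
have hcu : `|cos t - cos u| < complex.Re e / 2 by near: u.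
have hsu : `|sin t - sin u| < complex.Re e / 2 by near: u.
have -> : expi t - expi u
    = (cos t - cos u)%:C + 'i * (sin t - sin u)%:C.
  by apply/eqP; rewrite eq_complex /= !(mul0r, mul1r, addr0, add0r, subr0) !eqxx.
rewrite er (le_lt_trans (ler_normD _ _))// normrM.
rewrite !normc_def /= !expr0n /= !addr0 add0r expr1n sqrtr1 mul1r !sqrtr_sqr.
by rewrite -rmorphD /= ltcR (splitr (complex.Re e)) ltrD.
Unshelve. all: by end_near. Qed.

Lemma measurable_angle : measurable_fun setT (angle : R -> circle).
Proof.
apply: (@measurability _ _ _ circle _ _ (@open circle_top)) => //.
move=> _ [_ [V oV <-] <-]; rewrite setTI; apply: measurable_realfun.open_measurable.
by move/continuousP : continuous_expi => /(_ _ oV).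
Qed.

(* arc length: t |-> exp(it) maps [0, 2 pi[ bijectively onto the circle *)
Definition arc_length : set circle -> \bar R :=
  pushforward (mrestr lebesgue_measure (measurable_itv `[(0 : R), 2 * pi[))
    (angle : R -> circle).

Let arc_length0 : arc_length set0 = 0%E.
Proof. by rewrite /arc_length /pushforward preimage_set0 measure0. Qed.

Let arc_length_ge0 (E : set circle) : (0 <= arc_length E)%E.
Proof. by rewrite /arc_length /pushforward measure_ge0. Qed.

Let measurable_preimage_angle (E : set circle) :
  measurable E -> measurable ((angle : R -> circle) @^-1` E).
Proof. by move=> mE; rewrite -[X in measurable X]setTI; exact: measurable_angle. Qed.

Let arc_length_fin (E : set circle) :
  measurable E -> arc_length E \is a fin_num.
Proof.
move=> mE; rewrite /arc_length /pushforward /mrestr ge0_fin_numE//.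
apply: (@le_lt_trans _ _ (lebesgue_measure `[(0 : R), 2 * pi[)).
  by apply: le_measure; rewrite ?inE//; apply: measurableI => //;
    exact: measurable_preimage_angle.
by rewrite lebesgue_measure_itv/=; case: ifP; rewrite // -EFinD ltry.
Qed.

Let arc_length_sigma_additive : semi_sigma_additive arc_length.
Proof.
move=> F mF tF mUF; rewrite /arc_length /pushforward preimage_bigcup.
apply: measure_semi_sigma_additive.
- by move=> n; exact: measurable_preimage_angle.
- apply/trivIsetP => /= i j _ _ ij; rewrite -preimage_setI.
  by move/trivIsetP : tF => /(_ _ _ _ _ ij) ->//; rewrite preimage_set0.
- by rewrite -preimage_bigcup; exact: measurable_preimage_angle.
Qed.

HB.instance Definition _ := isMeasure.Build _ circle R arc_length
  arc_length0 arc_length_ge0 arc_length_sigma_additive.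
HB.instance Definition _ :=
  Measure_isFinite.Build _ circle R arc_length arc_length_fin.

End Circle.

Section Integral.
Context d (T : measurableType d) (R : realType).
Implicit Type nu : {charge set T -> \bar R}.

Definition hahn_pos_set nu : set T := projT1 (cid (Hahn_decomposition nu)).
Definition hahn_neg_set nu : set T :=
  projT1 (cid (projT2 (cid (Hahn_decomposition nu)))).

Definition hahn_sets nu :
    hahn_decomposition nu (hahn_pos_set nu) (hahn_neg_set nu) :=
  projT2 (cid (projT2 (cid (Hahn_decomposition nu)))).

(* Integral against a signed measure, through its Jordan decomposition; any
   two Hahn decompositions give the same value. *)
Definition charge_integral nu (E : set T) (f : T -> R) : R :=
  (\int[jordan_pos (hahn_sets nu)]_(x in E) f x)
  - (\int[jordan_neg (hahn_sets nu)]_(x in E) f x).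

Definition charge_integralC nu (E : set T) (f : T -> R[i]) : R[i] :=
  charge_integral nu E (fun x => complex.Re (f x))
  +i* charge_integral nu E (fun x => complex.Im (f x)).

(* the set function E |-> \sum_j \int_E v_j d(nu_j) *)
Definition dot_measure n (v : T -> 'rV[R[i]]_n)
    (nu : 'I_n -> {charge set T -> \bar R}) (E : set T) : R[i] :=
  \sum_(j < n) charge_integralC (nu j) E (fun x => v x 0 j).

(* A complex number is <= 0 in R[i] when it is real and nonpositive. *)
Definition negative_measure (nu : set T -> R[i]) : Prop :=
  forall E, measurable E -> nu E <= 0.

End Integral.

Section BoundaryMeasure.
Context {R : realType}.
Local Notation signed_measure := (charge (circle R) R).

Definition herglotz (mu : signed_measure) (z : R[i]) : R[i] :=
  (2 * pi)^-1%:C *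
  charge_integralC mu setT (fun x => (circle_val x + z) / (circle_val x - z)).

Definition is_boundary_measure (f : R[i] -> R[i]) (mu : signed_measure) : Prop :=
  exists alpha : R, forall z, unit_disc z -> f z = herglotz mu z + 'i * alpha%:C.

Definition boundary_measure n (phi : R[i] -> 'rV[R[i]]_n)
    (mu : 'I_n -> signed_measure) : Prop :=
  forall j, is_boundary_measure (fun z => phi z 0 j) (mu j).

Definition hquad n (a : 'rV[R[i]]_n) (b : 'rV[R]_n) (z : R[i]) : 'rV[R[i]]_n :=
  z ^+ 2 *: map_mx conjc a + z *: map_mx (real_complex R) b + a.

(* the components Re z_j dL - d(mu_j), L being arc length *)
Definition Re_arc_minus n (z : 'rV[R[i]]_n) (mu : 'I_n -> signed_measure)
    (j : 'I_n) : signed_measure :=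
  cadd (cscale (Re_vec z 0 j) (charge_of_finite_measure (@arc_length R)))
    (copp (mu j)).

End BoundaryMeasure.

(* Main.v *)
(* For [z] in [D] put [F_z l = h l . (z - phi l)]. The Herglotz formula gives
   [F_z l = l G_z l + w - conjc w l^2], where [Re G_z] is the Poisson integral of
   the measure of the theorem; negativity thus amounts to [Re G_z <= 0].

   If the measures are negative, then for every [e > 0] the function
   [F_z l - e l] has exactly one zero [f_e z] in the disc, and [f_e] is
   holomorphic from [D] to the disc. As [D] is open, [Re G_(phi s)] is strictly
   negative at [s], which forces [f_e (phi s)] to tend to [s] as [e] tends to 0:
   the Caratheodory distance along [phi] is at least the Poincare distance.

   Conversely let [s = 1/2]. The points [(Re psi 0, psi (c s) - psi 0)], with
   [psi] holomorphic from the disc to [D] and [c < 1], form a convex set, which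
   by Schwarz-Pick misses the point [(Re phi 0, phi s - phi 0)]. Separating them,
   [phi] maximizes some functional [A . Re psi 0 + Re (B . (psi s - psi 0))].
   The maps [phi l + (2 pi)^-1 int_E (x + l) / (x - l) (Re z dL - dmu)] have
   values in the closure of [D], so the functional is not larger there: the
   measure [(A + Re (B / (x - s))) . (Re z dL - dmu)] is negative, and so is its
   product with [|x - s|^2], which has the required form. *)

Require Import Defs.
From HB Require Import structures.
From mathcomp Require Import all_boot all_order all_algebra.
From mathcomp Require Import complex.
From mathcomp Require Import all_classical all_reals all_analysis.
From mathcomp Require Import measurable_realfun.
From mathcomp Require Import ring lra.

Set Implicit Arguments.
Unset Strict Implicit.
Unset Printing Implicit Defensive.

Import Order.TTheory GRing.Theory Num.Theory.
Import numFieldNormedType.Exports.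
Import Normc.

Local Open Scope classical_set_scope.
Local Open Scope ring_scope.
Local Open Scope complex_scope.

Local Notation Re := complex.Re.
Local Notation Im := complex.Im.
Local Notation ci := charge_integral.
Local Notation ciC := charge_integralC.
Local Notation signed_measure R := (charge (circle R) R).

(** * Complex differentiation *)

(** The bound [Re G <= 0] alone does not keep the zero of [l * G l + w - conjc w * l ^+ 2] inside
    the disc: [G l = 2 * l - 2] and [w = 1] give [(1 - l) ^+ 2]. The term [e l] makes the real part
    of the product with [conjc l] strictly negative near the circle. Existence of the zero then
    follows from the maximum principle, and so do lower bounds that give uniqueness and holomorphic
    dependence on [z]. No limit of the [f_e] is taken: the Caratheodory distance is a supremum, so
    maps nearly inverting [phi] at two prescribed points suffice. In the converse, testing a
    geodesic at two points only puts the separation into a real space of dimension [3 n]. The strict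
    [c < 1] keeps the extremal point outside the convex set; continuity restores [c = 1] afterwards.
    That the perturbed maps stay in the closure of [D] rests on half-spaces: a linear inequality for
    [phi] has to become one for its boundary measure. The sign of a measure is therefore recovered
    from that of its Poisson integral, by Lipschitz test functions and a Lusin approximation of
    indicators. *)

Section ComplexNorm.
Context {R : realType}.
Implicit Types z w : R[i].

Lemma norm_normc z : `|z| = (normc z)%:C.
Proof. by []. Qed.

Lemma Re_norm z : Re `|z| = normc z.
Proof. by []. Qed.

Lemma normc_ge0 z : 0 <= normc z.
Proof. by case: z => a b; exact: sqrtr_ge0. Qed.

Lemma sqr_normc_Re_Im z : normc z ^+ 2 = Re z ^+ 2 + Im z ^+ 2.
Proof. by case: z => a b; rewrite /normc sqr_sqrtr// addr_ge0 ?sqr_ge0. Qed.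

Lemma normc_conjc z : normc (conjc z) = normc z.
Proof. by case: z => a b; rewrite /normc /= sqrrN. Qed.

Lemma normc_real (x : R) : normc x%:C = `|x|.
Proof. by rewrite /normc /= expr0n addr0 sqrtr_sqr. Qed.

Lemma normc_eq0 z : (normc z == 0) = (z == 0).
Proof. by apply/eqP/eqP => [/eq0_normc//|->]; rewrite normc0. Qed.

Lemma normc_gt0 z : (0 < normc z) = (z != 0).
Proof. by rewrite lt_neqAle normc_ge0 andbT eq_sym normc_eq0. Qed.

Lemma normcB z w : normc (z - w) = normc (w - z).
Proof. by rewrite -normcN opprB. Qed.

Lemma normcX z n : normc (z ^+ n) = normc z ^+ n.
Proof.
elim: n => [|n ih]; first by rewrite !expr0 normc1.
by rewrite !exprS normcM ih.
Qed.

Lemma le_normc_ReIm z : normc z <= `|Re z| + `|Im z|.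
Proof.
rewrite -(@ler_pXn2r _ 2) ?nnegrE ?addr_ge0 ?normc_ge0//.
rewrite sqr_normc_Re_Im sqrrD !real_normK ?num_real// -addrA lerD2l lerDr.
by rewrite mulrn_wge0// mulr_ge0.
Qed.

Lemma ler_Re_normc z : `|Re z| <= normc z.
Proof.
rewrite -(@ler_pXn2r _ 2) ?nnegrE ?normc_ge0//.
by rewrite sqr_normc_Re_Im real_normK ?num_real// lerDl sqr_ge0.
Qed.

Lemma ler_Im_normc z : `|Im z| <= normc z.
Proof.
rewrite -(@ler_pXn2r _ 2) ?nnegrE ?normc_ge0//.
by rewrite sqr_normc_Re_Im real_normK ?num_real// lerDr sqr_ge0.
Qed.

Lemma cReD z w : Re (z + w) = Re z + Re w.
Proof. by case: z w => [? ?] []. Qed.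
Lemma cReN z : Re (- z) = - Re z.
Proof. by case: z. Qed.
Lemma cReB z w : Re (z - w) = Re z - Re w.
Proof. by rewrite cReD cReN. Qed.
Lemma cImD z w : Im (z + w) = Im z + Im w.
Proof. by case: z w => [? ?] []. Qed.
Lemma cImN z : Im (- z) = - Im z.
Proof. by case: z. Qed.
Lemma cImB z w : Im (z - w) = Im z - Im w.
Proof. by rewrite cImD cImN. Qed.
Lemma cReM z w : Re (z * w) =
  Re z * Re w - Im z * Im w.
Proof. by case: z w => [? ?] []. Qed.
Lemma cImM z w : Im (z * w) =
  Re z * Im w + Im z * Re w.
Proof. by case: z w => [? ?] []. Qed.
Lemma cReZ (x : R) z : Re (x%:C * z) = x * Re z.
Proof. by rewrite cReM /= mul0r subr0. Qed.
Lemma cImZ (x : R) z : Im (x%:C * z) = x * Im z.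
Proof. by rewrite cImM /= mul0r addr0. Qed.
Lemma Re_conjc z : Re (conjc z) = Re z.
Proof. by case: z. Qed.
Lemma Im_conjc z : Im (conjc z) = - Im z.
Proof. by case: z. Qed.

Lemma complex_eqP z w :
  Re z = Re w -> Im z = Im w -> z = w.
Proof. by case: z w => [? ?] [? ?] /= -> ->. Qed.

Lemma mulcJ z : z * conjc z = (normc z ^+ 2)%:C.
Proof. by rewrite sqr_normc_Re_Im; case: z => x y; apply: complex_eqP => /=; ring. Qed.

Lemma gt0cP (e : R[i]) : 0 < e -> exists2 x : R, 0 < x & e = x%:C.
Proof.
case: e => x y; rewrite ltcE /= => /andP[/eqP -> x0]; by exists x.
Qed.

(** The norm of [R[i]] is [R[i]]-valued. This equivalence and the two below replace it by the real
    [normc], so that all estimates become inequalities in [R]. *)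
Lemma nbhs_normcP z (P : set R[i]) :
  nbhs z P <-> exists2 e : R, 0 < e & forall w, normc (z - w) < e -> P w.
Proof.
split=> [/nbhs_ballP[_ /gt0cP[e e0 ->] zP]|[e e0 zP]].
  by exists e => // w zw; apply: zP; rewrite -ball_normE /ball_/= norm_normc ltcR.
apply/nbhs_ballP; exists e%:C; first by rewrite /= ltcR.
by move=> w; rewrite -ball_normE /ball_/= norm_normc ltcR; exact: zP.
Qed.

Lemma continuous_normcP (f : R[i] -> R[i]) z :
  {for z, continuous f} <-> forall e : R, 0 < e ->
  exists2 t : R, 0 < t & forall w, normc (z - w) < t -> normc (f z - f w) < e.
Proof.
split=> [cf e e0|cf].
  have /cf/nbhs_normcP[t t0 tP] : nbhs (f z) [set w | normc (f z - w) < e].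
    by apply/nbhs_normcP; exists e.
  by exists t.
by move=> P /nbhs_normcP[e e0 eP]; apply/nbhs_normcP; have [t t0 tP] := cf e e0;
  exists t => // w /tP; exact: eP.
Qed.

Lemma differentiable_normcP (f : R[i] -> R[i]) z :
  differentiable f z <-> exists d, forall e : R, 0 < e ->
  exists2 t : R, 0 < t & forall h, normc h < t ->
    normc (f (z + h) - f z - d * h) <= e * normc h.
Proof.
split=> [df|[d fd]].
  exists ('d f z 1) => e e0.
  have /eqaddoP := diff_locally df.
  have e0' : 0 < e%:C by rewrite ltcR.
  move=> /(_ _ e0')/nbhs_normcP[t t0 tP]; exists t => // h ht.
  have := tP h; rewrite sub0r normcN => /(_ ht) /=.
  rewrite !norm_normc -rmorphM lecR; congr (normc _ <= _).
  rewrite !fctE [h + z]addrC -/(_ + _) opprD addrA; congr (_ - _).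
  by rewrite -[X in 'd f z X]mulr1 [LHS]linearZ mulrC.
have dlin : linear (fun h : R[i] => d * h).
  by move=> a u v; rewrite mulrDr /GRing.scale /= mulrCA.
pose df : {linear R[i] -> R[i]} :=
  HB.pack (fun h : R[i] => d * h) (GRing.isLinear.Build _ _ _ _ _ dlin).
have cdf : continuous df.
  move=> x; apply/continuous_normcP => e e0; exists (e / (normc d + 1)).
    by rewrite divr_gt0// ltr_wpDl// normc_ge0.
  move=> w; rewrite ltr_pdivlMr ?ltr_wpDl ?normc_ge0//; apply: le_lt_trans.
  by rewrite -mulrBr normcM mulrC ler_wpM2l ?normc_ge0// lerDl.
have fE : f \o shift z = cst (f z) + df +o_ 0 id.
  apply/eqaddoP => _/gt0cP[e e0 ->]; have [t t0 tP] := fd e e0.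
  apply/nbhs_normcP; exists t => // h; rewrite sub0r normcN => /tP.
  rewrite !norm_normc -rmorphM lecR; congr (normc _ <= _).
  by rewrite !fctE /= [h + z]addrC opprD addrA.
apply/diff_locallyP; rewrite (diff_unique cdf fE); split => //.
Qed.

End ComplexNorm.

Section ComplexDifferentiable.
Context {R : realType} {V : normedModType R[i]}.
Implicit Types (f g : V -> R[i]).

Lemma dif_cst (a : R[i]) (z : V) : differentiable (fun _ : V => a) z.
Proof. exact: differentiable_cst. Qed.

Lemma difD f g z : differentiable f z -> differentiable g z ->
  differentiable (fun x => f x + g x) z.
Proof. by move=> ? ?; exact: differentiableD. Qed.

Lemma difB f g z : differentiable f z -> differentiable g z ->
  differentiable (fun x => f x - g x) z.
Proof. by move=> ? ?; exact: differentiableB. Qed.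

Lemma difN f z : differentiable f z -> differentiable (fun x => - f x) z.
Proof. by move=> ?; exact: differentiableN. Qed.

Lemma difM f g z : differentiable f z -> differentiable g z ->
  differentiable (fun x => f x * g x) z.
Proof. by move=> ? ?; exact: differentiableM. Qed.

Lemma difV f z : differentiable f z -> f z != 0 ->
  differentiable (fun x => (f x)^-1) z.
Proof. by move=> ? ?; exact: differentiableV. Qed.

Lemma dif_comp (U W : normedModType R[i]) (f : U -> V) (g : V -> W) (z : U) :
  differentiable f z -> differentiable g (f z) ->
  differentiable (fun x => g (f x)) z.
Proof. by move=> df dg; exact: (@differentiable_comp _ _ _ _ f g). Qed.

Lemma dif_sum n (f : 'I_n -> V -> R[i]) (z : V) :
  (forall i, differentiable (f i) z) ->
  differentiable (fun x => \sum_(i < n) f i x) z.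
Proof.
move=> df; have -> : (fun x => \sum_(i < n) f i x) = \sum_(i < n) f i.
  by apply/funext => x; rewrite fct_sumE.
exact: differentiable_sum.
Qed.

End ComplexDifferentiable.

Lemma dif_id {R : realType} {V : normedModType R[i]} (z : V) :
  differentiable (fun x : V => x) z.
Proof. exact: (@ex_diff _ _ _ _ _ (@idfun V)). Qed.

Lemma dif_coord {R : realType} n (j : 'I_n) (z : 'rV[R[i]]_n) :
  differentiable (fun x : 'rV[R[i]]_n => x 0 j) z.
Proof. exact: differentiable_coord. Qed.

Lemma dif_entry {R : realType} {V : normedModType R[i]} n (f : V -> 'rV[R[i]]_n) j z :
  differentiable f z -> differentiable (fun x => f x 0 j) z.
Proof. by move=> df; apply: (@dif_comp _ _ _ _ f (fun x => x 0 j)) df _; exact: dif_coord. Qed.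

(** * Cauchy's theorem and the maximum principle *)

Lemma four_pigeonhole (K : realFieldType) (m A B C D : K) :
  m <= `|A + B + (C + D)| ->
  m / 4 <= `|A| \/ m / 4 <= `|B| \/ m / 4 <= `|C| \/ m / 4 <= `|D|.
Proof.
have := ler_normD (A + B) (C + D); have := ler_normD A B; have := ler_normD C D.
case: (lerP (m / 4) `|A|); first by left.
case: (lerP (m / 4) `|B|); first by right; left.
case: (lerP (m / 4) `|C|); first by right; right; left.
case: (lerP (m / 4) `|D|); first by right; right; right.
by lra.
Qed.

(** Goursat's subdivision, for any rectangle function [J] additive under both kinds of cut. If
    [J a b c d] were nonzero, quartering would give nested rectangles on which the modulus keeps at
    least the share [4^-k], whereas near their common point [J] is small compared with the square of
    the side lengths. *)
Lemma bisection (R : realType) (J : R -> R -> R -> R -> R) (a b c d : R) :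
  a <= b -> c <= d ->
  (forall a' m b' c' d', a <= a' -> a' <= m -> m <= b' -> b' <= b ->
     c <= c' -> c' <= d' -> d' <= d ->
     J a' b' c' d' = J a' m c' d' + J m b' c' d') ->
  (forall a' b' c' m d', a <= a' -> a' <= b' -> b' <= b ->
     c <= c' -> c' <= m -> m <= d' -> d' <= d ->
     J a' b' c' d' = J a' b' c' m + J a' b' m d') ->
  (forall x y, a <= x <= b -> c <= y <= d -> forall e, 0 < e ->
     exists2 t, 0 < t & forall a' b' c' d', a <= a' -> a' <= x -> x <= b' ->
       b' <= b -> c <= c' -> c' <= y -> y <= d' -> d' <= d ->
       b' - a' < t -> d' - c' < t ->
       `|J a' b' c' d'| <= e * ((b' - a') + (d' - c')) ^+ 2) ->
  J a b c d = 0.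
Proof.
move=> ab cd Jx Jy Jloc; apply/eqP; apply/negPn/negP => J0.
set w := b - a; set h := d - c.
have w0 : 0 <= w by rewrite subr_ge0.
have h0 : 0 <= h by rewrite subr_ge0.
pose s (k : nat) : R := 2^-1 ^+ k.
have s0 k : 0 < s k by rewrite exprn_gt0// invr_gt0 ltr0n.
have sS k : s k.+1 = s k / 2 by rewrite /s exprS mulrC.
pose Q k (p : R * R) := [/\ a <= p.1, p.1 + w * s k <= b, c <= p.2,
  p.2 + h * s k <= d & `|J a b c d| * (4^-1) ^+ k <=
  `|J p.1 (p.1 + w * s k) p.2 (p.2 + h * s k)|].
pose child k (p p' : R * R) := [/\ p.1 <= p'.1,
  p'.1 + w * s k.+1 <= p.1 + w * s k, p.2 <= p'.2
  & p'.2 + h * s k.+1 <= p.2 + h * s k].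
have step k p : Q k p -> exists p', Q k.+1 p' /\ child k p p'.
  case: p => x y [/= ax xb cy yd Jk].
  have ws0 : 0 <= w * s k.+1 by rewrite mulr_ge0// ltW.
  have hs0 : 0 <= h * s k.+1 by rewrite mulr_ge0// ltW.
  have wE : w * s k = w * s k.+1 + w * s k.+1 by rewrite sS; lra.
  have hE : h * s k = h * s k.+1 + h * s k.+1 by rewrite sS; lra.
  set w' := w * s k.+1 in ws0 wE; set h' := h * s k.+1 in hs0 hE.
  rewrite wE hE in xb yd Jk.
  have E : J x (x + (w' + w')) y (y + (h' + h')) =
    J x (x + w') y (y + h') + J x (x + w') (y + h') (y + h' + h') +
    (J (x + w') (x + w' + w') y (y + h') +
     J (x + w') (x + w' + w') (y + h') (y + h' + h')).
    clear - Jx Jy ax xb cy yd ws0 hs0.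
    have xw : x <= x + w' by rewrite lerDl.
    have xw2 : x + w' <= x + w' + w' by rewrite lerDl.
    have yh : y <= y + h' by rewrite lerDl.
    have yh2 : y + h' <= y + h' + h' by rewrite lerDl.
    rewrite !addrA in xb yd *.
    have axw := le_trans ax xw; have xwb := le_trans xw2 xb.
    have yhd := le_trans yh2 yd; have yhd2 := le_trans yh yh2.
    by rewrite (Jx x (x + w') _ _ _ ax xw xw2 xb cy yhd2 yd)
      (Jy x _ y (y + h') _ ax xw xwb cy yh yh2 yd)
      (Jy (x + w') _ y (y + h') _ axw xw2 xb cy yh yh2 yd) !addrA.
  have e4 : 4^-1 ^+ k.+1 = 4^-1 ^+ k / 4 :> R by rewrite exprS mulrC.
  have gt : `|J a b c d| * 4^-1 ^+ k.+1 <= `|J x (x + w') y (y + h')| \/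
     `|J a b c d| * 4^-1 ^+ k.+1 <= `|J x (x + w') (y + h') (y + h' + h')| \/
     `|J a b c d| * 4^-1 ^+ k.+1 <= `|J (x + w') (x + w' + w') y (y + h')| \/
     `|J a b c d| * 4^-1 ^+ k.+1 <=
       `|J (x + w') (x + w' + w') (y + h') (y + h' + h')|.
    rewrite e4 mulrA; apply: four_pigeonhole; by rewrite -E.
  clear E Jx Jy Jloc Jk; case: gt => [g|[g|[g|g]]].
  - by exists (x, y); rewrite /Q /child /= -/w' -/h' ?wE ?hE; do !split; lra.
  - by exists (x, y + h'); rewrite /Q /child /= -/w' -/h' ?wE ?hE; do !split; lra.
  - by exists (x + w', y); rewrite /Q /child /= -/w' -/h' ?wE ?hE; do !split; lra.
  - by exists (x + w', y + h'); rewrite /Q /child /= -/w' -/h' ?wE ?hE; do !split; lra.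
pose next k p := xget p [set p' | Q k.+1 p' /\ child k p p'].
have nextP k p : Q k p -> Q k.+1 (next k p) /\ child k p (next k p).
  by move=> /step [p' p'P]; rewrite /next; case: xgetP => [q _ //|/(_ p')/(_ p'P)].
pose p := fix p k := if k is k'.+1 then next k' (p k') else (a, c).
have Qp k : Q k (p k).
  elim: k => [|k /nextP[]//]; rewrite /Q /= /s expr0 !mulr1 /w /h.
  by rewrite !subrKC !lexx.
have chp k : child k (p k) (p k.+1) by have [] := nextP k _ (Qp k).
have mono k m : (p k).1 <= (p (k + m)%N).1 /\ (p k).2 <= (p (k + m)%N).2 /\
    (p (k + m)%N).1 + w * s (k + m)%N <= (p k).1 + w * s k /\
    (p (k + m)%N).2 + h * s (k + m)%N <= (p k).2 + h * s k.
  elim: m => [|m [? [? [? ?]]]]; first by rewrite addn0 !lexx.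
  rewrite addnS; have [] := chp (k + m)%N => *; do !split; lra.
(* Left and lower ends at any level lie below right and upper ends at any other, so the suprema of
   the former give a common point. *)
have cross k m : (p m).1 <= (p k).1 + w * s k /\ (p m).2 <= (p k).2 + h * s k.
  have [km|/ltnW mk] := leqP k m.
    have := mono k (m - k)%N; rewrite subnKC// => -[_ [_ []]].
    have : 0 <= w * s m by rewrite mulr_ge0// ltW.
    have : 0 <= h * s m by rewrite mulr_ge0// ltW.
    by lra.
  have := mono m (k - m)%N; rewrite subnKC// => -[? [? _]].
  have : 0 <= w * s k by rewrite mulr_ge0// ltW.
  have : 0 <= h * s k by rewrite mulr_ge0// ltW.
  by lra.
have lub (f g : nat -> R) : (forall k m, f m <= g k) ->
    exists x, forall k, f k <= x <= g k.
  move=> fg; exists (sup (range f)) => k; apply/andP; split.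
    apply: ub_le_sup; first by exists (g 0%N) => _ [m _ <-].
    by exists k.
  apply: ge_sup; first by exists (f 0%N), 0%N.
  by move=> _ [m _ <-].
have [x xP] := lub (fun k => (p k).1) (fun k => (p k).1 + w * s k)
  (fun k m => (cross k m).1).
have [y yP] := lub (fun k => (p k).2) (fun k => (p k).2 + h * s k)
  (fun k m => (cross k m).2).
have xab : a <= x <= b.
  have := xP 0%N; rewrite /= /s expr0 mulr1 /w; lra.
have ycd : c <= y <= d.
  have := yP 0%N; rewrite /= /s expr0 mulr1 /h; lra.
have Jgt : 0 < `|J a b c d| by rewrite normr_gt0.
(* With this choice [e * (w + h) ^+ 2] is strictly below the modulus of [J a b c d], also for a
   degenerate rectangle. *)
pose e := `|J a b c d| / (2 * ((w + h) ^+ 2 + 1)).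
have wh : 0 < (w + h) ^+ 2 + 1 by rewrite ltr_wpDl// sqr_ge0.
have e0 : 0 < e by rewrite divr_gt0// mulr_gt0.
have [t t0 tP] := Jloc x y xab ycd e e0.
have [k kP] : exists k, (w + h) * s k < t.
  have : s @ \oo --> (0 : R).
    by apply: cvg_expr; rewrite ger0_norm ?invr_ge0// invf_lt1// ltr1n.
  move=> s0'; have : (fun k => (w + h) * s k) @ \oo --> (w + h) * 0.
    by apply: cvgM => //; exact: cvg_cst.
  rewrite mulr0 => /cvgrPdist_lt/(_ _ t0) [N _ /(_ N)].
  rewrite /= leqnn => /(_ isT); rewrite sub0r normrN => lt; exists N.
  by rewrite (le_lt_trans (ler_norm _)).
have [/= ap pb cp pd le2] := Qp k.
have := xP k; have := yP k => /andP[p2y yp2] /andP[p1x xp1].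
have ws0 : 0 <= w * s k by rewrite mulr_ge0// ltW.
have hs0 : 0 <= h * s k by rewrite mulr_ge0// ltW.
have e1 : (p k).1 + w * s k - (p k).1 = w * s k by clear; ring.
have e2 : (p k).2 + h * s k - (p k).2 = h * s k by clear; ring.
have lt1 : (p k).1 + w * s k - (p k).1 < t.
  by have := kP; rewrite e1 mulrDl; clear -hs0; lra.
have lt2 : (p k).2 + h * s k - (p k).2 < t.
  by have := kP; rewrite e2 mulrDl; clear -ws0; lra.
have := tP _ _ _ _ ap p1x xp1 pb cp p2y yp2 pd lt1 lt2.
rewrite e1 e2 => le1.
have s4 : 4^-1 ^+ k = s k ^+ 2.
  by rewrite /s -exprM mulnC exprM; congr (_ ^+ _); rewrite expr2 -invfM -natrM.
have : `|J a b c d| * s k ^+ 2 <= e * (w * s k + h * s k) ^+ 2.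
  rewrite -s4; exact: le_trans le2 le1.
have -> : e * (w * s k + h * s k) ^+ 2 = e * (w + h) ^+ 2 * s k ^+ 2.
  by clear; ring.
rewrite ler_pM2r ?exprn_gt0// leNgt => /negP; apply.
rewrite /e mulrAC ltr_pdivrMr ?mulr_gt0// -subr_gt0.
have -> : `|J a b c d| * (2 * ((w + h) ^+ 2 + 1)) - `|J a b c d| * (w + h) ^+ 2 =
  `|J a b c d| * ((w + h) ^+ 2 + 2) by ring.
by rewrite mulr_gt0// ltr_wpDl// sqr_ge0.
Qed.

Section Goursat.
Context {R : realType}.
Local Notation mu := (@lebesgue_measure R).
Definition intR (f : R -> R) (a b : R) := \int[mu]_(x in `[a, b]) f x.

Definition seg_cont (f : R -> R) (a b : R) :=
  forall x, a <= x <= b -> {for x, continuous f}.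

Lemma seg_cont_integrable f a b : seg_cont f a b ->
  mu.-integrable `[a, b] (EFin \o f).
Proof.
move=> cf; apply: continuous_compact_integrable; first exact: segment_compact.
apply: continuous_in_subspaceT => x; rewrite inE /= in_itv /=; exact: cf.
Qed.

Lemma seg_contB f g a b : seg_cont f a b -> seg_cont g a b ->
  seg_cont (fun x => f x - g x) a b.
Proof. by move=> cf cg x xab; apply: continuousB; [exact: cf|exact: cg]. Qed.

Lemma seg_cont_sub f a b a' b' : a <= a' -> b' <= b -> seg_cont f a b ->
  seg_cont f a' b'.
Proof.
move=> aa bb cf x /andP[ax xb]; apply: cf.
by rewrite (le_trans aa)//= (le_trans xb).
Qed.

Lemma int_split f a m b : a <= m -> m <= b -> seg_cont f a b ->
  intR f a b = intR f a m + intR f m b.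
Proof.
move=> am mb cf.
rewrite /intR; have := @Rintegral_itvB R f (BLeft a) (BRight b) m.
rewrite !bnd_simp am mb => /(_ (seg_cont_integrable cf) isT isT).
rewrite Rintegral_itv_obnd_cbnd; first by move=> <-; rewrite addrC subrK.
have := seg_cont_integrable (seg_cont_sub am (lexx b) cf).
by apply: integrableS => //; apply: subset_itvr; rewrite bnd_simp.
Qed.

Lemma int_cst (r a b : R) : a <= b -> intR (fun=> r) a b = r * (b - a).
Proof.
move=> ab; rewrite /intR Rintegral_cst//= lebesgue_measure_itv /= lte_fin.
move: ab; rewrite le_eqVlt => /predU1P[->|ab]; first by rewrite ltxx subrr.
by rewrite ab.
Qed.

Lemma int_near_cst f (r e a b : R) : a <= b -> seg_cont f a b ->
  (forall x, a <= x <= b -> `|f x - r| <= e) ->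
  `|intR f a b - r * (b - a)| <= e * (b - a).
Proof.
move=> ab cf fr.
have ir := seg_cont_integrable (fun x _ => @cst_continuous R R r x : {for x, continuous (fun=> r)}).
have ie := seg_cont_integrable (fun x _ => @cst_continuous R R e x : {for x, continuous (fun=> e)}).
have icf := seg_cont_integrable cf.
rewrite -!int_cst// /intR -RintegralB//.
have ib : mu.-integrable `[a, b] (EFin \o (fun x => f x - r)).
  by apply: seg_cont_integrable; apply: seg_contB => // x _; exact: cst_continuous.
apply: le_trans (le_normr_Rintegral _ ib) _ => //.
by apply: le_Rintegral => //; exact: (integrable_norm ib).
Qed.

(* The real form of Cauchy's theorem on a rectangle: U and V satisfy one of the
   two Cauchy-Riemann equations, pointwise and without any regularity of the
   partial derivatives. *)
Lemma goursat (U V : R -> R -> R) (a b c d : R) : a <= b -> c <= d ->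
  (forall x y, a <= x <= b -> c <= y <= d -> exists u1 u2 v1, forall e, 0 < e ->
    exists2 t, 0 < t & forall x' y', `|x' - x| < t -> `|y' - y| < t ->
    `|U x' y' - U x y - u1 * (x' - x) - u2 * (y' - y)|
      <= e * (`|x' - x| + `|y' - y|) /\
    `|V x' y' - V x y - v1 * (x' - x) - u1 * (y' - y)|
      <= e * (`|x' - x| + `|y' - y|)) ->
  intR (U b) c d - intR (U a) c d =
  intR (fun x => V x d) a b - intR (fun x => V x c) a b.
Proof.
move=> ab cd loc.
have cts : forall x y, a <= x <= b -> c <= y <= d ->
    {for y, continuous (U x)} /\ {for x, continuous (V ^~ y)}.
  move=> x y xab ycd; have [u1 [u2 [v1 uv]]] := loc x y xab ycd.
  have [t t0 tP] := uv 1 ltr01.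
  have aux (f : R -> R) (z k : R) : (forall w, `|w - z| < t ->
      `|f w - f z - k * (w - z)| <= `|w - z|) -> {for z, continuous f}.
    move=> fP; apply/cvgrPdist_lt => e e0.
    have k1 : 0 < `|k| + 1 by rewrite ltr_wpDl.
    apply/nbhs_ballP; exists (Num.min t (e / (`|k| + 1))).
      by rewrite /= lt_min t0 divr_gt0.
    move=> w; rewrite /ball /= lt_min (distrC z w) => /andP[wt].
    rewrite ltr_pdivlMr// (distrC (f z)); apply: le_lt_trans.
    have -> : f w - f z = f w - f z - k * (w - z) + k * (w - z) by ring.
    have -> : `|w - z| * (`|k| + 1) = `|w - z| + `|k| * `|w - z| by clear; ring.
    by rewrite (le_trans (ler_normD _ _))// normrM lerD// fP.
  have tt (z : R) : `|z - z| < t by rewrite subrr normr0.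
  split; [apply: (aux _ _ u2) => y' y't|apply: (aux _ _ v1) => x' x't].
    have [+ _] := tP x y' (tt x) y't.
    by rewrite !subrr normr0 add0r mulr0 subr0 mul1r.
  have [_ +] := tP x' y x't (tt y).
  by rewrite !subrr normr0 addr0 mulr0 subr0 mul1r.
have cU x a' b' : a <= x <= b -> c <= a' -> b' <= d -> seg_cont (U x) a' b'.
  move=> xab ca bd y /andP[ay yb]; apply: (cts x y xab _).1.
  by rewrite (le_trans ca)// (le_trans yb).
have cV y a' b' : c <= y <= d -> a <= a' -> b' <= b -> seg_cont (V ^~ y) a' b'.
  move=> ycd ca bd x /andP[ay yb]; apply: (cts x y _ ycd).2.
  by rewrite (le_trans ca)// (le_trans yb).
(* The defect of the identity. On a small rectangle the affine approximations of [U] and [V]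
   contribute [u1 * w * h] to each of the two differences, so they cancel in [J]; this is where the
   shared coefficient [u1] enters. *)
pose J a' b' c' d' := intR (U b') c' d' - intR (U a') c' d' -
  (intR (V ^~ d') a' b' - intR (V ^~ c') a' b').
apply/eqP; rewrite -subr_eq0 -/(J a b c d); apply/eqP; apply: bisection => //.
- move=> a' m b' c' d' aa am mb bb cc cd' dd; rewrite /J.
  rewrite (@int_split (V ^~ d') a' m b')// ?(@int_split (V ^~ c') a' m b')//.
  + by clear; ring.
  + by apply: cV => //; rewrite cc (le_trans cd').
  + by apply: cV => //; rewrite dd andbT (le_trans cc).
- move=> a' b' c' m d' aa ab' bb cc cm md dd; rewrite /J.
  rewrite (@int_split (U b') c' m d')// ?(@int_split (U a') c' m d')//.
  + by clear; ring.
  + by apply: cU => //; rewrite aa (le_trans ab').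
  + by apply: cU => //; rewrite bb andbT (le_trans aa).
- move=> x y xab ycd e e0; have [u1 [u2 [v1 uv]]] := loc x y xab ycd.
  have e2 : 0 < e / 2 by rewrite divr_gt0.
  have [t t0 tP] := uv (e / 2) e2; exists t => //.
  move=> a' b' c' d' aa ax xb bb cc cy yd dd.
  set w := b' - a'; set h := d' - c' => wt ht.
  have ab' := le_trans ax xb; have cd' := le_trans cy yd.
  have w0 : 0 <= w by rewrite subr_ge0.
  have h0 : 0 <= h by rewrite subr_ge0.
  have dx x' : a' <= x' <= b' -> `|x' - x| <= w.
    by rewrite /w; clear -ax xb; rewrite ler_norml => ?; apply/andP; split; lra.
  have dy y' : c' <= y' <= d' -> `|y' - y| <= h.
    by rewrite /h; clear -cy yd; rewrite ler_norml => ?; apply/andP; split; lra.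
  have a'i : a' <= a' <= b' by rewrite lexx.
  have b'i : a' <= b' <= b' by rewrite lexx andbT.
  have c'i : c' <= c' <= d' by rewrite lexx.
  have d'i : c' <= d' <= d' by rewrite lexx andbT.
  have near x' y' : a' <= x' <= b' -> c' <= y' <= d' ->
      `|U x' y' - U x y - u1 * (x' - x) - u2 * (y' - y)| <= e / 2 * (w + h) /\
      `|V x' y' - V x y - v1 * (x' - x) - u1 * (y' - y)| <= e / 2 * (w + h).
    move=> /dx xw /dy yh; have [] := tP _ _ (le_lt_trans xw wt) (le_lt_trans yh ht).
    have : e / 2 * (`|x' - x| + `|y' - y|) <= e / 2 * (w + h).
      by rewrite ler_wpM2l ?lerD// ltW.
    by move=> le ? ?; split; exact: le_trans le.
  have tri (p q r : R) : `|p| <= r -> `|q| <= r -> `|p - q| <= 2 * r.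
    move=> pr qr; rewrite mulr2n mulrDl !mul1r.
    by rewrite (le_trans (ler_normB _ _))// lerD.
  have JU : `|intR (U b') c' d' - intR (U a') c' d' - u1 * w * h|
      <= e * (w + h) * h.
    rewrite /intR -RintegralB//; last 2 first.
      by apply/seg_cont_integrable/cU => //; rewrite bb andbT (le_trans aa).
      by apply/seg_cont_integrable/cU => //; rewrite aa (le_trans ab').
    apply: int_near_cst => //.
      by apply: seg_contB; apply: cU => //; rewrite ?aa ?bb ?(le_trans ab' bb)// andbT (le_trans aa).
    move=> y' y'i; have [+ _] := near b' y' b'i y'i; have [+ _] := near a' y' a'i y'i.
    move=> /tri/[apply]; rewrite distrC => H.
    have -> : e * (w + h) = 2 * (e / 2 * (w + h)) by field.
    by apply: le_trans H; rewrite le_eqVlt; apply/orP; left; apply/eqP; congr `|_|; rewrite /w; clear; ring.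
  have JV : `|intR (V ^~ d') a' b' - intR (V ^~ c') a' b' - u1 * h * w|
      <= e * (w + h) * w.
    rewrite /intR -RintegralB//; last 2 first.
      by apply/seg_cont_integrable/cV => //; rewrite dd andbT (le_trans cc).
      by apply/seg_cont_integrable/cV => //; rewrite cc (le_trans cd').
    apply: int_near_cst => //.
      by apply: seg_contB; apply: cV => //; rewrite ?cc ?dd ?(le_trans cd' dd)// andbT (le_trans cc).
    move=> x' x'i; have [_ +] := near x' d' x'i d'i; have [_ +] := near x' c' x'i c'i.
    move=> /tri/[apply]; rewrite distrC => H.
    have -> : e * (w + h) = 2 * (e / 2 * (w + h)) by field.
    by apply: le_trans H; rewrite le_eqVlt; apply/orP; left; apply/eqP; congr `|_|; rewrite /h; clear; ring.
  rewrite /J.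
  have -> : e * (w + h) ^+ 2 = e * (w + h) * h + e * (w + h) * w by clear; ring.
  apply: le_trans (lerD JU JV).
  apply: le_trans (ler_normB _ _).
  rewrite le_eqVlt; apply/orP; left; apply/eqP; congr `|_|; clear; ring.
Qed.

End Goursat.

(** * The complex exponential *)

Section ComplexExponential.
Context {R : realType}.

Lemma is_derive_bound (f : R -> R) (x d e : R) : is_derive x 1 f d -> 0 < e ->
  exists2 t, 0 < t & forall h, `|h| < t -> `|f (x + h) - f x - d * h| <= e * `|h|.
Proof.
move=> [df fd] e0; have dif : differentiable f x by exact/derivable1_diffP.
have /eqaddoP/(_ _ e0)/nbhs_ballP[t t0 tP] := diff_locally dif.
exists t => // h ht; have := tP h; rewrite /ball /= sub0r normrN => /(_ ht).
congr (`|_| <= _); rewrite !fctE /= [h + x]addrC opprD addrA; congr (_ - _).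
have -> : 'd f x h = h *: 'd f x 1 by rewrite -linearZ /GRing.scale /= mulr1.
by rewrite -deriveE// fd mulrC.
Qed.

Definition cexp (w : R[i]) : R[i] := (expR (Re w))%:C * expi (Im w).

Lemma expiD (s t : R) : expi (s + t) = expi s * expi t.
Proof. by apply: complex_eqP; rewrite /= ?cosD ?sinD//; ring. Qed.

Lemma normc_expi (t : R) : normc (expi t) = 1.
Proof. by rewrite /normc /= cos2Dsin2 sqrtr1. Qed.

Lemma cexpD z w : cexp (z + w) = cexp z * cexp w.
Proof. by rewrite /cexp cReD cImD expRD expiD rmorphM /= mulrACA. Qed.

Lemma normc_cexp w : normc (cexp w) = expR (Re w).
Proof. by rewrite normcM normc_expi mulr1 normc_real ger0_norm// expR_ge0. Qed.

Lemma cexp0_dif (e : R) : 0 < e -> exists2 t, 0 < t & forall h : R[i],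
  normc h < t -> normc (cexp h - 1 - h) <= e * normc h.
Proof.
(* The error is at most [6 * (e' * n)]: twice [e' * n] for each of the [cos] and [sin] terms, which
   carry a factor [expR a <= 2], and once for each of the two remaining terms. *)
move=> e0; pose e' := e / 7.
have e'0 : 0 < e' by rewrite divr_gt0.
have [t1 t10 t1P] := is_derive_bound (is_derive_expR (0 : R)) e'0.
have [t2 t20 t2P] := is_derive_bound (is_derive_cos (0 : R)) e'0.
have [t3 t30 t3P] := is_derive_bound (is_derive_sin (0 : R)) e'0.
have ln20 : 0 < ln 2 :> R by rewrite ln_gt0// ltr1n.
exists (Num.min (Num.min t1 t2) (Num.min t3 (Num.min (e' / (1 + e')) (ln 2)))).
  by rewrite !lt_min t10 t20 t30 ln20 divr_gt0// addr_gt0.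
case=> a b; set n := normc _; rewrite !lt_min.
move=> /andP[/andP[nt1 nt2] /andP[nt3 /andP[nt4 nt5]]].
have an : `|a| <= n := ler_Re_normc (a +i* b).
have bn : `|b| <= n := ler_Im_normc (a +i* b).
have n0 : 0 <= n by exact: normc_ge0.
have := t1P a (le_lt_trans an nt1); have := t2P b (le_lt_trans bn nt2).
have := t3P b (le_lt_trans bn nt3).
rewrite !add0r expR0 cos0 sin0 !subr0 mul1r oppr0 mul0r subr0.
rewrite -[X in `|_ - X * _|]cos0 cos0 mul1r => Hs Hc He.
have ea2 : expR a <= 2.
  rewrite -[leRHS](@lnK _ 2) ?posrE// ler_expR.
  by rewrite (le_trans (ler_norm _))// (le_trans an)// ltW.
have ea1 : `|expR a - 1| <= e'.
  have -> : expR a - 1 = (expR a - 1 - a) + a by ring.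
  rewrite (le_trans (ler_normD _ _))// (le_trans (lerD He (lexx _)))//.
  have -> : e' * `|a| + `|a| = `|a| * (1 + e') by ring.
  by rewrite -ler_pdivlMr ?addr_gt0// (le_trans an)// ltW.
rewrite (le_trans (le_normc_ReIm _))// !(cReB, cImB) /=.
rewrite [X in `|X| + _](_ : _ = expR a * (cos b - 1) + (expR a - 1 - a)); last by ring.
rewrite [X in _ + `|X|](_ : _ = expR a * (sin b - b) + (expR a - 1) * b); last by ring.
have ea0 : 0 <= expR a by exact: expR_ge0.
have H1 : `|expR a * (cos b - 1)| <= 2 * (e' * n).
  rewrite normrM ler_pM// ?(ger0_norm ea0)// (le_trans Hc)//.
  by rewrite ler_pM2l.
have H2 : `|expR a * (sin b - b)| <= 2 * (e' * n).
  rewrite normrM ler_pM// ?(ger0_norm ea0)// (le_trans Hs)//.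
  by rewrite ler_pM2l.
have H3 : `|(expR a - 1) * b| <= e' * n by rewrite normrM ler_pM.
have H4 : `|expR a - 1 - a| <= e' * n by rewrite (le_trans He)// ler_pM2l.
apply: (@le_trans _ _ (6 * (e' * n))).
  have := ler_normD (expR a * (cos b - 1)) (expR a - 1 - a).
  have := ler_normD (expR a * (sin b - b)) ((expR a - 1) * b).
  clear -H1 H2 H3 H4; lra.
have -> : e * n = 7 * (e' * n) by rewrite /e'; field.
have : 0 <= e' * n by rewrite mulr_ge0// ltW.
by clear; lra.
Qed.

Lemma differentiable_cexp w : differentiable cexp w.
Proof.
apply/differentiable_normcP; exists (cexp w) => e e0.
have w0 : 0 < normc (cexp w) by rewrite normc_cexp expR_gt0.
have [t t0 tP] := cexp0_dif (divr_gt0 e0 w0); exists t => // h /tP.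
have -> : cexp (w + h) - cexp w - cexp w * h = cexp w * (cexp h - 1 - h).
  by rewrite cexpD; ring.
by rewrite mulrAC ler_pdivlMr// => H; rewrite normcM mulrC.
Qed.

End ComplexExponential.

(** * Mean values over circles *)

Section MeanValue.
Context {R : realType}.
Implicit Types (q : R[i] -> R[i]) (c : R[i]).

(* Cauchy's theorem in the coordinates c + rho exp (x + i y), where the circles
   centred at c are segments and the excluded point c is at infinity. *)
Lemma circle_mean_indep q c (rho r' x1 : R) : 0 < rho -> rho < r' -> x1 <= 0 ->
  (forall z, 0 < normc (z - c) -> normc (z - c) < r' -> differentiable q z) ->
  intR (fun y => Re (q (c + rho%:C * cexp (0 +i* y)))) 0 (2 * pi) =
  intR (fun y => Re (q (c + rho%:C * cexp (x1 +i* y)))) 0 (2 * pi).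
Proof.
move=> rho0 rhor' x10 dq.
pose F (w : R[i]) := q (c + rho%:C * cexp w).
have dF w : Re w <= 0 -> differentiable F w.
  move=> w0; apply: (@dif_comp _ _ _ _ (fun w => c + rho%:C * cexp w) q).
    by apply: difD; [exact: dif_cst|apply: difM; [exact: dif_cst|exact: differentiable_cexp]].
  rewrite -subr_gt0 in rhor'.
  have E : normc (c + rho%:C * cexp w - c) = rho * expR (Re w).
    by rewrite addrAC subrr add0r normcM normc_real normc_cexp ger0_norm// ltW.
  apply: dq; rewrite E ?mulr_gt0 ?expR_gt0//.
  rewrite -subr_gt0 (lt_le_trans rhor')// lerB// ler_piMr ?(ltW rho0)//.
  by rewrite -expR0 ler_expR.
have pi2 : 0 <= 2 * pi :> R by rewrite mulr_ge0// pi_ge0.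
have := @goursat _ (fun x y => Re (F (x +i* y)))
  (fun x y => Im (F (x +i* y))) x1 0 0 (2 * pi) x10 pi2.
(* The sides [y = 0] and [y = 2 * pi] have the same image, so their contributions cancel. *)
have -> : (fun x : R => Im (F (x +i* (2 * pi)))) =
          (fun x : R => Im (F (x +i* 0))).
  apply/funext => x; rewrite /F /cexp /= /expi.
  by rewrite cos0 sin0 (mulr2n (1 : R)) mulrDl mul1r -mulr2n cos2pi sin2pi.
rewrite subrr => H; apply/eqP; rewrite -subr_eq0; apply/eqP; apply: H.
move=> x y /andP[_ x0] _; have /differentiable_normcP[d dP] := dF (x +i* y) x0.
exists (Re d), (- Im d), (Im d) => e e0.
have [t t0 tP] := dP e e0; exists (t / 2); first by rewrite divr_gt0.
move=> x' y' xx yy; pose h := (x' - x) +i* (y' - y).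
have hl : normc h <= `|x' - x| + `|y' - y| := le_normc_ReIm h.
have /tP : normc h < t by rewrite (le_lt_trans hl)// (splitr t) ltrD.
have -> : x +i* y + h = x' +i* y' by apply: complex_eqP; rewrite /= addrC subrK.
set X := _ - _ - _ => XP.
have {}XP : normc X <= e * (`|x' - x| + `|y' - y|).
  by rewrite (le_trans XP)// ler_pM2l.
split; [apply: le_trans (le_trans (ler_Re_normc X) XP)|
        apply: le_trans (le_trans (ler_Im_normc X) XP)].
  by rewrite /X /h !cReB cReM /= le_eqVlt; apply/orP; left; apply/eqP; congr `|_|; ring.
by rewrite /X /h !cImB cImM /= le_eqVlt; apply/orP; left; apply/eqP; congr `|_|; ring.
Qed.

(** Independence of the radius lets the circle shrink to [c], where continuity decides. The
    assumption at [c] is mere continuity so that the result applies to the quotients produced by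
    [removable]. *)
Lemma circle_mean q c (rho r' : R) : 0 < rho -> rho < r' ->
  (forall z, 0 < normc (z - c) -> normc (z - c) < r' -> differentiable q z) ->
  {for c, continuous q} ->
  intR (fun y => Re (q (c + rho%:C * expi y))) 0 (2 * pi) =
  2 * pi * Re (q c).
Proof.
move=> rho0 rhor' dq cq; apply/eqP; rewrite -subr_eq0; apply/eqP.
set I := intR _ _ _.
have pi0 : 0 < 2 * pi :> R by rewrite mulr_gt0// pi_gt0.
suff H e : 0 < e -> `|I - Re (q c) * (2 * pi)| <= e * (2 * pi).
  apply/eqP; rewrite -normr_le0 (mulrC (2 * pi)); apply/ler_addgt0Pr => e e0.
  have := H (e / (2 * pi)) (divr_gt0 e0 pi0); rewrite mulfVK ?gt_eqF// => /le_trans; apply.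
  by rewrite add0r.
move=> e0; have /continuous_normcP/(_ _ e0)[t t0 tP] := cq.
pose s := Num.min 1 (t / (2 * rho)).
have s0 : 0 < s by rewrite lt_min ltr01 divr_gt0// mulr_gt0.
have s1 : s <= 1 by rewrite ge_min lexx.
have x10 : ln s <= 0 by rewrite ln_le0.
have IE : I = intR (fun y => Re (q (c + rho%:C * cexp (ln s +i* y)))) 0 (2 * pi).
  rewrite -(circle_mean_indep rho0 rhor' x10 dq) /I; congr intR.
  by apply/funext => y; rewrite /cexp /= expR0 mul1r.
have E y : normc (rho%:C * cexp (ln s +i* y)) = rho * s.
  by rewrite normcM normc_real normc_cexp ger0_norm ?(ltW rho0)//= lnK ?posrE.
rewrite IE -{2}[2 * pi]subr0; rewrite -[X in e * X]subr0; apply: int_near_cst.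
- exact: ltW.
- move=> y _.
  have dg : differentiable (fun w => q (c + rho%:C * cexp w)) (ln s +i* y).
    apply: (@dif_comp _ _ _ _ (fun w => c + rho%:C * cexp w) q).
      by apply: difD; [exact: dif_cst|apply: difM; [exact: dif_cst|exact: differentiable_cexp]].
    by apply: dq; rewrite addrAC subrr add0r E ?mulr_gt0// (le_lt_trans _ rhor')//
      ler_piMr// ltW.
  have /continuous_normcP cg := differentiable_continuous dg.
  apply/cvgrPdist_lt => k k0; have [u u0 uP] := cg k k0.
  apply/nbhs_ballP; exists u => // y' yy'; rewrite /= -cReB.
  apply: le_lt_trans (ler_Re_normc _) _; apply: uP.
  apply: le_lt_trans (le_normc_ReIm _) _.
  by rewrite /= subrr normr0 add0r.
- move=> y _; rewrite -cReB.
  apply: le_trans (ler_Re_normc _) _; rewrite normcB ltW//; apply: tP.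
  rewrite opprD addrA subrr add0r normcN E.
  have : rho * s <= t / 2.
    have -> : t / 2 = rho * (t / (2 * rho)) by field; rewrite gt_eqF.
    by rewrite ler_pM2l// ge_min lexx orbT.
  by move=> /le_lt_trans; apply; rewrite ltr_pdivrMr// ltr_pMr// ltr1n.
Qed.

End MeanValue.

Section MaximumPrinciple.
Context {R : realType}.
Implicit Types (q : R[i] -> R[i]) (c : R[i]).

Lemma cvg_near_normcP (f : R[i] -> R) z :
  {for z, continuous f} <-> forall e : R, 0 < e ->
  exists2 t : R, 0 < t & forall w, normc (z - w) < t -> `|f z - f w| < e.
Proof.
split=> [cf e e0|cf]; first by have /cvgrPdist_lt/(_ e e0)/nbhs_normcP := cf.
move=> P /nbhs_ballP[e e0 eP]; have [t t0 tP] := cf e e0.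
by apply/nbhs_normcP; exists t => // w /tP; exact: eP.
Qed.

Lemma continuous_cmull q a z : {for z, continuous q} ->
  {for z, continuous (fun w => a * q w)}.
Proof.
by move=> cq; exact: (@continuousM _ _ (fun=> a) q z (@cst_continuous _ _ a z) cq).
Qed.

Lemma compact_disc c (r : R) : compact [set z : R[i] | normc (z - c) <= r].
Proof.
pose f (p : R * R) : R[i] := p.1 +i* p.2.
have cf : continuous f.
  move=> p P /nbhs_normcP[e e0 eP].
  apply/nbhs_ballP; exists (e / 2); first by rewrite /= divr_gt0.
  move=> p' [p1 p2]; apply: eP; apply: le_lt_trans (le_normc_ReIm _) _.
  by rewrite (splitr e) /= ltrD.
pose a := `|r| + normc c.
have cK : compact (f @` (`[- a, a] `*` `[- a, a])).
  apply: continuous_compact; first exact: continuous_subspaceT.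
  by apply: compact_setX; exact: segment_compact.
apply: subclosed_compact cK _.
  rewrite -openC openE => z /negP; rewrite -ltNge => rz.
  have e0 : 0 < normc (z - c) - r by rewrite subr_gt0.
  apply/nbhs_normcP; exists (normc (z - c) - r) => // w zw; apply/negP.
  rewrite -ltNge; have := le_normcD (z - w) (w - c).
  by rewrite addrA subrK; clear -zw; lra.
move=> z zr; exists (Re z, Im z); last exact: complex_eqP.
have za : normc z <= a.
  have := le_normcD (z - c) c; rewrite subrK /a.
  by have := ler_norm r; clear -zr; rewrite /= in zr; lra.
by split; rewrite /= in_itv /= -ler_norml (le_trans _ za)// ?ler_Re_normc ?ler_Im_normc.
Qed.

Lemma disc_max (f : R[i] -> R) c (r : R) : 0 <= r ->
  (forall z, normc (z - c) <= r -> {for z, continuous f}) ->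
  exists2 z, normc (z - c) <= r & forall w, normc (w - c) <= r -> f w <= f z.
Proof.
move=> r0 cf.
have ne : [set z : R[i] | normc (z - c) <= r] !=set0.
  by exists c; rewrite /= subrr normc0.
have cw : {within [set z : R[i] | normc (z - c) <= r], continuous f}.
  by apply: continuous_in_subspaceT => z; rewrite inE; exact: cf.
have [z] := compact_EVT_max ne (@compact_disc c r) cw.
by rewrite inE /= => zr zP; exists z => // w wr; apply: zP; rewrite inE.
Qed.

Lemma continuous_Re q z : {for z, continuous q} ->
  {for z, continuous (fun z => Re (q z))}.
Proof.
move=> /continuous_normcP cq; apply/cvg_near_normcP => e /cq[t t0 tP].
exists t => // w /tP; apply: le_lt_trans.
by rewrite -cReB; exact: ler_Re_normc.
Qed.

Lemma continuous_normc q z : {for z, continuous q} ->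
  {for z, continuous (fun z => normc (q z))}.
Proof.
move=> /continuous_normcP cq; apply/cvg_near_normcP => e /cq[t t0 tP].
exists t => // w /tP; apply: le_lt_trans.
rewrite ler_norml; have := le_normcD (q w) (q z - q w).
have := le_normcD (q z) (q w - q z).
by rewrite !subrKC (normcB (q w)); clear; move=> *; apply/andP; split; lra.
Qed.

Lemma circle_seg_cont q c (rho a b : R) :
  (forall z, normc (z - c) = rho -> {for z, continuous q}) -> 0 <= rho ->
  seg_cont (fun y => Re (q (c + rho%:C * expi y))) a b.
Proof.
move=> cq rho0 y _.
have E : normc (c + rho%:C * expi y - c) = rho.
  by rewrite addrAC subrr add0r normcM normc_expi mulr1 normc_real ger0_norm.
have /cvg_near_normcP cRe := continuous_Re (cq _ E).
apply/cvgrPdist_lt => e /cRe[t t0 tP].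
have r1 : 0 < rho + 1 by rewrite ltr_wpDl.
have t1 : 0 < (t / (rho + 1))%:C by rewrite ltcE /= eqxx divr_gt0.
have := @continuous_expi R y; move=> /cvgrPdist_lt/(_ _ t1).
apply: filterS => u; rewrite ltcE => /andP[_]; rewrite Re_norm /=.
rewrite ltr_pdivlMr// => yu; apply: tP.
rewrite opprD addrACA subrr add0r -mulrBr normcM normc_real ger0_norm//.
by apply: le_lt_trans yu; rewrite mulrC ler_wpM2l ?normc_ge0// lerDl.
Qed.

Lemma circle_mean_le q c (rho r' m : R) : 0 < rho -> rho < r' ->
  (forall z, 0 < normc (z - c) -> normc (z - c) < r' -> differentiable q z) ->
  {for c, continuous q} ->
  (forall z, normc (z - c) = rho -> Re (q z) <= m) ->
  Re (q c) <= m.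
Proof.
move=> rho0 rhor' dq cq qm.
have pi0 : 0 < 2 * pi :> R by rewrite mulr_gt0// pi_gt0.
rewrite -(ler_pM2l pi0) -(circle_mean rho0 rhor' dq cq).
have -> : 2 * pi * m = intR (fun=> m) 0 (2 * pi).
  by rewrite int_cst ?(ltW pi0)// subr0 mulrC.
apply: le_Rintegral => //.
- apply: seg_cont_integrable; apply: circle_seg_cont; last exact: ltW.
  by move=> z zr; apply: differentiable_continuous; apply: dq; rewrite zr.
- by apply: seg_cont_integrable => ? _; exact: cst_continuous.
- move=> y _; apply: qm.
  by rewrite addrAC subrr add0r normcM normc_expi mulr1 normc_real gtr0_norm.
Qed.

(** Adding [e |z - c|^2] to [Re q] gives a function that cannot have an interior maximum, by the
    mean value property; then [e] tends to 0. The exceptional point [l0], where [q] is only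
    continuous, is there for functions divided by [l - l0]. *)
Lemma max_principle q c l0 (r M : R) : 0 <= r ->
  (forall z, normc (z - c) <= r -> {for z, continuous q}) ->
  (forall z, normc (z - c) <= r -> z != l0 -> differentiable q z) ->
  (forall z, normc (z - c) = r -> Re (q z) <= M) ->
  forall z, normc (z - c) <= r -> Re (q z) <= M.
Proof.
move=> r0 cq dq qM z0 z0r; apply/ler_addgt0Pr => e' e'0.
pose e := e' / (r ^+ 2 + 1).
have r2 : 0 < r ^+ 2 + 1 by rewrite ltr_wpDl// sqr_ge0.
have e0 : 0 < e by rewrite divr_gt0.
pose u z := Re (q z) + e * normc (z - c) ^+ 2.
have cu z : normc (z - c) <= r -> {for z, continuous u}.
  move=> zr; apply: continuousD; first exact/continuous_Re/cq.
  have cn : {for z, continuous (fun z : R[i] => normc (z - c))}.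
    apply: continuous_normc; apply: differentiable_continuous.
    by apply: difB; [exact: dif_id|exact: dif_cst].
  apply: continuousM; first exact: cst_continuous.
  rewrite (_ : (fun x => _ ^+ 2) = (fun x => normc (x - c) * normc (x - c))); last first.
    by apply/funext => x; rewrite expr2.
  exact: continuousM.
have [z zr zmax] := disc_max r0 cu.
have [zr'|] := ltP (normc (z - c)) r; last first.
  move=> rz; have {rz}zr : normc (z - c) = r by apply/eqP; rewrite eq_le zr.
  have := zmax _ z0r; rewrite /u zr => H; have := qM _ zr.
  have : 0 <= e * normc (z0 - c) ^+ 2 by rewrite mulr_ge0 ?sqr_ge0// ltW.
  have : e * r ^+ 2 <= e'.
    by rewrite /e mulrAC ler_pdivrMr// ler_pM2l// lerDl.
  by clear -H; lra.
(* an interior maximum of u contradicts the mean value property of q2, whose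
   real part is u up to a constant and to the term in |w - z|^2 *)
pose q2 w := q w + (2 * e)%:C * conjc (z - c) * (w - z).
have Req2 w : Re (q2 w) =
    u w - e * normc (z - c) ^+ 2 - e * normc (w - z) ^+ 2.
  rewrite /q2 /u !sqr_normc_Re_Im; case: (q w) => x y; case: z {zmax zr zr' q2} => a b.
  by case: c {cq dq qM u cu z0r} => ? ?; case: w => ? ?; rewrite /=; ring.
(* The punctured disc of radius [rho] about [z] must avoid [l0]; the case [z = l0] is harmless,
   since [circle_mean_le] tolerates an exceptional centre. *)
have [rho rho0 [rhor rhol]] : exists2 rho, 0 < rho & rho < r - normc (z - c) /\
    forall w, 0 < normc (w - z) -> normc (w - z) < rho -> w != l0.
  have d0 : 0 < r - normc (z - c) by rewrite subr_gt0.
  have [zl0|zl0] := eqVneq z l0.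
    exists ((r - normc (z - c)) / 2); first by rewrite divr_gt0.
    split; first by rewrite ltr_pdivrMr// ltr_pMr// ltr1n.
    by move=> w wz _; rewrite -zl0 -subr_eq0 -normc_gt0.
  have l00 : 0 < normc (l0 - z) by rewrite normc_gt0 subr_eq0 eq_sym.
  exists (Num.min ((r - normc (z - c)) / 2) (normc (l0 - z))).
    by rewrite lt_min l00 divr_gt0.
  split; first by rewrite gt_min ltr_pdivrMr// ltr_pMr// ltr1n.
  by move=> w _; rewrite lt_min => /andP[_]; apply: contraTneq => ->; rewrite ltxx.
have inr w : normc (w - z) <= rho -> normc (w - c) <= r.
  move=> wr; have := le_normcD (w - z) (z - c); rewrite addrA subrK.
  by clear -wr rhor; lra.
have rho2 : 0 < rho / 2 by rewrite divr_gt0.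
have rho2' : rho / 2 < rho by rewrite ltr_pdivrMr// ltr_pMr// ltr1n.
have dlin w : differentiable (fun w => (2 * e)%:C * conjc (z - c) * (w - z)) w.
  by apply: difM; [exact: dif_cst|apply: difB; [exact: dif_id|exact: dif_cst]].
have dq2 w : 0 < normc (w - z) -> normc (w - z) < rho -> differentiable q2 w.
  move=> w0 wr; apply: difD => //.
  by apply: dq; [exact/inr/ltW|exact: rhol].
have cq2 : {for z, continuous q2}.
  by apply: continuousD; [exact: cq|exact: differentiable_continuous].
have := @circle_mean_le q2 z (rho / 2) rho
  (Re (q2 z) - e * (rho / 2) ^+ 2) rho2 rho2' dq2 cq2.
have e2 : 0 < e * (rho / 2) ^+ 2 by rewrite mulr_gt0// exprn_gt0.
suff H w : normc (w - z) = rho / 2 ->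
    Re (q2 w) <= Re (q2 z) - e * (rho / 2) ^+ 2.
  by move=> /(_ H); clear -e2; lra.
move=> wz; have /inr/zmax uw : normc (w - z) <= rho by rewrite wz ltW.
rewrite !Req2 wz subrr normc0; clear -uw; rewrite expr0n mulr0; lra.
Qed.

(** A unimodular factor turns the value at the given point into its modulus; the bound for real
    parts then applies to the rotated function. *)
Lemma norm_max_principle q c l0 (r M : R) : 0 <= r ->
  (forall z, normc (z - c) <= r -> {for z, continuous q}) ->
  (forall z, normc (z - c) <= r -> z != l0 -> differentiable q z) ->
  (forall z, normc (z - c) = r -> normc (q z) <= M) ->
  forall z, normc (z - c) <= r -> normc (q z) <= M.
Proof.
move=> r0 cq dq qM z zr.
have [->|qz0] := eqVneq (q z) 0.
  rewrite normc0 (le_trans (normc_ge0 (q (c + r%:C))))// qM//.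
  by rewrite addrAC subrr add0r normc_real ger0_norm.
pose a := conjc (q z) / (normc (q z))%:C.
have n0 : 0 < normc (q z) by rewrite normc_gt0.
have n0' : (normc (q z))%:C != 0 :> R[i].
  by apply/eqP => /(congr1 (@Re R)) /= H; rewrite H ltxx in n0.
have a1 : normc a = 1.
  rewrite /a normcM normcV normc_conjc normc_real (ger0_norm (normc_ge0 _)).
  by rewrite divff// gt_eqF.
have -> : normc (q z) = Re (a * q z).
  rewrite /a mulrAC (mulrC (conjc _)) mulcJ -fmorphV -rmorphM /=.
  by rewrite expr2 mulfK// gt_eqF.
apply: (@max_principle (fun w => a * q w) c l0 r M r0).
- by move=> w wr; apply: continuous_cmull; exact: cq.
- by move=> w wr wl; apply: difM; [exact: dif_cst|exact: dq].
- move=> w wr; apply: le_trans (ler_norm _) _; apply: le_trans (ler_Re_normc _) _.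
  by rewrite normcM a1 mul1r qM.
- exact: zr.
Qed.

End MaximumPrinciple.

(** * The Schwarz-Pick inequality *)

Section SchwarzPick.
Context {R : realType}.
Implicit Types (f g q : R[i] -> R[i]).

Lemma differentiable_near_eq (f g : R[i] -> R[i]) z (e : R) : 0 < e ->
  (forall w, normc (z - w) < e -> f w = g w) ->
  differentiable f z -> differentiable g z.
Proof.
move=> e0 fg /differentiable_normcP[d dP]; apply/differentiable_normcP.
exists d => k /dP[t t0 tP]; exists (Num.min t e); first by rewrite lt_min t0.
move=> h; rewrite lt_min => /andP[/tP + he]; rewrite !fg//.
  by rewrite subrr normc0.
by rewrite opprD addrA subrr add0r normcN.
Qed.

(** The difference quotient, completed at [a] by the derivative. Continuity at [a] is what the
    maximum principle asks of its exceptional point. *)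
Lemma removable f a : differentiable f a -> exists q,
  [/\ forall z, f z - f a = (z - a) * q z, {for a, continuous q}
    & forall z, z != a -> differentiable f z -> differentiable q z].
Proof.
move=> /differentiable_normcP[d dP].
exists (fun z => if z == a then d else (f z - f a) / (z - a)); split.
- move=> z; case: eqP => [->|/eqP]; first by rewrite !subrr mul0r.
  by rewrite -subr_eq0 => za; rewrite mulrCA divff// mulr1.
- apply/continuous_normcP => e e0.
  have e2 : 0 < e / 2 by rewrite divr_gt0.
  have [t t0 tP] := dP _ e2; exists t => // w; rewrite eqxx normcB => wt.
  case: eqP => [_|/eqP wa]; first by rewrite subrr normc0.
  have wa0 : 0 < normc (w - a) by rewrite normc_gt0 subr_eq0.
  have := tP _ wt; rewrite subrKC => H.
  rewrite normcB -(ltr_pM2r wa0) -normcM.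
  have -> : ((f w - f a) / (w - a) - d) * (w - a) = f w - f a - d * (w - a).
    by field; rewrite subr_eq0.
  by apply: le_lt_trans H _; rewrite ltr_pM2r// ltr_pdivrMr// ltr_pMr// ltr1n.
- move=> z za df; have za0 : 0 < normc (z - a) by rewrite normc_gt0 subr_eq0.
  apply: (@differentiable_near_eq (fun z => (f z - f a) / (z - a)) _ z _ za0).
    by move=> w wz; case: eqP wz => // ->; rewrite ltxx.
  apply: difM; first by apply: difB => //; exact: dif_cst.
  apply: difV; first by apply: difB; [exact: dif_id|exact: dif_cst].
  by rewrite subr_eq0.
Qed.

Lemma schwarz g : (forall z, normc z < 1 -> differentiable g z) ->
  (forall z, normc z < 1 -> normc (g z) < 1) -> g 0 = 0 ->
  forall z, normc z < 1 -> normc (g z) <= normc z.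
Proof.
move=> dg g1 g0 z z1.
have d0 : differentiable g 0 by apply: dg; rewrite normc0.
have [q [gq cq dq]] := removable d0.
have {}gq w : g w = w * q w by have := gq w; rewrite g0 !subr0.
rewrite gq normcM -[leRHS]mulr1; apply: ler_wpM2l; first exact: normc_ge0.
apply/ler_addgt0Pr => e e0.
(* On the circle of radius [r] the quotient [q] is bounded by [r^-1], hence by [1 + e]; the disc
   also has to contain [z]. *)
pose r := Num.max (normc z) (1 + e)^-1.
have e1 : 0 < 1 + e by rewrite addr_gt0.
have r0 : 0 < r by rewrite lt_max invr_gt0 e1 orbT.
have r1 : r < 1 by rewrite gt_max z1 invf_lt1// ltrDl.
have dqr w : normc (w - 0) <= r -> w != 0 -> differentiable q w.
  by rewrite subr0 => wr w0; apply: (dq _ w0); apply: dg; exact: le_lt_trans wr r1.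
apply: (@norm_max_principle _ q 0 0 r (1 + e) (ltW r0)).
- move=> w wr; have [->|w0] := eqVneq w 0; first exact: cq.
  by apply: differentiable_continuous; exact: dqr.
- exact: dqr.
- move=> w; rewrite subr0 => wr; rewrite -(ler_pM2l r0) -{1}wr -normcM -gq.
  have /ltW/le_trans : normc (g w) < 1 by apply: g1; rewrite wr.
  apply; rewrite -ler_pdivrMr// mul1r; by rewrite le_max lexx orbT.
- by rewrite subr0 le_max lexx.
Qed.

Lemma neq0_1BJM (w u : R[i]) : normc w < 1 -> normc u < 1 -> 1 - conjc w * u != 0.
Proof.
move=> w1 u1; rewrite subr_eq0; apply/eqP => /(congr1 (@normc R)).
rewrite normc1 normcM normc_conjc => E.
have : normc w * normc u < 1 * 1 by rewrite ltr_pM// ?normc_ge0.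
by rewrite -E mulr1 ltxx.
Qed.

Lemma mobius_lt1 (w u : R[i]) : normc w < 1 -> normc u < 1 ->
  normc ((u - w) / (1 - conjc w * u)) < 1.
Proof.
move=> w1 u1; rewrite normcM normcV.
have n0 : 0 < normc (1 - conjc w * u) by rewrite normc_gt0 neq0_1BJM.
rewrite ltr_pdivrMr// mul1r -(@ltr_pXn2r _ 2) ?nnegrE ?normc_ge0// -subr_gt0.
have -> : normc (1 - conjc w * u) ^+ 2 - normc (u - w) ^+ 2 =
    (1 - normc u ^+ 2) * (1 - normc w ^+ 2).
  rewrite !sqr_normc_Re_Im; case: w {w1 n0} => a b; case: u {u1} => c d /=; ring.
by rewrite mulr_gt0// subr_gt0 expr_lt1// normc_ge0.
Qed.

Lemma schwarz_pick f : (forall z, normc z < 1 -> differentiable f z) ->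
  (forall z, normc z < 1 -> normc (f z) < 1) ->
  forall z w, normc z < 1 -> normc w < 1 ->
  normc ((f z - f w) / (1 - conjc (f w) * f z)) <=
  normc ((z - w) / (1 - conjc w * z)).
Proof.
move=> df f1 z w z1 w1.
pose M u := (u + w) / (1 + conjc w * u).
pose T v := (v - f w) / (1 - conjc (f w) * v).
have ME u : M u = (u - - w) / (1 - conjc (- w) * u).
  by rewrite /M opprK rmorphN mulNr opprK.
have wN : normc (- w) < 1 by rewrite normcN.
have M1 u : normc u < 1 -> normc (M u) < 1.
  by move=> u1; rewrite ME mobius_lt1.
have M0 : M 0 = w by rewrite /M mulr0 addr0 add0r divr1.
have zw : 1 - conjc w * z != 0 by rewrite neq0_1BJM.
have ww : 1 - conjc w * w != 0 by rewrite neq0_1BJM.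
set u := (z - w) / (1 - conjc w * z).
have uz : M u = z.
  rewrite /M /u; field; rewrite zw /=.
  by rewrite (_ : _ + _ = 1 - conjc w * w)//; ring.
have dM v : normc v < 1 -> differentiable M v.
  move=> v1; apply: difM; first by apply: difD; [exact: dif_id|exact: dif_cst].
  apply: difV; last by have := neq0_1BJM wN v1; rewrite rmorphN mulNr opprK.
  by apply: difD; [exact: dif_cst|apply: difM; [exact: dif_cst|exact: dif_id]].
have dT v : normc v < 1 -> differentiable T v.
  move=> v1; apply: difM; first by apply: difB; [exact: dif_id|exact: dif_cst].
  apply: difV; last exact: neq0_1BJM (f1 _ w1) v1.
  by apply: difB; [exact: dif_cst|apply: difM; [exact: dif_cst|exact: dif_id]].
have dfM v : normc v < 1 -> differentiable (fun u => f (M u)) v.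
  by move=> v1; apply: (@dif_comp _ _ _ _ M f); [exact: dM|exact/df/M1].
have u1 : normc u < 1 by exact: mobius_lt1.
(* Since [M 0 = w] and [T (f w) = 0], the map [T \o f \o M] fixes 0 and Schwarz's lemma applies to
   it at [u], the preimage of [z]. *)
rewrite -/(T (f z)) -{1}uz; apply: (@schwarz (fun u => T (f (M u)))).
- move=> v v1; apply: (@dif_comp _ _ _ _ (fun u => f (M u)) T); first exact: dfM.
  exact/dT/f1/M1.
- by move=> v v1; apply: mobius_lt1; [exact: f1|exact/f1/M1].
- by rewrite M0 /T subrr mul0r.
- exact: u1.
Qed.

Lemma unit_discE (z : R[i]) : unit_disc z = (normc z < 1) :> Prop.
Proof. by rewrite /unit_disc /= norm_normc -[1]/(1%:C) ltcR. Qed.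

Lemma atanh_le (m1 m2 : R) : 0 <= m1 -> m1 <= m2 -> m2 < 1 ->
  ln ((1 + m1) / (1 - m1)) / 2 <= ln ((1 + m2) / (1 - m2)) / 2.
Proof.
move=> m10 m12 m21; have m11 := le_lt_trans m12 m21.
have m20 := le_trans m10 m12.
have [p1 p2] : 0 < 1 - m1 /\ 0 < 1 - m2 by rewrite !subr_gt0.
have [p3 p4] : 0 < 1 + m1 /\ 0 < 1 + m2 by rewrite !ltr_wpDr.
rewrite ler_pM2r ?invr_gt0// ler_ln ?posrE ?divr_gt0//.
by rewrite ler_pdivrMr// mulrAC ler_pdivlMr//; clear -m12; nra.
Qed.

Lemma atanh_lt (m1 m2 : R) : 0 <= m1 -> m1 < m2 -> m2 < 1 ->
  ln ((1 + m1) / (1 - m1)) / 2 < ln ((1 + m2) / (1 - m2)) / 2.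
Proof.
move=> m10 m12 m21; have m11 := lt_trans m12 m21.
have m20 := le_trans m10 (ltW m12).
have [p1 p2] : 0 < 1 - m1 /\ 0 < 1 - m2 by rewrite !subr_gt0.
have [p3 p4] : 0 < 1 + m1 /\ 0 < 1 + m2 by rewrite !ltr_wpDr.
rewrite ltr_pM2r ?invr_gt0// ltr_ln ?posrE ?divr_gt0//.
by rewrite ltr_pdivrMr// mulrAC ltr_pdivlMr//; clear -m12; nra.
Qed.

Lemma poincare_contract f :
  holomorphic_maps (@unit_disc R) (@unit_disc R) f ->
  forall z w, unit_disc z -> unit_disc w ->
  poincare (f z) (f w) <= poincare z w.
Proof.
move=> [df f1] z w z1 w1; apply: atanh_le; first exact: normc_ge0.
  apply: schwarz_pick; [| |by rewrite -unit_discE..].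
    by move=> v; rewrite -unit_discE; exact: df.
  by move=> v; rewrite -!unit_discE; exact: f1.
by apply: mobius_lt1; rewrite -unit_discE.
Qed.

End SchwarzPick.

(** * Integration against signed measures *)

Section ChargeIntegral.
Context d (T : measurableType d) (R : realType).
Implicit Types (nu : {charge set T -> \bar R}) (f g : T -> R) (E : set T).

(** Bounded measurable functions are integrable for every finite measure and stable under sums and
    products, so they serve as the common class of integrands for all charges. *)
Definition bmf f := measurable_fun setT f /\ exists M, forall x, `|f x| <= M.

Lemma bmf_cst (c : R) : bmf (fun=> c).
Proof. by split=> //; exists `|c|. Qed.

Lemma bmfD f g : bmf f -> bmf g -> bmf (fun x => f x + g x).
Proof.
move=> [mf [M fM]] [mg [N gN]]; split; first exact: measurable_realfun.measurable_funD.
by exists (M + N) => x; rewrite (le_trans (ler_normD _ _))// lerD.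
Qed.

Lemma bmfM f g : bmf f -> bmf g -> bmf (fun x => f x * g x).
Proof.
move=> [mf [M fM]] [mg [N gN]]; split; first exact: measurable_realfun.measurable_funM.
by exists (M * N) => x; rewrite normrM ler_pM.
Qed.

Lemma bmfZ (c : R) f : bmf f -> bmf (fun x => c * f x).
Proof. by move=> bf; apply: bmfM => //; exact: bmf_cst. Qed.

Lemma bmfN f : bmf f -> bmf (fun x => - f x).
Proof.
move=> bf; have -> : (fun x => - f x) = (fun x => -1 * f x).
  by apply/funext => x; rewrite mulN1r.
exact: bmfZ.
Qed.

Lemma bmfB f g : bmf f -> bmf g -> bmf (fun x => f x - g x).
Proof. by move=> bf bg; apply: bmfD => //; exact: bmfN. Qed.

Lemma bmf_sum (I : Type) (s : seq I) (F : I -> T -> R) :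
  (forall i, bmf (F i)) -> bmf (fun x => \sum_(i <- s) F i x).
Proof.
move=> bF; elim: s => [|i s ih].
  by under eq_fun do rewrite big_nil; exact: bmf_cst.
by under eq_fun do rewrite big_cons; exact: bmfD.
Qed.

Lemma bmf_indic E : measurable E -> bmf (\1_E : T -> R).
Proof.
move=> mE; split; first exact: measurable_realfun.measurable_indic.
by exists 1 => x; rewrite indicE; case: (_ \in _); rewrite ?normr1 ?normr0.
Qed.

Lemma bmf_integrable (m : {measure set T -> \bar R}) E f : (m setT < +oo)%E ->
  measurable E -> bmf f -> m.-integrable E (EFin \o f).
Proof.
move=> moo mE [mf [M fM]]; apply: measurable_bounded_integrable => //.
- by apply: le_lt_trans moo; apply: le_measure; rewrite ?inE.
- exact: measurable_funTS.
- by exists M; split; [exact: num_real|move=> N MN x _ /=; rewrite (le_trans (fM x))// ltW].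
Qed.

Lemma Rint_bound (m : {measure set T -> \bar R}) E f (M : R) : (m setT < +oo)%E ->
  measurable E -> bmf f -> 0 <= M -> (forall x, E x -> `|f x| <= M) ->
  `|\int[m]_(x in E) f x| <= M * fine (m setT).
Proof.
move=> moo mE bf M0 fM; have i := bmf_integrable moo mE bf.
apply: (le_trans (le_normr_Rintegral mE i)).
have mEoo : (m E <= m setT)%E by apply: le_measure; rewrite ?inE.
apply: (@le_trans _ _ (\int[m]_(x in E) M)).
  apply: le_Rintegral => //; first exact: integrable_norm.
  exact: (bmf_integrable moo mE (bmf_cst M)).
rewrite Rintegral_cst// ler_wpM2l// fine_le//.
  by rewrite ge0_fin_numE// (le_lt_trans mEoo).
by rewrite ge0_fin_numE.
Qed.

Definition jpos nu := jordan_pos (hahn_sets nu).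
Definition jneg nu := jordan_neg (hahn_sets nu).

Lemma jpos_oo nu : (jpos nu setT < +oo)%E.
Proof. by rewrite -ge0_fin_numE//; exact: fin_num_measure. Qed.

Lemma jneg_oo nu : (jneg nu setT < +oo)%E.
Proof. by rewrite -ge0_fin_numE//; exact: fin_num_measure. Qed.

Lemma charge_integralE nu E f :
  ci nu E f =
  \int[jpos nu]_(x in E) f x - \int[jneg nu]_(x in E) f x.
Proof. by []. Qed.

Lemma cross_sub (a b p q : R) : p + b = q + a -> p - q = a - b.
Proof. by lra. Qed.

Lemma fin_num_cross (a b p q : \bar R) : a \is a fin_num -> b \is a fin_num ->
  p \is a fin_num -> q \is a fin_num -> (a - b = p - q -> p + b = q + a)%E.
Proof.
move: a b p q => [a| |] [b| |] [p| |] [q| |]//= _ _ _ _.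
by rewrite -!EFinB -!EFinD => -[H]; congr (_%:E); clear -H; lra.
Qed.

(** The equality of differences is rewritten as [jpos + beta = jneg + alpha], an equality of genuine
    measures, for which integrals add. *)
Lemma charge_integral_decomp nu (alpha beta : {measure set T -> \bar R}) E f :
  (alpha setT < +oo)%E -> (beta setT < +oo)%E ->
  (forall A, measurable A -> nu A = (alpha A - beta A)%E) ->
  measurable E -> bmf f ->
  ci nu E f =
  \int[alpha]_(x in E) f x - \int[beta]_(x in E) f x.
Proof.
move=> aoo boo ab mE bf.
have fin (m : {measure set T -> \bar R}) A : (m setT < +oo)%E -> measurable A ->
    m A \is a fin_num.
  move=> moo mA; rewrite ge0_fin_numE//; apply: le_lt_trans moo.
  by apply: le_measure; rewrite ?inE.
have eqm A : measurable A -> A `<=` E ->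
    measure_add (jpos nu) beta A = measure_add (jneg nu) alpha A.
  move=> mA _; rewrite !measure_addE.
  apply: (@fin_num_cross (alpha A)); rewrite ?fin_num_measure//.
  - exact: fin.
  - exact: fin.
  by rewrite -ab// (jordan_decomp (hahn_sets nu) mA) /cadd /= cscaleN1.
have := eq_measure_integral (measure_add (jneg nu) alpha) eqm (f := EFin \o f).
have [ip inn] := (bmf_integrable (jpos_oo nu) mE bf, bmf_integrable (jneg_oo nu) mE bf).
have [ia ib] := (bmf_integrable aoo mE bf, bmf_integrable boo mE bf).
move/integrableP: (ip) => [mf _].
rewrite !integral_measure_add// => H.
have {}H : \int[jpos nu]_(x in E) f x + \int[beta]_(x in E) f x =
     \int[jneg nu]_(x in E) f x + \int[alpha]_(x in E) f x.
  by rewrite -!fineD ?H//; exact: integrable_fin_num.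
by rewrite charge_integralE; exact: cross_sub.
Qed.

Section fixed_set.
Variables (nu : {charge set T -> \bar R}) (E : set T).
Hypothesis mE : measurable E.

Lemma ciD f g : bmf f -> bmf g ->
  ci nu E (fun x => f x + g x) =
  ci nu E f + ci nu E g.
Proof.
move=> bf bg; rewrite !charge_integralE !RintegralD//.
  by ring.
all: apply: bmf_integrable => //; by [exact: jpos_oo|exact: jneg_oo].
Qed.

Lemma ciZ (c : R) f : bmf f ->
  ci nu E (fun x => c * f x) = c * ci nu E f.
Proof.
move=> bf; rewrite !charge_integralE !RintegralZl//.
  by ring.
all: apply: bmf_integrable => //; by [exact: jpos_oo|exact: jneg_oo].
Qed.

Lemma ci_bound f (M : R) : bmf f -> 0 <= M -> (forall x, E x -> `|f x| <= M) ->
  `|ci nu E f| <= M * (fine (jpos nu setT) + fine (jneg nu setT)).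
Proof.
move=> bf M0 fM; rewrite charge_integralE (le_trans (ler_normB _ _))// mulrDr.
by rewrite lerD// Rint_bound//; [exact: jpos_oo|exact: jneg_oo].
Qed.

Lemma eq_ci f g : (forall x, E x -> f x = g x) ->
  ci nu E f = ci nu E g.
Proof.
by move=> fg; rewrite !charge_integralE; congr (_ - _); apply: eq_Rintegral => x;
  rewrite inE; exact: fg.
Qed.

Lemma ciN f : bmf f ->
  ci nu E (fun x => - f x) = - ci nu E f.
Proof. by move=> bf; rewrite -mulN1r -ciZ//; apply: eq_ci => x _; rewrite mulN1r. Qed.

Lemma ciB f g : bmf f -> bmf g ->
  ci nu E (fun x => f x - g x) =
  ci nu E f - ci nu E g.
Proof. by move=> bf bg; rewrite ciD ?ciN//; exact: bmfN. Qed.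

Lemma ci0 : ci nu E (fun=> 0) = 0.
Proof.
rewrite -[RHS](mul0r (ci nu E (fun=> 0))) -(ciZ 0 (bmf_cst 0)).
by apply: eq_ci => x _; rewrite mulr0.
Qed.

Lemma ci_sum (I : Type) (s : seq I) (F : I -> T -> R) : (forall i, bmf (F i)) ->
  ci nu E (fun x => \sum_(i <- s) F i x) =
  \sum_(i <- s) ci nu E (F i).
Proof.
move=> bF; elim: s => [|i s ih].
  by rewrite big_nil -[RHS]ci0; apply: eq_ci => x _; rewrite big_nil.
rewrite big_cons -ih -ciD//; last exact: bmf_sum.
by apply: eq_ci => x _; rewrite big_cons.
Qed.

Lemma ci_indic A f :
  ci nu E (fun x => \1_A x * f x) = ci nu (E `&` A) f.
Proof.
rewrite !charge_integralE !Rintegral_mkcondr; congr (_ - _);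
  apply: eq_Rintegral => x _; rewrite patchE indicE; case: ifPn => // _;
  by rewrite ?mul1r ?mul0r.
Qed.

End fixed_set.

Lemma charge_integral_one nu E : measurable E ->
  ci nu E (fun=> 1) = fine (nu E).
Proof.
move=> mE; rewrite charge_integralE !Rintegral_cst// !mul1r.
have := jordan_decomp (hahn_sets nu) mE; rewrite /cadd /= cscaleN1 => ->.
by rewrite fineB//; exact: fin_num_measure.
Qed.

(** The sum counts the positive multiples of [e] not exceeding [p], so [e] times it is [p] rounded
    down to a multiple of [e]. *)
Lemma layer_cake (p e : R) (N : nat) : 0 < e -> 0 <= p -> p < e * N.+1%:R ->
  `|p - e * \sum_(k < N) (e * k.+1%:R <= p)%R%:R| <= e.
Proof.
move=> e0 p0; elim: N => [|N ih].
  by rewrite big_ord0 mulr0 subr0 ger0_norm// mulr1 => /ltW.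
rewrite big_ord_recr /=.
have [ep pe|pe _] := leP (e * N.+1%:R) p; last by rewrite addr0 ih.
rewrite (eq_bigr (fun=> 1)) => [|k _].
  rewrite sumr_const card_ord mulrS.
  by move: ep pe; rewrite !mulrSr; clear; rewrite ler_norml => *; apply/andP; split; lra.
suff -> : e * k.+1%:R <= p by [].
by rewrite (le_trans _ ep)// ler_pM2l// ler_nat ltnS ltnW.
Qed.

(** The staircase [s] built on the superlevel sets of [P] turns the weighted integral into
    unweighted ones over the intersections of [E] with the [A k], each covered by the hypothesis;
    the uniform error [e] is arbitrary. *)
Lemma ci_sum_weight (I : finType) (nu : I -> {charge set T -> \bar R})
    (q : I -> T -> R) (P : T -> R) : (forall i, bmf (q i)) -> bmf P ->
  (forall x, 0 <= P x) ->
  (forall E, measurable E -> \sum_i ci (nu i) E (q i) <= 0) ->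
  forall E, measurable E ->
    \sum_i ci (nu i) E (fun x => P x * q i x) <= 0.
Proof.
move=> bq bP P0 neg E mE; apply/ler_addgt0Pr => e' e'0; rewrite add0r.
have [B BP] := @choice _ _ (fun i b => forall x, `|q i x| <= b)
  (fun i => (bq i).2).
pose C i := fine (jpos (nu i) setT) + fine (jneg (nu i) setT).
have C0 i : 0 <= C i by rewrite addr_ge0// fine_ge0.
pose S := \sum_i `|B i| * C i.
have S0 : 0 <= S by apply: sumr_ge0 => i _; rewrite mulr_ge0.
pose e := e' / (S + 1).
have S1 : 0 < S + 1 by rewrite ltr_wpDl.
have e0 : 0 < e by rewrite divr_gt0.
have [_ [M PM]] := bP.
pose N := Num.bound `|M / e|.
have NM : `|M / e| < N%:R by apply: archi_boundP.
have PN x : P x < e * N.+1%:R.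
  rewrite mulrC -ltr_pdivrMr//; apply: (@le_lt_trans _ _ (M / e)).
    by rewrite ler_pM2r ?invr_gt0// (le_trans (ler_norm _)).
  by rewrite (le_lt_trans (ler_norm _))// (lt_le_trans NM)// ler_nat.
pose A k := [set x | e * k.+1%:R <= P x].
have mA k : measurable (A k).
  have [mP _] := bP; rewrite -[A k]setTI.
  have -> : setT `&` A k = setT `&` [set x | (cst (e * k.+1%:R) x <= P x)%R] by [].
  by apply: measurable_fun_le.
pose s x := e * \sum_(k < N) \1_(A k) x.
have bA (k : 'I_N) : bmf (\1_(A k) : T -> R) by exact: bmf_indic.
have bs : bmf s by apply: bmfZ; exact: bmf_sum.
have split i : ci (nu i) E (fun x => P x * q i x) =
    e * (\sum_(k < N) ci (nu i) (E `&` A k) (q i)) +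
    ci (nu i) E (fun x => (P x - s x) * q i x).
  have <- : ci (nu i) E (fun x => s x * q i x) =
     e * (\sum_(k < N) ci (nu i) (E `&` A k) (q i)).
    rewrite (eq_bigr (fun k : 'I_N => ci (nu i) E (fun x => \1_(A k) x * q i x))); last first.
      by move=> k _; rewrite ci_indic.
    rewrite -(ci_sum _ mE); last by move=> k; exact: bmfM.
    rewrite -ciZ//; last by apply: bmf_sum => k; exact: bmfM.
    by apply: eq_ci => x _; rewrite /s -mulrA mulr_suml.
  rewrite -ciD//; [|exact: bmfM|by apply: bmfM => //; exact: bmfB].
  by apply: eq_ci => x _; rewrite -mulrDl subrKC.
under eq_bigr do rewrite split.
rewrite big_split /= -[leRHS]add0r lerD//.
  rewrite -mulr_sumr exchange_big /= pmulr_rle0//; apply: sumr_le0 => k _.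
  by apply: neg; exact: measurableI.
have -> : e' = e * (S + 1) by rewrite /e mulfVK// gt_eqF.
apply: (@le_trans _ _ (e * S)); last by rewrite ler_pM2l// lerDl.
rewrite mulr_sumr; apply: ler_sum => i _; rewrite mulrA.
apply: le_trans (ler_norm _) _; apply: ci_bound => //.
    by apply: bmfM => //; exact: bmfB.
  by rewrite mulr_ge0// ltW.
move=> x _; rewrite normrM ler_pM//; last by rewrite (le_trans (BP i x))// ler_norm.
have := layer_cake e0 (P0 x) (PN x); congr (`|_ - _ * _| <= _).
by apply: eq_bigr => k _; rewrite indicE; congr (nat_of_bool _)%:R; apply/idP/idP; rewrite inE.
Qed.

End ChargeIntegral.

(** * Continuous functions on the circle and arc length *)

Section CircleFunctions.
Context {R : realType}.
Implicit Types (F : R[i] -> R[i]) (x y : circle R).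

Lemma normc_circle x : normc (circle_val x) = 1.
Proof.
have : unit_circle (circle_val x).
  exact: (@set_valP _ (@unit_circle R) (x : circle_top R)).
by rewrite /unit_circle /= norm_normc => /(congr1 (@Re R)).
Qed.

Lemma circle_mulJ x : circle_val x * conjc (circle_val x) = 1.
Proof. by rewrite mulcJ normc_circle expr1n. Qed.

Lemma open_normcP (A : set R[i]) : (forall z, A z -> exists2 t, 0 < t &
  forall w, normc (z - w) < t -> A w) -> open A.
Proof. by move=> Aop; rewrite openE => z /Aop; rewrite /interior => /nbhs_normcP. Qed.

Lemma circle_cont_measurable (g : circle R -> R) :
  (forall x e, 0 < e -> exists2 t, 0 < t & forall y,
    normc (circle_val x - circle_val y) < t -> `|g x - g y| < e) ->
  measurable_fun setT g.
Proof.
move=> cg; apply: (measurability _ (measurable_realfun.RGenOpens.measurableE R)) => _ [_ [a [b ->]] <-].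
rewrite setTI; apply: sub_sigma_algebra.
(* An open set of the plane whose trace on the circle is the preimage of the open interval from [a]
   to [b]; such traces generate the measurable sets of [circle]. *)
pose A := [set z : R[i] | exists x t, [/\ 0 < t, normc (circle_val x - z) < t &
  forall y, normc (circle_val x - circle_val y) < t -> a < g y < b]].
exists A.
  apply: open_normcP => z [x [t [t0 xz tP]]].
  exists (t - normc (circle_val x - z)); first by rewrite subr_gt0.
  move=> w; rewrite ltrBrDl => zw; exists x, t; split => //.
  by apply: le_lt_trans zw; rewrite -(subrKA z) le_normcD.
apply/seteqP; split => [y [x [t [t0 xy tP]]]|x].
  by rewrite /= in_itv /=; exact: tP.
rewrite /= in_itv /= => /andP[ag gb].
have e0 : 0 < Num.min (g x - a) (b - g x) by rewrite lt_min !subr_gt0 ag.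
have [t t0 tP] := cg x _ e0; exists x, t; split=> //.
  by rewrite -[set_val _]/(circle_val x) subrr normc0.
move=> y /tP; rewrite lt_min ltr_norml; clear -ag.
by move=> /andP[/andP[? ?]]; rewrite ltr_norml => /andP[? ?]; apply/andP; split; lra.
Qed.

Definition circle_cont F := forall z, normc z = 1 -> {for z, continuous F}.

Lemma compact_circle : compact [set z : R[i] | normc z = 1].
Proof.
apply: subclosed_compact (@compact_disc R 0 1) _; last by move=> z /=; rewrite subr0 => ->.
rewrite -openC; apply: open_normcP => z /eqP z1.
exists `|normc z - 1|; first by rewrite normr_gt0 subr_eq0.
move=> w zw /= w1; move: zw; rewrite -w1 ltNge => /negP; apply.
rewrite ler_norml; have := le_normcD (w - z) z; have := le_normcD (z - w) w.
by rewrite !subrK (normcB w) => *; apply/andP; split; lra.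
Qed.

Lemma circle_cont_bounded F : circle_cont F -> exists M, forall x, normc (F (circle_val x)) <= M.
Proof.
move=> cF; have ne : [set z : R[i] | normc z = 1] !=set0 by exists 1; exact: normc1.
have cw : {within [set z : R[i] | normc z = 1], continuous (fun z => normc (F z))}.
  by apply: continuous_in_subspaceT => z; rewrite inE => /cF; exact: continuous_normc.
have [z _ zP] := compact_EVT_max ne compact_circle cw.
by exists (normc (F z)) => x; apply: zP; rewrite inE; exact: normc_circle.
Qed.

Lemma bmf_circle_Re F : circle_cont F -> bmf (fun x => Re (F (circle_val x))).
Proof.
move=> cF; split.
  apply: circle_cont_measurable => x e e0.
  have /continuous_normcP/(_ e e0)[t t0 tP] := cF _ (normc_circle x).
  by exists t => // y /tP; apply: le_lt_trans; rewrite -cReB; exact: ler_Re_normc.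
have [M MP] := circle_cont_bounded cF.
by exists M => x; exact: le_trans (ler_Re_normc _) (MP x).
Qed.

Lemma circle_cont_cmull (a : R[i]) F : circle_cont F -> circle_cont (fun z => a * F z).
Proof. by move=> cF z /cF; exact: continuous_cmull. Qed.

Lemma bmf_circle_Im F : circle_cont F -> bmf (fun x => Im (F (circle_val x))).
Proof.
move=> /(@circle_cont_cmull (- 'i))/bmf_circle_Re.
by congr bmf; apply/funext => x; rewrite cReM /=; ring.
Qed.

Lemma dif_circle_cont F : (forall z, normc z = 1 -> differentiable F z) -> circle_cont F.
Proof. by move=> dF z /dF; exact: differentiable_continuous. Qed.

Lemma arc_integral (f : circle R -> R) : bmf f ->
  \int[@arc_length R]_x f x = intR (f \o @angle R) 0 (2 * pi).
Proof.
move=> bf; rewrite /intR /Rintegral.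
pose m := mrestr lebesgue_measure (measurable_itv `[(0 : R), 2 * pi[).
have pi0 : 0 < 2 * pi :> R by rewrite mulr_gt0// pi_gt0.
have moo : (m setT < +oo)%E.
  by rewrite /m /mrestr setTI /= lebesgue_measure_itv /= lte_fin pi0 ltry.
have mC0 : m (~` `[(0 : R), 2 * pi[%classic) = 0%E.
  by rewrite /m /mrestr setICl measure0.
have [mf bf'] := bf.
have mfa : measurable_fun setT (f \o @angle R : R -> R).
  by apply: measurableT_comp => //; exact: measurable_angle.
have bfa : @bmf _ (measurableTypeR R) _ (f \o @angle R).
  by split=> //; have [M MP] := bf'; exists M => t; exact: MP.
have int : m.-integrable setT (EFin \o (f \o @angle R)).
  exact: (@bmf_integrable _ _ _ m).
have step1 : (\int[@arc_length R]_x (f x)%:E = \int[m]_t (f (angle t))%:E)%E.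
  have mEf : measurable_fun setT (EFin \o f) by exact/measurable_EFinP.
  have mang : @measurable_fun _ _ (measurableTypeR R) (circle R) setT (@angle R).
    exact: (@measurable_angle R).
  have := integral_pushforward mang (D := setT) mEf int measurableT.
  move=> <-.
  exact: eq_measure_integral.
rewrite step1; congr fine.
have mI : @measurable _ (measurableTypeR R) `[(0 : R), 2 * pi[%classic.
  exact: measurable_itv.
rewrite (negligible_integral (measurableC mI) (@measurableT _ (measurableTypeR R)) int mC0).
rewrite setTD setCK.
rewrite (@eq_measure_integral _ _ _ _ lebesgue_measure m); last first.
  by move=> A mA AI; rewrite /m /mrestr /=; congr (lebesgue_measure _); apply/setIidPl.
apply: integral_itv_bndo_bndc => //.
by apply/measurable_EFinP; exact: measurable_funTS.
Qed.

End CircleFunctions.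

(** * Poisson integrals *)

Section Lusin.
Context {R : realType}.
Implicit Types (G : R[i] -> R) (E B : set (circle R)).

(** The test functions of [korovkin]: the Lipschitz bound gives a rate, and the range [[0, 1]] makes
    the class stable under [1 - G] and products, as indicators are. *)
Definition lip01 G := (exists2 k, 0 <= k & forall z w, `|G z - G w| <= k * normc (z - w)) /\
  forall z, 0 <= G z <= 1.

Lemma lip01_measurable G : lip01 G -> measurable_fun setT (fun x : circle R => G (circle_val x)).
Proof.
move=> [[k k0 kP] _]; apply: circle_cont_measurable => x e e0.
have k1 : 0 < k + 1 by rewrite ltr_wpDl.
exists (e / (k + 1)); first by rewrite divr_gt0.
move=> y; rewrite ltr_pdivlMr// => xy; apply: le_lt_trans (kP _ _) _.
by apply: le_lt_trans xy; rewrite mulrC ler_wpM2l ?normc_ge0// lerDl.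
Qed.

Lemma lip01_bmf G : lip01 G -> bmf (fun x : circle R => G (circle_val x)).
Proof.
move=> lG; split; first exact: lip01_measurable.
by exists 1 => x; have /andP[G0 G1] := lG.2 (circle_val x); rewrite ger0_norm.
Qed.

Lemma lip01_onem G : lip01 G -> lip01 (fun z => 1 - G z).
Proof.
move=> [[k k0 kP] G01]; split; last first.
  by move=> z; have /andP[? ?] := G01 z; rewrite subr_ge0 gerBl; apply/andP.
exists k => // z w; rewrite distrC; apply: le_trans (kP z w).
by rewrite opprB addrC addrA subrK.
Qed.

Lemma lip01M G H : lip01 G -> lip01 H -> lip01 (fun z => G z * H z).
Proof.
move=> [[k k0 kP] G01] [[l l0 lP] H01]; split; last first.
  move=> z; have /andP[? ?] := G01 z; have /andP[? ?] := H01 z.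
  by rewrite mulr_ge0// mulr_ile1.
exists (k + l) => [|z w]; first exact: addr_ge0.
have -> : G z * H z - G w * H w = (G z - G w) * H z + G w * (H z - H w) by ring.
rewrite (le_trans (ler_normD _ _))// [leRHS]mulrDl !normrM.
have /andP[? ?] := G01 w; have /andP[? ?] := H01 z.
apply: lerD; first by rewrite -[leRHS]mulr1 ler_pM// ger0_norm.
by rewrite -[leRHS]mul1r ler_pM// ger0_norm.
Qed.

Lemma lip01_cst1 : lip01 (fun=> 1).
Proof.
split; last by move=> z; rewrite ler01 lexx.
by exists 0 => // z w; rewrite subrr normr0 mul0r.
Qed.

Definition dist_to (C : set R[i]) (z : R[i]) : R := inf [set normc (z - w) | w in C].

Lemma dist_to_lip C z w : C !=set0 -> `|dist_to C z - dist_to C w| <= normc (z - w).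
Proof.
move=> [c Cc].
have H u v : dist_to C u <= dist_to C v + normc (u - v).
  rewrite -lerBlDr; apply: lb_le_inf; first by exists (normc (v - c)), c.
  move=> _ [a Ca <-]; rewrite lerBlDr.
  apply: (@le_trans _ _ (normc (u - a))).
    by apply: ge_inf; [exists 0 => _ [? _ <-]; exact: normc_ge0|exists a].
  by have := le_normcD (u - v) (v - a); rewrite addrA subrK [X in _ <= X]addrC.
rewrite ler_norml; have := H z w; have := H w z; rewrite (normcB w).
by move=> *; apply/andP; split; lra.
Qed.

Lemma dist_to_ge0 C z : C !=set0 -> 0 <= dist_to C z.
Proof.
move=> [c Cc]; apply: lb_le_inf; first by exists (normc (z - c)), c.
by move=> _ [? _ <-]; exact: normc_ge0.
Qed.

Lemma dist_to_in C z : C z -> dist_to C z <= 0.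
Proof.
move=> Cz; apply: ge_inf; first by exists 0 => _ [? _ <-]; exact: normc_ge0.
by exists z => //; rewrite subrr normc0.
Qed.

Lemma dist_to_gt0 (A : set R[i]) z : open A -> A z -> (~` A) !=set0 -> 0 < dist_to (~` A) z.
Proof.
move=> oA Az [c Cc]; have /nbhs_normcP[t t0 tP] : nbhs z A by exact: open_nbhs_nbhs.
apply: lt_le_trans t0 _; apply: lb_le_inf; first by exists (normc (z - c)), c.
by move=> _ [w Cw <-]; rewrite leNgt; apply/negP => /tP.
Qed.

Lemma lip01_dist C (k : R) : C !=set0 -> 0 <= k -> lip01 (fun z => Num.min 1 (k * dist_to C z)).
Proof.
move=> C0 k0; split; last first.
  by move=> z; rewrite le_min ler01/= mulr_ge0 ?dist_to_ge0//= ge_min lexx.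
exists k => // z w; apply: (@le_trans _ _ (`|k * dist_to C z - k * dist_to C w|)); last first.
  by rewrite -mulrBr normrM ger0_norm// ler_wpM2l// dist_to_lip.
move: (k * _) (k * _) => a b; rewrite !minEle.
have := ler_norm (a - b); have := ler_norm (b - a); rewrite (distrC b).
by case: (leP 1 a) => ?; case: (leP 1 b) => ? ? ?; rewrite ?subrr ?normr0// ler_norml; apply/andP; split; lra.
Qed.

Variable gamma : {measure set (circle R) -> \bar R}.
Hypothesis goo : (gamma setT < +oo)%E.

(** Agreement off a small set survives [1 - G] and products, so the sets with this property are
    stable under complements and intersections; together with open traces and countable unions they
    exhaust the measurable sets. *)
Definition lusin E := measurable E /\ forall e : R, 0 < e -> exists G B,
  [/\ lip01 G, measurable B, (gamma B <= e%:E)%E &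
      forall x, ~ B x -> G (circle_val x) = \1_E x].

Lemma lusinC E : lusin E -> lusin (~` E).
Proof.
move=> [mE lE]; split; first exact: measurableC.
move=> e /lE[G [B [lG mB Be GB]]]; exists (fun z => 1 - G z), B; split => //.
  exact: lip01_onem.
move=> x /GB ->; rewrite !indicE in_setC.
by case: (x \in E); rewrite ?subrr ?subr0.
Qed.

Lemma lusinI E F : lusin E -> lusin F -> lusin (E `&` F).
Proof.
move=> [mE lE] [mF lF]; split; first exact: measurableI.
move=> e e0; have e2 : 0 < e / 2 by rewrite divr_gt0.
have [G [B [lG mB Be GB]]] := lE _ e2; have [H [A [lH mA Ae HA]]] := lF _ e2.
exists (fun z => G z * H z), (B `|` A); split.
- exact: lip01M.
- exact: measurableU.
- rewrite (splitr e) EFinD (le_trans (measureU2 _ _ _))//; exact: leeD.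
- by move=> x /not_orP[/GB -> /HA ->]; rewrite indicI.
Qed.

Lemma lusin_open (A : set R[i]) : open A -> lusin [set x : circle R | A (circle_val x)].
Proof.
move=> oA; set E := [set x | _].
have mE : measurable E by apply: sub_sigma_algebra; exists A.
split=> // e e0.
(* If [A] is the whole plane, [dist_to] is an infimum over the empty set and carries no information;
   the constant 1 replaces it. *)
have [A0|] := pselect ((~` A) !=set0); last first.
  move=> A0; exists (fun=> 1), set0; split => //.
  - exact: lip01_cst1.
  - by rewrite measure0 lee_fin ltW.
  - move=> x _; rewrite indicE mem_set// /E /=; apply: contrapT => Ax.
    by apply: A0; exists (circle_val x).
pose G (k : nat) z := Num.min 1 (k%:R * dist_to (~` A) z).
have lG k : lip01 (G k) by apply: lip01_dist.
(* The part of [E] where [G k] has not reached 1. It decreases to the empty set, since a point of an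
   open set has positive distance to the complement. *)
pose B (k : nat) := E `&` [set x : circle R | k%:R * dist_to (~` A) (circle_val x) < 1].
have mB k : measurable (B k).
  apply: measurableI => //.
  rewrite (_ : [set x | _] = ~` (setT `&` [set x : circle R |
      cst 1 x <= k%:R * dist_to (~` A) (circle_val x)])); last first.
    by rewrite setTI; apply/seteqP; split => x /=; rewrite ltNge => /negP.
  apply/measurableC/measurable_fun_le => //.
  apply: circle_cont_measurable => x e1 e10.
  have k1 : 0 < k%:R + 1 :> R by rewrite ltr_wpDl.
  exists (e1 / (k%:R + 1)); first by rewrite divr_gt0.
  move=> y; rewrite ltr_pdivlMr// => xy; rewrite -mulrBr normrM normr_nat.
  apply: le_lt_trans xy; rewrite mulrC ler_pM// ?lerDl//.
  exact: dist_to_lip.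
have B0 : \bigcap_k B k = set0.
  apply/seteqP; split => // x Bx; have [Ex _] := Bx 0%N I.
  have d0 := dist_to_gt0 oA Ex A0.
  have [_] := Bx (Num.bound (dist_to (~` A) (circle_val x))^-1) I.
  rewrite /= -ltr_pdivlMr// mul1r => /ltW; apply/negP; rewrite -ltNge.
  by apply: archi_boundP; rewrite invr_ge0 ltW.
have : (gamma \o B) k @[k --> \oo] --> (0 : \bar R)%E.
  rewrite -[X in _ --> X](measure0 gamma) -B0; apply: nonincreasing_cvg_mu => //.
  - by apply: le_lt_trans goo; apply: le_measure; rewrite ?inE.
  - by rewrite B0.
  - move=> k l kl; rewrite subsetEset => x [Ex /= lx]; split => //=.
    by apply: le_lt_trans lx; rewrite ler_wpM2r ?dist_to_ge0// ler_nat.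
move=> /fine_cvgP[_ /cvgrPdist_lt/(_ e e0)[k _ /(_ k)]] /=; rewrite leqnn => /(_ isT).
rewrite sub0r normrN => Bk; exists (G k), (B k); split => //.
  rewrite -[gamma _]fineK; first by rewrite lee_fin (le_trans (ler_norm _))// ltW.
  by rewrite ge0_fin_numE//; apply: le_lt_trans goo; apply: le_measure; rewrite ?inE.
move=> x Bx; rewrite indicE /G; have [Ex|Ex] := pselect (E x).
  rewrite mem_set//; apply: min_l; rewrite leNgt; apply/negP => lt.
  exact: Bx.
rewrite memNset//; apply/eqP; rewrite eq_le ge_min le_min ler01 !mulr_ge0 ?dist_to_ge0//=.
by rewrite andbT; apply/orP; right; rewrite mulr_ge0_le0// dist_to_in.
Qed.

Lemma lusin_bigcup (F : (set (circle R))^nat) : (forall n, lusin (F n)) ->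
  lusin (\bigcup_n F n).
Proof.
move=> lF; have mF n : measurable (F n) := (lF n).1.
have mU : measurable (\bigcup_n F n) by exact: bigcup_measurable.
split=> // e e0; have e2 : 0 < e / 2 by rewrite divr_gt0.
pose U n := \big[setU/set0]_(k < n) F k.
have lU n : lusin (U n).
  rewrite /U; elim: n => [|n ih].
    rewrite big_ord0 -setCT; apply: lusinC.
    rewrite (_ : setT = [set x : circle R | (setT : set R[i]) (circle_val x)]) //.
    by apply: lusin_open; exact: openT.
  rewrite big_ord_recr /= -[X in lusin X]setCK setCU.
  by apply: lusinC; apply: lusinI; exact: lusinC.
(* The tail of the union decreases to the empty set; half of [e] is spent on it and half on the
   finite union. *)
pose V n := (\bigcup_n F n) `\` U n.
have mV n : measurable (V n) by apply: measurableD => //; exact: (lU n).1.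
have V0 : \bigcap_n V n = set0.
  apply/seteqP; split => // x Vx; have [[n _ Fn] _] := Vx 0%N I.
  have [_] := Vx n.+1 I; apply; rewrite /U -bigcup_mkord.
  by exists n => /=.
have : (gamma \o V) k @[k --> \oo] --> (0 : \bar R)%E.
  rewrite -[X in _ --> X](measure0 gamma) -V0; apply: nonincreasing_cvg_mu => //.
  - by apply: le_lt_trans goo; apply: le_measure; rewrite ?inE.
  - by rewrite V0.
  - move=> k l kl; rewrite subsetEset => x [Ux lx]; split => // kx; apply: lx.
    move: kx; rewrite /U -!bigcup_mkord => -[j /= jk Fj]; exists j => //=.
    exact: leq_trans jk kl.
move=> /fine_cvgP[_ /cvgrPdist_lt/(_ _ e2)[k _ /(_ k)]] /=; rewrite leqnn => /(_ isT).
rewrite sub0r normrN => Vk.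
have gV : (gamma (V k) <= (e / 2)%:E)%E.
  rewrite -[gamma (V k)]fineK; first by rewrite lee_fin (le_trans (ler_norm _))// ltW.
  by rewrite ge0_fin_numE//; apply: le_lt_trans goo; apply: le_measure; rewrite ?inE.
have [G [B [lG mB Be GB]]] := (lU k).2 _ e2.
exists G, (B `|` V k); split => //.
- exact: measurableU.
- rewrite (splitr e) EFinD (le_trans (measureU2 _ _ _))//; exact: leeD.
- move=> x /not_orP[/GB -> nV]; rewrite !indicE.
  have [Ux|Ux] := pselect (U k x).
    rewrite !mem_set//; move: Ux; rewrite /U -bigcup_mkord => -[j _ Fj].
    by exists j.
  rewrite !memNset// => Fx; exact: nV.
Qed.

Lemma measurable_lusin E : measurable E -> lusin E.
Proof.
move=> mE; have : [set F | lusin F] E.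
  apply: (smallest_sub _ _ mE).
    split.
    - rewrite /= (_ : set0 = [set x : circle R | (set0 : set R[i]) (circle_val x)]) //.
      by apply: lusin_open; exact: open0.
    - by move=> F lF; rewrite /= setTD; exact: lusinC.
    - exact: lusin_bigcup.
  by move=> F [A oA <-]; exact: lusin_open.
by [].
Qed.

End Lusin.

Section PoissonKernel.
Context {R : realType}.
Implicit Types (x y : circle R) (z w l : R[i]).

(** The Herglotz kernel; for [z] on the circle its real part is the Poisson kernel. *)
Definition herK z w : R[i] := (z + w) / (z - w).

Lemma circle_sub_neq0 z w : normc z = 1 -> normc w < 1 -> z - w != 0.
Proof. by move=> z1 w1; rewrite subr_eq0; apply: contraTneq w1 => <-; rewrite z1 ltxx. Qed.

Lemma Re_herK z w : normc z = 1 -> normc w < 1 ->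
  Re (herK z w) = (1 - normc w ^+ 2) / normc (z - w) ^+ 2.
Proof.
move=> z1 w1; have zw := circle_sub_neq0 z1 w1.
have n0 : normc (z - w) ^+ 2 != 0 by rewrite expf_eq0 /= normc_eq0.
have -> : herK z w = ((normc (z - w) ^+ 2)^-1)%:C * ((z + w) * conjc (z - w)).
  have : conjc (z - w) != 0 by rewrite conjc_eq0.
  rewrite /herK fmorphV /= -mulcJ; move: (conjc _) => c c0.
  by field; rewrite zw c0.
rewrite cReZ mulrC; congr (_ / _).
have := sqr_normc_Re_Im z; rewrite z1 expr1n => ->; rewrite sqr_normc_Re_Im.
by case: z {z1 zw n0} => a b; case: w {w1} => c d /=; ring.
Qed.

Lemma Re_herK_gt0 z w : normc z = 1 -> normc w < 1 -> 0 < Re (herK z w).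
Proof.
move=> z1 w1; rewrite Re_herK// divr_gt0//.
  by rewrite subr_gt0 expr_lt1// normc_ge0.
by rewrite exprn_gt0// normc_gt0 circle_sub_neq0.
Qed.

Lemma herK_circle_cont w : normc w < 1 -> circle_cont (fun z => herK z w).
Proof.
move=> w1; apply: dif_circle_cont => z z1.
apply: difM; first by apply: difD; [exact: dif_id|exact: dif_cst].
apply: difV; first by apply: difB; [exact: dif_id|exact: dif_cst].
exact: circle_sub_neq0.
Qed.

Definition arc_charge : signed_measure R :=
  charge_of_finite_measure (@arc_length R).

Lemma arc_length_oo : (@arc_length R setT < +oo)%E.
Proof. by rewrite -ge0_fin_numE//; exact: fin_num_measure. Qed.

Lemma arc_chargeE (E : set (circle R)) (f : circle R -> R) : measurable E -> bmf f ->
  ci arc_charge E f = \int[@arc_length R]_(x in E) f x.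
Proof.
move=> mE bf; rewrite (@charge_integral_decomp _ _ _ _ (@arc_length R) mzero)//.
- by rewrite /Rintegral integral_measure_zero subr0.
- exact: arc_length_oo.
- by rewrite /mzero ltry.
- by move=> A mA; rewrite /mzero sube0.
Qed.

Lemma arc_mean (F : R[i] -> R[i]) (r : R) : 1 < r ->
  (forall z, normc z < r -> differentiable F z) ->
  ci arc_charge setT (fun x => Re (F (circle_val x))) =
  2 * pi * Re (F 0).
Proof.
move=> r1 dF.
have cF : circle_cont F by apply: dif_circle_cont => z z1; apply: dF; rewrite z1.
rewrite arc_chargeE//; last exact: bmf_circle_Re.
rewrite arc_integral; last exact: bmf_circle_Re.
rewrite -(@circle_mean _ F 0 1 r ltr01 r1).
- by congr intR; apply/funext => t; rewrite /= add0r mul1r.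
- by move=> z _; rewrite subr0; exact: dF.
- by apply/differentiable_continuous/dF; rewrite normc0 (lt_trans _ r1).
Qed.

Lemma mul_neq1 z w (r : R) : normc z <= r -> normc w < r^-1 -> 0 < r -> 1 - z * w != 0.
Proof.
move=> zr wr r0; rewrite subr_eq0; apply/eqP => /(congr1 (@normc R)).
rewrite normc1 normcM => E.
suff : normc z * normc w < 1 by rewrite -E ltxx.
have r0' : r != 0 by rewrite gt_eqF.
rewrite -(divff r0') (@le_lt_trans _ _ (r * normc w))//.
  by rewrite ler_wpM2r ?normc_ge0.
by rewrite ltr_pM2l.
Qed.

(* x and y are exchanged by |x - r y| = |y - r x| on the circle *)
Lemma arc_herK (a : R[i]) (r : R) : 0 < r -> r < 1 -> normc a <= r ->
  ci arc_charge setT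
    (fun x => Re ((1 + a * circle_val x) / (1 - a * circle_val x))) = 2 * pi.
Proof.
move=> r0 r1 ar.
have r1' : 1 < r^-1 by rewrite invf_gt1.
have -> : 2 * pi = 2 * pi * Re ((1 + a * 0) / (1 - a * 0)).
  by rewrite mulr0 addr0 subr0 divr1 mulr1.
apply: (@arc_mean (fun z => (1 + a * z) / (1 - a * z)) r^-1 r1').
move=> z zr; apply: difM.
  by apply: difD; [exact: dif_cst|apply: difM; [exact: dif_cst|exact: dif_id]].
apply: difV; last exact: mul_neq1 ar zr r0.
by apply: difB; [exact: dif_cst|apply: difM; [exact: dif_cst|exact: dif_id]].
Qed.

Lemma circle_inv z : normc z = 1 -> z^-1 = conjc z.
Proof.
move=> z1; have z0 : z != 0 by rewrite -normc_gt0 z1.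
by apply: (mulfI z0); rewrite divff// mulcJ z1 expr1n.
Qed.

(** As a function of [x] the kernel has a pole at [w], inside the disc. Substituting [conjc x] for
    the inverse of [x] moves the pole outside, after which the mean value property on the circle is
    available. *)
Lemma herK_conj x w : normc w < 1 ->
  herK (circle_val x) w = conjc ((1 + conjc w * circle_val x) / (1 - conjc w * circle_val x)).
Proof.
move=> w1; have x1 := normc_circle x; have xw := circle_sub_neq0 x1 w1.
have x0 : circle_val x != 0 by rewrite -normc_gt0 x1.
rewrite rmorphM fmorphV rmorphD rmorphB !rmorphM rmorph1 /= conjcK -circle_inv//.
by rewrite /herK; field; rewrite x0 xw.
Qed.

End PoissonKernel.

Section PoissonApproximation.
Context {R : realType}.
Implicit Types (x y : circle R) (z w l : R[i]).
Local Notation aint := (ci (@arc_charge R) setT).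

Lemma aint_le (f g : circle R -> R) : bmf f -> bmf g -> (forall x, f x <= g x) ->
  aint f <= aint g.
Proof.
move=> bf bg fg; rewrite !arc_chargeE//; apply: le_Rintegral => //.
  exact: (bmf_integrable (@arc_length_oo R)).
exact: (bmf_integrable (@arc_length_oo R)).
Qed.

Lemma aint_cst (c : R) : aint (fun=> c) = c * (2 * pi).
Proof.
have dF z : normc z < 2 -> differentiable (fun _ : R[i] => c%:C : R[i]) z.
  by move=> _; exact: dif_cst.
have lt12 : 1 < 2 :> R by rewrite ltr1n.
by have := arc_mean lt12 dF; rewrite /= => ->; rewrite mulrC.
Qed.

Definition pk (r : R) x y := Re (herK (circle_val x) (r%:C * circle_val y)).

Section radius.
Variable r : R.
Hypotheses (r0 : 0 < r) (r1 : r < 1).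

Lemma normc_rcircle y : normc (r%:C * circle_val y) = r.
Proof. by rewrite normcM normc_circle mulr1 normc_real gtr0_norm. Qed.

Lemma pkE x y : pk r x y = (1 - r ^+ 2) / normc (circle_val x - r%:C * circle_val y) ^+ 2.
Proof. by rewrite /pk Re_herK ?normc_rcircle// normc_circle. Qed.

Lemma pk_gt0 x y : 0 < pk r x y.
Proof. by rewrite /pk Re_herK_gt0 ?normc_rcircle ?normc_circle. Qed.

Lemma pk_den x y : (1 - r) ^+ 2 <= normc (circle_val x - r%:C * circle_val y) ^+ 2.
Proof.
rewrite ler_pXn2r ?nnegrE ?normc_ge0 ?subr_ge0 ?(ltW r1)// lerBlDr.
rewrite -[X in X <= _](normc_circle x) -[X in _ <= _ + X](normc_rcircle y).
by rewrite -[X in normc X <= _](subrK (r%:C * circle_val y)) le_normcD.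
Qed.

Lemma pk_le x y : pk r x y <= (1 - r ^+ 2) / (1 - r) ^+ 2.
Proof.
have r2 : 0 < 1 - r ^+ 2 by rewrite subr_gt0 expr_lt1// ltW.
have r3 : 0 < (1 - r) ^+ 2 by rewrite exprn_gt0// subr_gt0.
rewrite pkE ler_pM2l// lef_pV2 ?posrE ?pk_den//.
exact: lt_le_trans (pk_den x y).
Qed.

(** This amounts to [r |x - y|^2 <= |x - r y|^2]; on the circle the two sides differ by [(1 - r)^2].
    It is the small second moment on which [korovkin] relies. *)
Lemma pk_sqr x y : pk r x y * normc (circle_val x - circle_val y) ^+ 2 <= (1 - r ^+ 2) / r.
Proof.
have r2 : 0 < 1 - r ^+ 2 by rewrite subr_gt0 expr_lt1// ltW.
have r3 : 0 < (1 - r) ^+ 2 by rewrite exprn_gt0// subr_gt0.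
have d0 := lt_le_trans r3 (pk_den x y).
rewrite pkE mulrAC ler_pdivrMr// -mulrA ler_pM2l// mulrC ler_pdivlMr// mulrC.
have := sqr_normc_Re_Im (circle_val x); have := sqr_normc_Re_Im (circle_val y).
rewrite !normc_circle expr1n !sqr_normc_Re_Im; case: (circle_val x) => a b.
case: (circle_val y) => c d /= cd ab; rewrite -subr_ge0.
have -> : (a - (r * c - 0 * d)) ^+ 2 + (b - (r * d + 0 * c)) ^+ 2 -
  r * ((a - c) ^+ 2 + (b - d) ^+ 2) =
  (1 - r) * ((a ^+ 2 + b ^+ 2) - r * (c ^+ 2 + d ^+ 2)) by ring.
by rewrite -cd -ab mulr1 mulr_ge0// subr_ge0 ltW.
Qed.

Lemma pk_bmf_r x : bmf (pk r x).
Proof.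
apply: (@bmf_circle_Re R (fun z => herK (circle_val x) (r%:C * z))).
apply: dif_circle_cont => z z1.
apply: difM; first by apply: difD; [exact: dif_cst|apply: difM; [exact: dif_cst|exact: dif_id]].
apply: difV; first by apply: difB; [exact: dif_cst|apply: difM; [exact: dif_cst|exact: dif_id]].
by apply: circle_sub_neq0; rewrite ?normc_circle// normcM z1 mulr1 normc_real gtr0_norm.
Qed.

Lemma pk_bmf_l y : bmf (pk r ^~ y).
Proof.
apply: (@bmf_circle_Re R (fun z => herK z (r%:C * circle_val y))).
by apply: herK_circle_cont; rewrite normc_rcircle.
Qed.

Lemma pk_mean x : aint (pk r x) = 2 * pi.
Proof.
rewrite -(@arc_herK R (r%:C * conjc (circle_val x)) r r0 r1); last first.
  by rewrite normcM normc_conjc normc_circle mulr1 normc_real gtr0_norm.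
apply: eq_ci => y _; rewrite /pk /herK; congr Re.
have x1 := normc_circle x.
have x0 : circle_val x != 0 by rewrite -normc_gt0 x1.
have := @circle_sub_neq0 _ _ (r%:C * circle_val y) x1.
rewrite normc_rcircle -circle_inv// => /(_ r1) xy.
by field; rewrite x0 xy.
Qed.

(** A positive kernel of mean one and small second moment is an approximate identity. With
    [n = |x - y|], the arithmetic-geometric inequality gives [|G y - G x| <= k n <= k (t / 2 + n^2 /
    (2 t))], and [pk_sqr] bounds the kernel times the last term. *)
Lemma korovkin (G : R[i] -> R) (k t : R) x : 0 <= k -> 0 < t -> lip01 G ->
  (forall z w, `|G z - G w| <= k * normc (z - w)) ->
  `|(2 * pi)^-1 * aint (fun y => pk r x y * G (circle_val y)) - G (circle_val x)|
  <= k * (t / 2 + (1 - r ^+ 2) / r / (2 * t)).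
Proof.
move=> k0 t0 lG kP; have pi0 : 0 < 2 * pi :> R by rewrite mulr_gt0// pi_gt0.
have bG := lip01_bmf lG; have bp := pk_bmf_r x.
set g := G (circle_val x).
have -> : (2 * pi)^-1 * aint (fun y => pk r x y * G (circle_val y)) - g =
    (2 * pi)^-1 * aint (fun y => pk r x y * (G (circle_val y) - g)).
  have -> : aint (fun y => pk r x y * (G (circle_val y) - g)) =
     aint (fun y => pk r x y * G (circle_val y)) - g * (2 * pi).
    rewrite -(pk_mean x) -ciZ// -ciB//; last 2 first.
      exact: bmfM.
      exact: bmfZ.
    by apply: eq_ci => y _; ring.
  by rewrite [RHS]mulrBr; congr (_ - _); rewrite [RHS]mulrC mulfK// gt_eqF.
rewrite normrM gtr0_norm ?invr_gt0// mulrC ler_pdivrMr//.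
set e := k * (t / 2); set e2 := k * ((1 - r ^+ 2) / r / (2 * t)).
have bb : bmf (fun y => e * pk r x y + e2).
  by apply: bmfD; [exact: bmfZ|exact: bmf_cst].
have bg : bmf (fun y => pk r x y * (G (circle_val y) - g)).
  by apply: bmfM => //; apply: bmfB => //; exact: bmf_cst.
have E : aint (fun y => e * pk r x y + e2) =
    k * (t / 2 + (1 - r ^+ 2) / r / (2 * t)) * (2 * pi).
  rewrite ciD//; [|exact: bmfZ|exact: bmf_cst].
  by rewrite ciZ// pk_mean aint_cst /e /e2; ring.
have H y : `|pk r x y * (G (circle_val y) - g)| <= e * pk r x y + e2.
  have p0 := ltW (pk_gt0 x y).
  rewrite normrM ger0_norm//; set n := normc (circle_val x - circle_val y).
  have Gn : `|G (circle_val y) - g| <= k * (t / 2 + n ^+ 2 / (2 * t)).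
    rewrite distrC (le_trans (kP _ _))// ler_wpM2l// -/n -subr_ge0.
    have -> : t / 2 + n ^+ 2 / (2 * t) - n = (t - n) ^+ 2 / (2 * t).
      by field; rewrite gt_eqF.
    by rewrite divr_ge0 ?sqr_ge0// mulr_ge0// ltW.
  apply: (le_trans (ler_wpM2l p0 Gn)).
  have -> : pk r x y * (k * (t / 2 + n ^+ 2 / (2 * t))) =
     e * pk r x y + k * (pk r x y * n ^+ 2 / (2 * t)) by rewrite /e; ring.
  rewrite lerD2l ler_wpM2l// ler_pM2r ?pk_sqr// invr_gt0 mulr_gt0//.
rewrite -E ler_norml; apply/andP; split.
  rewrite -ciN//; apply: aint_le => // [|y]; first exact: bmfN.
  by have := H y; rewrite ler_norml => /andP[].
apply: aint_le => // y.
by have := H y; rewrite ler_norml => /andP[].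
Qed.

Lemma pk_measurable : measurable_fun setT (fun p : circle R * circle R => pk r p.1 p.2).
Proof.
pose D (p : circle R * circle R) := normc (circle_val p.1 - r%:C * circle_val p.2) ^+ 2.
have D0 p : 0 < D p.
  by apply: lt_le_trans (pk_den p.1 p.2); rewrite exprn_gt0// subr_gt0.
(* Division by [D > 0] is written as the exponential of a logarithm, so that joint measurability
   follows by composition. *)
have -> : (fun p : circle R * circle R => pk r p.1 p.2) =
    (fun p => (1 - r ^+ 2) * expR (0 - ln (D p))).
  by apply/funext => p; rewrite pkE sub0r expRN lnK// posrE D0.
have cid : circle_cont (@id R[i]).
  by apply: dif_circle_cont => z _; exact: dif_id.
have mRe := (bmf_circle_Re cid).1; have mIm := (bmf_circle_Im cid).1.
have mD : measurable_fun setT D.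
  have -> : D = (fun p : circle R * circle R =>
     (Re (circle_val p.1) - r * Re (circle_val p.2)) *
     (Re (circle_val p.1) - r * Re (circle_val p.2)) +
     (Im (circle_val p.1) - r * Im (circle_val p.2)) *
     (Im (circle_val p.1) - r * Im (circle_val p.2))).
    by apply/funext => p; rewrite /D sqr_normc_Re_Im !(cReB, cImB) cReZ cImZ; ring.
  have m1 : measurable_fun setT (fun p : circle R * circle R => Re (circle_val p.1)).
    exact: (measurableT_comp mRe measurable_fst).
  have m2 : measurable_fun setT (fun p : circle R * circle R => Re (circle_val p.2)).
    exact: (measurableT_comp mRe measurable_snd).
  have m3 : measurable_fun setT (fun p : circle R * circle R => Im (circle_val p.1)).
    exact: (measurableT_comp mIm measurable_fst).
  have m4 : measurable_fun setT (fun p : circle R * circle R => Im (circle_val p.2)).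
    exact: (measurableT_comp mIm measurable_snd).
  have m5 : measurable_fun setT (fun p : circle R * circle R =>
     Re (circle_val p.1) - r * Re (circle_val p.2)).
    by apply: measurable_funB => //; apply: measurable_funM.
  have m6 : measurable_fun setT (fun p : circle R * circle R =>
     Im (circle_val p.1) - r * Im (circle_val p.2)).
    by apply: measurable_funB => //; apply: measurable_funM.
  by apply: measurable_funD; apply: measurable_funM.
apply: measurable_funM => //; apply: measurableT_comp; first exact: measurable_expR.
apply: measurable_funB => //; by apply: measurableT_comp; first exact: measurable_ln.
Qed.

End radius.
End PoissonApproximation.

Section PoissonNegative.
Context {R : realType}.
Implicit Types (x y : circle R).
Local Notation aint := (ci (@arc_charge R) setT).

Section fubini.
Variables (r : R) (G : R[i] -> R).
Hypotheses (r0 : 0 < r) (r1 : r < 1) (lG : lip01 G).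
Variable m : {finite_measure set (circle R) -> \bar R}.

Let moo : (m setT < +oo)%E.
Proof. by rewrite -ge0_fin_numE//; exact: fin_num_measure. Qed.

Let f (p : circle R * circle R) := (pk r p.1 p.2 * G (circle_val p.2))%:E.

Let f0 p : (0 <= f p)%E.
Proof.
rewrite lee_fin mulr_ge0//; first exact/ltW/pk_gt0.
by have /andP[] := lG.2 (circle_val p.2).
Qed.

Let mf : measurable_fun setT f.
Proof.
apply/measurable_EFinP/measurable_funM; first exact: pk_measurable.
exact: (measurableT_comp (lip01_measurable lG) measurable_snd).
Qed.

Let bpG x : bmf (fun y => pk r x y * G (circle_val y)).
Proof. by apply: bmfM; [exact: pk_bmf_r|exact: lip01_bmf]. Qed.

Let FE x : fubini_F (@arc_length R) f x = (aint (fun y => pk r x y * G (circle_val y)))%:E.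
Proof.
rewrite arc_chargeE// /Rintegral fineK//.
exact/integrable_fin_num/(bmf_integrable (@arc_length_oo R)).
Qed.

Let GE y : fubini_G m f y = (\int[m]_x (pk r x y) * G (circle_val y))%:E.
Proof.
rewrite -RintegralZr//; last by apply: bmf_integrable => //; exact: pk_bmf_l.
rewrite /Rintegral fineK//; apply: integrable_fin_num => //.
apply: bmf_integrable => //; apply: bmfM; [exact: pk_bmf_l|exact: bmf_cst].
Qed.

Let pi0 : 0 < 2 * pi :> R.
Proof. by rewrite mulr_gt0// pi_gt0. Qed.

Let C := (1 - r ^+ 2) / (1 - r) ^+ 2.

Let C0 : 0 <= C.
Proof. by rewrite divr_ge0// ?exprn_ge0 ?subr_ge0 ?(ltW r1)// expr_le1// ?ltW. Qed.

Let pG_bound x y : `|pk r x y * G (circle_val y)| <= C.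
Proof.
have /andP[G0 G1] := lG.2 (circle_val y).
by rewrite normrM (gtr0_norm (pk_gt0 r0 r1 x y)) (ger0_norm G0) -[leRHS]mulr1
  ler_pM ?pk_le// ltW// pk_gt0.
Qed.

Lemma aint_pk_bmf : bmf (fun x => aint (fun y => pk r x y * G (circle_val y))).
Proof.
split.
  apply/measurable_EFinP; have := measurable_fun_fubini_tonelli_F (m2 := @arc_length R) _ mf f0.
  by congr (measurable_fun _ _); apply/funext => x; rewrite FE.
exists (C * (fine (jpos (@arc_charge R) setT) + fine (jneg (@arc_charge R) setT))) => x.
by apply: ci_bound => // y _; exact: pG_bound.
Qed.

Lemma int_pk_bmf : bmf (fun y => \int[m]_x (pk r x y) * G (circle_val y)).
Proof.
split.
  apply/measurable_EFinP; have := measurable_fun_fubini_tonelli_G (m1 := m) _ mf f0.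
  by congr (measurable_fun _ _); apply/funext => x; rewrite GE.
exists (C * fine (m setT)) => y.
have /andP[G0 G1] := lG.2 (circle_val y).
rewrite normrM (ger0_norm G0) -[leRHS]mulr1 ler_pM//.
apply: Rint_bound => //; first exact: pk_bmf_l.
by move=> x _; rewrite (gtr0_norm (pk_gt0 r0 r1 x y)) pk_le.
Qed.

Lemma pk_fubini : \int[m]_x (aint (fun y => pk r x y * G (circle_val y))) =
  aint (fun y => \int[m]_x (pk r x y) * G (circle_val y)).
Proof.
rewrite arc_chargeE//; last exact: int_pk_bmf.
rewrite /Rintegral; congr fine.
under eq_integral do rewrite -FE.
under [RHS]eq_integral do rewrite -[X in X * _]/(\int[m]_x _) -GE.
exact: fubini_tonelli.
Qed.

End fubini.

Variables (I : finType) (nu : I -> signed_measure R) (c : I -> R).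
Hypothesis neg : forall l, normc l < 1 ->
  \sum_i c i * ci (nu i) setT (fun x => Re (herK (circle_val x) l)) <= 0.

Let tv i := fine (jpos (nu i) setT) + fine (jneg (nu i) setT).

(** By Tonelli the sum is an average over [y], with the weight [G y >= 0], of the Poisson integrals
    at [r y], whose sign is given by [neg]. *)
Lemma poisson_neg_avg r (G : R[i] -> R) : 0 < r -> r < 1 -> lip01 G ->
  \sum_i c i * ci (nu i) setT
    (fun x => (2 * pi)^-1 * aint (fun y => pk r x y * G (circle_val y))) <= 0.
Proof.
move=> r0 r1 lG; have pi0 : 0 < 2 * pi :> R by rewrite mulr_gt0// pi_gt0.
have bA := aint_pk_bmf r0 r1 lG.
have E i : ci (nu i) setT
    (fun x => (2 * pi)^-1 * aint (fun y => pk r x y * G (circle_val y))) =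
  (2 * pi)^-1 * aint (fun y => ci (nu i) setT (pk r ^~ y) * G (circle_val y)).
  rewrite ciZ//; congr (_ * _); rewrite charge_integralE.
  rewrite !(pk_fubini r0 r1 lG) -ciB//; [|exact: int_pk_bmf..].
  by apply: eq_ci => y _; rewrite -mulrBl.
under eq_bigr do rewrite E mulrCA.
rewrite -mulr_sumr pmulr_rle0 ?invr_gt0//.
have bH i : bmf (fun y => ci (nu i) setT (pk r ^~ y) * G (circle_val y)).
  under eq_fun do rewrite charge_integralE mulrBl.
  by apply: bmfB; exact: int_pk_bmf.
have -> : \sum_i c i * aint (fun y => ci (nu i) setT (pk r ^~ y) * G (circle_val y)) =
  aint (fun y => \sum_i c i * (ci (nu i) setT (pk r ^~ y) * G (circle_val y))).
  rewrite ci_sum//; last by move=> i; exact: bmfZ.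
  by apply: eq_bigr => i _; rewrite ciZ.
rewrite -[leRHS](ci0 arc_charge (@measurableT _ (circle R))); apply: aint_le.
- by apply: bmf_sum => i; exact: bmfZ.
- exact: bmf_cst.
- move=> y; under eq_bigr do rewrite mulrA.
  rewrite -mulr_suml mulr_le0_ge0//.
    by apply: neg; rewrite normc_rcircle.
  by have /andP[] := lG.2 (circle_val y).
Qed.

Lemma poisson_neg_lip (G : R[i] -> R) : lip01 G ->
  \sum_i c i * ci (nu i) setT (fun x => G (circle_val x)) <= 0.
Proof.
move=> lG; have [[k k0 kP] _] := lG; apply/ler_addgt0Pr => e' e'0; rewrite add0r.
pose S := \sum_i `|c i| * tv i.
have tv0 i : 0 <= tv i by rewrite addr_ge0// fine_ge0.
have S0 : 0 <= S by apply: sumr_ge0 => i _; rewrite mulr_ge0.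
pose M := (k + 1) * (S + 1).
have M0 : 0 < M by rewrite mulr_gt0// ltr_wpDl.
pose t := Num.min 1 (e' / M).
have t0 : 0 < t by rewrite lt_min ltr01 divr_gt0.
have t1 : t <= 1 by rewrite ge_min lexx.
(* with 1 - r = t^2/4 the Korovkin bound is at most k t *)
pose r := 1 - t ^+ 2 / 4.
have t2 : t ^+ 2 <= 1 by rewrite expr_le1// ltW.
have t20 : 0 < t ^+ 2 by rewrite exprn_gt0.
have r0 : 0 < r by rewrite /r; clear -t2; lra.
have r1 : r < 1 by rewrite /r; clear -t20; lra.
have Kt : t / 2 + (1 - r ^+ 2) / r / (2 * t) <= t.
  have -> : (1 - r ^+ 2) / r / (2 * t) = (1 + r) / r * (t / 8).
    by rewrite /r; field; rewrite !gt_eqF//; rewrite /r in r0; clear -r0; lra.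
  have : (1 + r) / r <= 4 by rewrite ler_pdivrMr// /r; clear -t2; lra.
  move: (_ / r) => q q4; have : 0 <= (4 - q) * t by rewrite mulr_ge0 ?subr_ge0// ltW.
  clear; lra.
set u := fun x => (2 * pi)^-1 * aint (fun y => pk r x y * G (circle_val y)).
have bu : bmf u by apply: bmfZ; exact: aint_pk_bmf.
have bG := lip01_bmf lG.
have uG x : `|G (circle_val x) - u x| <= k * t.
  by rewrite distrC (le_trans (korovkin r0 r1 x k0 t0 lG kP))// ler_wpM2l.
have step i : c i * ci (nu i) setT (fun x => G (circle_val x)) <=
    c i * ci (nu i) setT u + k * t * (`|c i| * tv i).
  rewrite -lerBlDl -mulrBr -ciB// mulrCA (le_trans (ler_norm _))// normrM.
  rewrite ler_wpM2l//; apply: ci_bound => //; first exact: bmfB.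
  by rewrite mulr_ge0// ltW.
apply: (@le_trans _ _ (\sum_i (c i * ci (nu i) setT u + k * t * (`|c i| * tv i)))).
  by apply: ler_sum => i _.
rewrite big_split /= -mulr_sumr -/S -[leRHS]add0r lerD ?poisson_neg_avg//.
have tM : t * M <= e' by rewrite -ler_pdivlMr// ge_min lexx orbT.
apply: le_trans tM; rewrite mulrAC mulrC ler_wpM2l ?(ltW t0)// /M.
by rewrite ler_pM// lerDl.
Qed.

Lemma finite_dominating (s : seq {measure set (circle R) -> \bar R}) :
  all (fun m : {measure set (circle R) -> \bar R} => (m setT < +oo)%E) s ->
  exists2 g : {measure set (circle R) -> \bar R}, (g setT < +oo)%E &
    forall m, List.In m s -> forall A, measurable A -> (m A <= g A)%E.
Proof.
elim: s => [_|m s ih /= /andP[moo /ih[g goo gP]]].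
  by exists mzero; rewrite ?/mzero ?ltry.
exists (measure_add m g).
  suff : (measure_add m g setT < +oo)%E by [].
  by rewrite measure_addE lte_add_pinfty.
move=> m' m's A mA; suff : (m' A <= measure_add m g A)%E by [].
rewrite measure_addE; case: m's => [<-|/gP m's]; first exact: leeDl.
by apply: le_trans (m's _ mA) _; exact: leeDr.
Qed.

(** [measurable_lusin] replaces the indicator by a Lipschitz function, to which [poisson_neg_lip]
    applies. One finite measure dominating all Jordan parts provides a single exceptional set for
    every [i]. *)
Lemma poisson_neg (E : set (circle R)) : measurable E ->
  \sum_i c i * ci (nu i) setT \1_E <= 0.
Proof.
move=> mE; apply/ler_addgt0Pr => e' e'0; rewrite add0r.
pose ms := [seq (jpos (nu i) : {measure set (circle R) -> \bar R}) | i <- enum I] ++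
  [seq (jneg (nu i) : {measure set (circle R) -> \bar R}) | i <- enum I].
have [|g goo gP] := @finite_dominating ms.
  rewrite all_cat; apply/andP; split; rewrite all_map; apply/allP => i _ /=;
    [exact: jpos_oo|exact: jneg_oo].
(* The factor 2 accounts for the two Jordan parts, each of which errs by at most [e]. *)
pose S := \sum_i `|c i| * 2.
have S0 : 0 <= S by apply: sumr_ge0 => i _; rewrite mulr_ge0.
pose e := e' / (S + 1).
have S1 : 0 < S + 1 by rewrite ltr_wpDl.
have e0 : 0 < e by rewrite divr_gt0.
have [_ /(_ e e0)[G [B [lG mB Be GB]]]] := measurable_lusin goo mE.
have bG := lip01_bmf lG; have bE := @bmf_indic _ _ R _ mE.
have bD : bmf (fun x : circle R => \1_E x - G (circle_val x)) by exact: bmfB.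
have D1 x : `|\1_E x - G (circle_val x)| <= 1.
  have /andP[G0 G1] := lG.2 (circle_val x).
  by rewrite indicE ler_norml; case: (_ \in _) => /=; apply/andP; split; clear -G0 G1; lra.
have ReE (m : {measure set (circle R) -> \bar R}) : List.In m ms ->
    `|\int[m]_x (\1_E x - G (circle_val x))| <= e.
  move=> mm; have mBe : (m B <= e%:E)%E by exact: le_trans (gP _ mm _ mB) Be.
  have moo : (m setT < +oo)%E by exact: le_lt_trans (gP _ mm _ measurableT) goo.
  have iB : m.-integrable setT (EFin \o (\1_B : circle R -> R)).
    by apply: bmf_integrable => //; exact: bmf_indic.
  have iD := bmf_integrable moo measurableT bD.
  apply: (le_trans (le_normr_Rintegral measurableT iD)).
  apply: (@le_trans _ _ (\int[m]_x \1_B x)).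
    apply: le_Rintegral => //; first exact: integrable_norm.
    move=> x _; rewrite [leRHS]indicE; have [xB|xB] := boolP (x \in B); first exact: D1.
    by rewrite GB ?subrr ?normr0// => Bx; move: xB; rewrite mem_set.
  rewrite /Rintegral integral_indic// setIT -lee_fin fineK//.
  by rewrite ge0_fin_numE// (le_lt_trans mBe)// ltry.
have inm i : List.In (jpos (nu i) : {measure set (circle R) -> \bar R}) ms /\
    List.In (jneg (nu i) : {measure set (circle R) -> \bar R}) ms.
  have Ii : List.In i (enum I).
    have : i \in enum I by rewrite mem_enum.
    elim: (enum I) => // j s ih; rewrite in_cons => /predU1P[->|/ih]; by [left|right].
  split; apply/List.in_or_app; [left|right].
    exact: (List.in_map (fun i => (jpos (nu i) : {measure set (circle R) -> \bar R})) _ _ Ii).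
  exact: (List.in_map (fun i => (jneg (nu i) : {measure set (circle R) -> \bar R})) _ _ Ii).
have step i : c i * ci (nu i) setT \1_E <=
    c i * ci (nu i) setT (fun x => G (circle_val x)) + e * (`|c i| * 2).
  rewrite -lerBlDl -mulrBr -ciB// mulrCA (le_trans (ler_norm _))// normrM.
  rewrite ler_wpM2l// charge_integralE (le_trans (ler_normB _ _))//.
  have [ip inn] := inm i; have := ReE _ ip; have := ReE _ inn.
  move: (`|_|) (`|_|) => a b; clear; lra.
apply: (@le_trans _ _ (\sum_i (c i * ci (nu i) setT (fun x => G (circle_val x))
    + e * (`|c i| * 2)))).
  by apply: ler_sum => i _.
rewrite big_split /= -mulr_sumr -/S -[leRHS]add0r lerD ?poisson_neg_lip//.
have -> : e' = e * (S + 1) by rewrite /e mulfVK// gt_eqF.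
by rewrite ler_pM2l// lerDl.
Qed.

End PoissonNegative.

(** * Separation of convex sets *)

Section Separation.
Context {R : realType} {N : nat}.
Implicit Types (u v w y p : 'rV[R]_N).

Definition dotv u v : R := \sum_i u 0 i * v 0 i.

Lemma dotvDl u v w : dotv (u + v) w = dotv u w + dotv v w.
Proof. by rewrite -big_split; apply: eq_bigr => i _; rewrite mxE mulrDl. Qed.

Lemma dotvDr u v w : dotv w (u + v) = dotv w u + dotv w v.
Proof. by rewrite -big_split; apply: eq_bigr => i _; rewrite mxE mulrDr. Qed.

Lemma dotvZl a u v : dotv (a *: u) v = a * dotv u v.
Proof. by rewrite mulr_sumr; apply: eq_bigr => i _; rewrite mxE mulrA. Qed.

Lemma dotvZr a u v : dotv v (a *: u) = a * dotv v u.
Proof. by rewrite mulr_sumr; apply: eq_bigr => i _; rewrite mxE mulrCA. Qed.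

Lemma dotvNl u v : dotv (- u) v = - dotv u v.
Proof. by rewrite -scaleN1r dotvZl mulN1r. Qed.

Lemma dotvBr u v w : dotv w (u - v) = dotv w u - dotv w v.
Proof. by rewrite dotvDr -[X in _ + dotv _ X]scaleN1r dotvZr mulN1r. Qed.

Lemma dotv0l v : dotv 0 v = 0.
Proof. by rewrite -(scale0r v) dotvZl mul0r. Qed.

Lemma dotv_gt0 u : u != 0 -> 0 < dotv u u.
Proof.
move=> u0; rewrite lt_neqAle sumr_ge0 ?andbT => [|i _]; last by rewrite -expr2 sqr_ge0.
apply: contra u0; rewrite eq_sym psumr_eq0 => [|i _]; last by rewrite -expr2 sqr_ge0.
move=> /allP H; apply/eqP/rowP => i; rewrite mxE.
by have := H i (mem_index_enum i); rewrite /= mulf_eq0 orbb => /eqP.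
Qed.

Lemma small_factor (T : eqType) (s : seq T) (f g : T -> R) :
  (forall t : T, t \in s -> 0 < f t) ->
  exists2 e : R, 0 < e & forall t : T, t \in s -> e * g t < f t.
Proof.
elim: s => [_|y s ih fP]; first by exists 1.
have [|e e0 eP] := ih; first by move=> z zs; apply: fP; rewrite in_cons zs orbT.
have fy : 0 < f y by apply: fP; rewrite mem_head.
have g1 : 0 < `|g y| + 1 by rewrite ltr_wpDl.
pose e' := Num.min e (f y / (`|g y| + 1)).
have e'0 : 0 < e' by rewrite lt_min e0 divr_gt0.
exists e' => // z; rewrite in_cons => /predU1P[->|zs].
  apply: (@le_lt_trans _ _ (e' * `|g y|)); first by rewrite ler_pM2l// ler_norm.
  apply: (@lt_le_trans _ _ (e' * (`|g y| + 1))); first by rewrite ltr_pM2l// ltrDl.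
  by rewrite -ler_pdivlMr// ge_min lexx orbT.
have [g0|g0] := leP (g z) 0.
  by rewrite (le_lt_trans (mulr_ge0_le0 (ltW e'0) g0))// fP// in_cons zs orbT.
by rewrite (le_lt_trans _ (eP _ zs))// ler_pM2r// ge_min lexx.
Qed.

(** Induction on the number of vectors. If the functional [l] found for the tail is negative at
    [y0], the tail is projected along [y0] into the kernel of [l]; the projections are positive
    combinations, hence lie in [K], and the induction hypothesis applies to them. *)
Lemma gordan (K : set 'rV[R]_N) : (forall u v, K u -> K v -> K (u + v)) ->
  (forall a u, 0 < a -> K u -> K (a *: u)) -> ~ K 0 ->
  forall s : seq 'rV[R]_N, (forall y, y \in s -> K y) ->
  exists l, forall y, y \in s -> 0 < dotv l y.
Proof.
move=> KD KZ K0 s; move: {2}(size s) (leqnn (size s)) => n; elim: n s => [|n ih] [|y0 s]//=.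
- by exists 0.
- by exists 0.
rewrite ltnS => sn sK.
have Ky0 : K y0 by apply: sK; rewrite mem_head.
have Ks y : y \in s -> K y by move=> ys; apply: sK; rewrite in_cons ys orbT.
have [l lP] := ih s sn Ks.
have cons k : 0 < dotv k y0 -> (forall y, y \in s -> 0 < dotv k y) ->
    exists l, forall y, y \in y0 :: s -> 0 < dotv l y.
  by move=> k0 ks; exists k => y; rewrite in_cons => /predU1P[->|/ks].
have [ly0|ly0|ly0] := ltgtP (dotv l y0) 0; last 2 first.
- exact: cons ly0 lP.
- have y00 : y0 != 0 by apply: contra_not_neq K0 => <-.
  have [e e0 eP] := small_factor (fun y => - dotv y0 y) lP.
  apply: (cons (l + e *: y0)).
    by rewrite dotvDl dotvZl ly0 add0r mulr_gt0// dotv_gt0.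
  by move=> y /eP; rewrite dotvDl dotvZl mulrN; clear; lra.
pose m := - dotv l y0; have m0 : 0 < m by rewrite oppr_gt0.
pose z y := m *: y + dotv l y *: y0.
have [||k kP] := ih [seq z y | y <- s].
- by rewrite size_map.
- by move=> _ /mapP[y ys ->]; apply: KD; apply: KZ => //; [exact: Ks|exact: lP].
(* [k + M *: l] vanishes at [y0] and is positive on [s]; subtracting a small multiple of [l], which
   is negative at [y0], makes it positive there too. *)
pose M := dotv k y0 / m.
have kM y : y \in s -> 0 < dotv k y + M * dotv l y.
  move=> ys; have := kP _ (map_f z ys); rewrite dotvDr !dotvZr.
  have -> : m * dotv k y + dotv l y * dotv k y0 = m * (dotv k y + M * dotv l y).
    by rewrite /M; field; rewrite gt_eqF.
  by rewrite pmulr_rgt0.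
have [e e0 eP] := small_factor (dotv l) kM.
apply: (cons (k + (M - e) *: l)).
  rewrite dotvDl dotvZl; have -> : dotv l y0 = - m by rewrite opprK.
  have -> : dotv k y0 = M * m by rewrite /M mulfVK// gt_eqF.
  have -> : M * m + (M - e) * - m = e * m by ring.
  exact: mulr_gt0.
by move=> y /eP; rewrite dotvDl dotvZl mulrBl; clear; lra.
Qed.

Lemma dotv_continuous v : continuous (fun u => dotv u v).
Proof.
move=> u; have -> : (fun u => dotv u v) = \sum_i (fun u : 'rV[R]_N => u 0 i * v 0 i).
  by apply/funext => w; rewrite fct_sumE.
have d : differentiable (\sum_i (fun u : 'rV[R]_N => u 0 i * v 0 i)) u.
  apply: differentiable_sum => i; apply: differentiableM; last exact: differentiable_cst.
  exact: differentiable_coord.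
exact: differentiable_continuous.
Qed.

(** If no functional worked, the open sets [l . y < 0], with [y] in the cone [K] over [C - p], would
    cover the unit sphere. Finitely many would suffice by compactness, and [gordan] gives a
    functional positive at all these [y], a contradiction. *)
Lemma separation (C : set 'rV[R]_N) p : (0 < N)%N ->
  (forall u v t, C u -> C v -> 0 < t -> t < 1 -> C (t *: u + (1 - t) *: v)) ->
  ~ C p -> exists2 l, l != 0 & forall y, C y -> dotv l y <= dotv l p.
Proof.
move=> N0 Cc Cp; pose K := [set u | exists a y, [/\ 0 < a, C y & u = a *: (y - p)]].
have KZ a u : 0 < a -> K u -> K (a *: u).
  by move=> a0 [b [y [b0 Cy ->]]]; exists (a * b), y; rewrite scalerA mulr_gt0.
have KD u v : K u -> K v -> K (u + v).
  move=> [a [y [a0 Cy ->]]] [b [z [b0 Cz ->]]].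
  have ab : 0 < a + b by rewrite addr_gt0.
  exists (a + b), ((a / (a + b)) *: y + (1 - a / (a + b)) *: z); split => //.
    apply: Cc => //; first by rewrite divr_gt0.
    by rewrite ltr_pdivrMr// mul1r ltrDl.
  apply/rowP => i; rewrite !mxE; field; by rewrite gt_eqF.
have K0 : ~ K 0.
  move=> [a [y [a0 Cy /esym/eqP]]]; rewrite scaler_eq0 gt_eqF//= subr_eq0 => /eqP yp.
  by rewrite yp in Cy.
apply: contrapT => nsep.
have cov l : l != 0 -> exists2 y, K y & dotv l y < 0.
  move=> l0; apply: contrapT => H; apply: nsep; exists (- l); first by rewrite oppr_eq0.
  move=> y Cy; rewrite leNgt; apply/negP => lt; apply: H; exists (y - p).
    by exists 1, y; rewrite scale1r.
  by move: lt; rewrite !dotvNl dotvBr; clear; lra.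
pose S := [set l : 'rV[R]_N | `|l| = 1].
have cS : compact S.
  apply: bounded_closed_compact.
    by exists 1; split; [exact: num_real|move=> M M1 l /= ->; exact: ltW].
  rewrite (_ : S = (fun l : 'rV[R]_N => `|l|) @^-1` [set 1])//.
  apply: preimage_closed; last exact: closed_eq.
  by move=> l _; exact: norm_continuous.
have SP l : S l -> l != 0.
  by move=> Sl; rewrite -normr_eq0 Sl oner_eq0.
move: (cS); rewrite compact_cover.
move=> /(_ 'rV[R]_N K (fun y => [set l | dotv l y < 0])) [||s sK sS].
- move=> y _; rewrite (_ : [set l | _] = (fun l => dotv l y) @^-1` [set x | x < 0])//.
  apply: open_comp; last exact: open_lt.
  by move=> l _; exact: dotv_continuous.
- move=> l /SP/cov[y Ky ly]; by exists y.
have [l lP] := gordan KD KZ K0 (s := finmap.enum_fset s) (fun y ys => set_mem (sK y ys)).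
have cont k : k != 0 -> exists2 y, y \in finmap.enum_fset s & dotv k y < 0.
  move=> k0; have k1 : 0 < `|k|^-1 by rewrite invr_gt0 normr_gt0.
  have : S (`|k|^-1 *: k).
    by rewrite /S /= normrZ gtr0_norm// mulVf// normr_eq0.
  by move=> /sS[y /= ys]; rewrite dotvZl pmulr_rlt0// => ky; exists y.
(* [l = 0] is compatible with an empty list only; as [0 < N], there is a nonzero vector to be
   covered, so the list has a member, at which [l] is strictly positive. *)
have [l0|/cont[y ys]] := eqVneq l 0; last by rewrite ltNge ltW// lP.
have [|y ys _] := cont (const_mx 1).
  apply/eqP => /rowP/(_ (Ordinal N0)); rewrite !mxE => /eqP; by rewrite oner_eq0.
by have := lP _ ys; rewrite l0 dotv0l ltxx.
Qed.

End Separation.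

(** * Linear relations between charges *)

Section ChargeRelations.
Context d (T : measurableType d) (R : realType).

(** The Jordan decomposition is not linear in the charge, so linearity of the integral in the charge
    needs an argument. For a nonnegative integrand it is [ci_sum_weight] with constants of both
    signs; a general integrand is shifted by a bound. *)
Lemma ci_linear_relation (I : finType) (nu : I -> {charge set T -> \bar R}) (c : I -> R) :
  (forall A, measurable A -> \sum_i c i * fine (nu i A) = 0) ->
  forall (E : set T) (f : T -> R), measurable E -> bmf f ->
    \sum_i c i * ci (nu i) E f = 0.
Proof.
move=> rel E f mE bf.
have pos (g : T -> R) : bmf g -> (forall x, 0 <= g x) ->
    \sum_i c i * ci (nu i) E g = 0.
  move=> bg g0.
  have one (k : I -> R) A : measurable A ->
      \sum_i ci (nu i) A (fun=> k i) = \sum_i k i * fine (nu i A).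
    move=> mA; apply: eq_bigr => i _; rewrite -charge_integral_one// -ciZ//; last exact: bmf_cst.
    by apply: eq_ci => x _; rewrite mulr1.
  have fac (k : I -> R) : \sum_i ci (nu i) E (fun x => g x * k i) =
      \sum_i k i * ci (nu i) E g.
    by apply: eq_bigr => i _; rewrite -ciZ//; apply: eq_ci => x _; rewrite mulrC.
  apply/eqP; rewrite eq_le -fac; apply/andP; split.
    apply: ci_sum_weight => // [i|A mA]; first exact: bmf_cst.
    by rewrite one// rel.
  rewrite -oppr_le0 fac -sumrN.
  rewrite (eq_bigr (fun i => (- c i) * ci (nu i) E g)); last first.
    by move=> i _; rewrite mulNr.
  rewrite -(fac (fun i => - c i)).
  apply: ci_sum_weight => // [i|A mA]; first exact: bmf_cst.
  rewrite one// (eq_bigr (fun i => - (c i * fine (nu i A)))) => [|i _]; last by rewrite mulNr.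
  by rewrite sumrN rel// oppr0.
have [M MP] := bf.2; have bM := @bmf_cst _ T R `|M|.
have bfM : bmf (fun x => f x + `|M|) by exact: bmfD.
rewrite (eq_bigr (fun i => c i * ci (nu i) E (fun x => f x + `|M|) -
   c i * ci (nu i) E (fun=> `|M|))).
  rewrite sumrB !pos ?subr0// => x.
  rewrite -lerBlDr sub0r; have := MP x; rewrite ler_norml => /andP[+ _].
  by apply: le_trans; rewrite lerN2 ler_norm.
by move=> i _; rewrite -mulrBr -ciB//; congr (_ * _); apply: eq_ci => x _; rewrite addrK.
Qed.

End ChargeRelations.

Section ReArcMinus.
Context {R : realType}.

Lemma ci_Re_arc_minus n (z : 'rV[R[i]]_n) (mu : 'I_n -> signed_measure R)
    (j : 'I_n) E f : measurable E -> bmf f ->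
  ci (Re_arc_minus z mu j) E f =
  Re (z 0 j) * ci (@arc_charge R) E f - ci (mu j) E f.
Proof.
move=> mE bf.
pose nu (k : 'I_3) : signed_measure R :=
  if val k == 0%N then Re_arc_minus z mu j else if val k == 1%N then arc_charge else mu j.
pose c (k : 'I_3) : R := if val k == 0%N then 1 else if val k == 1%N then - Re (z 0 j) else 1.
have := @ci_linear_relation _ _ _ _ nu c _ E f mE bf.
rewrite !big_ord_recl big_ord0 /nu /c /= !mul1r => H.
apply/eqP; rewrite -subr_eq0; apply/eqP; rewrite -H; first by ring.
move=> A mA; rewrite !big_ord_recl big_ord0 /=.
have fL : (@arc_length R A) \is a fin_num by exact: fin_num_measure.
have fm : mu j A \is a fin_num by exact: fin_num_measure.
have -> : Re_arc_minus z mu j A = ((Re (z 0 j))%:E * @arc_length R A - mu j A)%E.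
  by rewrite -[X in (X%:E * _)%E](mxE map_mx_key (fun i j => Re (z i j)) 0 j).
rewrite fineB ?fin_numM// fineM//=.
ring.
Qed.

End ReArcMinus.

Section ComplexChargeIntegral.
Context d (T : measurableType d) (R : realType) (nu : {charge set T -> \bar R}).
Variable E : set T.
Hypothesis mE : measurable E.
Implicit Types f g : T -> R[i].

Definition cbmf f := bmf (fun x => Re (f x)) /\ bmf (fun x => Im (f x)).

Lemma cbmfD f g : cbmf f -> cbmf g -> cbmf (fun x => f x + g x).
Proof.
move=> [? ?] [? ?]; split; [under eq_fun do rewrite cReD|under eq_fun do rewrite cImD];
  exact: bmfD.
Qed.

Lemma cbmfM f g : cbmf f -> cbmf g -> cbmf (fun x => f x * g x).
Proof.
move=> [? ?] [? ?]; split; [under eq_fun do rewrite cReM|under eq_fun do rewrite cImM].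
  by apply: bmfB; exact: bmfM.
by apply: bmfD; exact: bmfM.
Qed.

Lemma cbmf_cst (a : R[i]) : cbmf (fun=> a).
Proof. by split; exact: bmf_cst. Qed.

Lemma cbmf_real (u : T -> R) : bmf u -> cbmf (fun x => (u x)%:C).
Proof. by move=> bu; split => //=; exact: bmf_cst. Qed.

Lemma ciCD f g : cbmf f -> cbmf g ->
  ciC nu E (fun x => f x + g x) = ciC nu E f + ciC nu E g.
Proof.
move=> [f1 f2] [g1 g2]; apply: complex_eqP; rewrite ?cReD ?cImD /=.
  by rewrite -ciD//; apply: eq_ci => x _; rewrite cReD.
by rewrite -ciD//; apply: eq_ci => x _; rewrite cImD.
Qed.

Lemma ciCZ (a : R[i]) f : cbmf f ->
  ciC nu E (fun x => a * f x) = a * ciC nu E f.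
Proof.
move=> [f1 f2]; apply: complex_eqP; rewrite ?cReM ?cImM /=.
  rewrite -!ciZ// -ciB//; [|exact: bmfZ..].
  by apply: eq_ci => x _; rewrite cReM.
rewrite -!ciZ// -ciD//; [|exact: bmfZ..].
by apply: eq_ci => x _; rewrite cImM.
Qed.

Lemma eq_ciC f g : (forall x, f x = g x) -> ciC nu E f = ciC nu E g.
Proof. by move=> /funext ->. Qed.

Lemma ciC_bound f (M : R) : cbmf f -> (forall x, normc (f x) <= M) -> 0 <= M ->
  normc (ciC nu E f) <= M * (2 * (fine (jpos nu setT) + fine (jneg nu setT))).
Proof.
move=> [f1 f2] fM M0; apply: (le_trans (le_normc_ReIm _)) => /=.
have -> : M * (2 * (fine (jpos nu setT) + fine (jneg nu setT))) =
  M * (fine (jpos nu setT) + fine (jneg nu setT)) + M * (fine (jpos nu setT) + fine (jneg nu setT)).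
  by ring.
apply: lerD; apply: ci_bound => // x _.
  exact: le_trans (ler_Re_normc _) (fM x).
exact: le_trans (ler_Im_normc _) (fM x).
Qed.

End ComplexChargeIntegral.

Lemma half_room (R : realType) (m t : R) : 0 < t -> 2 * t = 1 - m -> m + t < 1.
Proof. by lra. Qed.

Lemma half_room_le (R : realType) (m t a b : R) : 2 * t = 1 - m -> 1 <= a + b -> b <= m + t -> t <= a.
Proof. by lra. Qed.

Section HerglotzKernel.
Context {R : realType} (nu : signed_measure R) (E : set (circle R)).
Hypothesis mE : measurable E.
Variable u : circle R -> R.
Hypothesis bu : bmf u.

Lemma circle_cont_cbmf F : circle_cont F -> cbmf (fun x : circle R => F (circle_val x)).
Proof. by move=> cF; split; [exact: bmf_circle_Re|exact: bmf_circle_Im]. Qed.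

Lemma herK_cbmf (l : R[i]) : normc l < 1 -> cbmf (fun x : circle R => herK (circle_val x) l).
Proof. by move=> l1; apply: (@circle_cont_cbmf (fun z => herK z l)); exact: herK_circle_cont. Qed.

(** Differentiation under the integral by an exact expansion: the kernel at [l + h] is its value at
    [l] plus [h * D] plus [h ^+ 2 * Q], where [Q] is bounded as long as [l + h] stays at distance at
    least [t] from the circle. *)
Lemma differentiable_herglotz (l : R[i]) : normc l < 1 ->
  differentiable (fun l => ciC nu E (fun x => (u x)%:C * herK (circle_val x) l)) l.
Proof.
move=> l1; pose t := (1 - normc l) / 2.
have t0 : 0 < t by rewrite divr_gt0// subr_gt0.
have bc := cbmf_real bu.
have far (x : circle R) (w : R[i]) : normc w <= normc l + t -> t <= normc (circle_val x - w).
  move=> wl; have := le_normcD (circle_val x - w) w; rewrite subrK normc_circle.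
  by move=> ab; apply: half_room_le ab wl; rewrite /t; field.
have kc (w1 w2 : R[i]) : normc w1 < 1 -> normc w2 < 1 ->
    cbmf (fun x : circle R => 2 * circle_val x / ((circle_val x - w1) ^+ 2 * (circle_val x - w2))).
  move=> w11 w21; apply: (@circle_cont_cbmf (fun z => 2 * z / ((z - w1) ^+ 2 * (z - w2)))).
  have ds w (z : R[i]) : differentiable (fun z : R[i] => z - w) z.
    by apply: difB; [exact: dif_id|exact: dif_cst].
  apply: dif_circle_cont => z z1; apply: difM.
    by apply: difM; [exact: dif_cst|exact: dif_id].
  apply: difV; last by rewrite mulf_neq0 ?expf_neq0// circle_sub_neq0.
  apply: difM; last exact: ds.
  have -> : (fun x : R[i] => (x - w1) ^+ 2) = (fun x => (x - w1) * (x - w1)).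
    by apply/funext => x; rewrite expr2.
  by apply: difM; exact: ds.
apply/differentiable_normcP.
pose D (x : circle R) : R[i] := 2 * circle_val x / (circle_val x - l) ^+ 2.
have bD : cbmf D.
  have -> : D = (fun x : circle R => (2 * circle_val x / ((circle_val x - l) ^+ 2 * (circle_val x - l)))
      * (circle_val x - l)).
    apply/funext => x; rewrite /D; field.
    by rewrite circle_sub_neq0// normc_circle.
  apply: cbmfM; first exact: kc.
  apply: (@circle_cont_cbmf (fun z => z - l)); apply: dif_circle_cont => z _.
  by apply: difB; [exact: dif_id|exact: dif_cst].
exists (ciC nu E (fun x => (u x)%:C * D x)) => e e0.
have [Mu MuP] := bu.2.
pose tv := 2 * (fine (jpos nu setT) + fine (jneg nu setT)).
have tv0 : 0 <= tv by rewrite mulr_ge0// addr_ge0// fine_ge0.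
pose B := `|Mu| * (2 / t ^+ 3).
have B0 : 0 <= B by rewrite mulr_ge0// divr_ge0// exprn_ge0// ltW.
have B1 : 0 < B * tv + 1 by rewrite ltr_wpDl// mulr_ge0.
exists (Num.min t (e / (B * tv + 1))); first by rewrite lt_min t0 divr_gt0.
move=> h; rewrite lt_min => /andP[ht he].
have lh : normc (l + h) <= normc l + t by rewrite (le_trans (le_normcD _ _))// lerD2l ltW.
have lh1 : normc (l + h) < 1.
  by apply: (le_lt_trans lh); apply: half_room t0 _; rewrite /t; field.
pose Q (x : circle R) : R[i] := 2 * circle_val x / ((circle_val x - l) ^+ 2 * (circle_val x - (l + h))).
have bQ : cbmf Q by exact: kc.
have bK := herK_cbmf l1; have bKh := herK_cbmf lh1.
have -> : ciC nu E (fun x => (u x)%:C * herK (circle_val x) (l + h)) -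
    ciC nu E (fun x => (u x)%:C * herK (circle_val x) l) -
    ciC nu E (fun x => (u x)%:C * D x) * h =
    h ^+ 2 * ciC nu E (fun x => (u x)%:C * Q x).
  have bcD := cbmfM bc bD; have bcQ := cbmfM bc bQ; have bcK := cbmfM bc bK.
  have bhD := cbmfM (@cbmf_cst _ _ R h) bcD; have bhQ := cbmfM (@cbmf_cst _ _ R (h ^+ 2)) bcQ.
  have -> : ciC nu E (fun x => (u x)%:C * herK (circle_val x) (l + h)) =
      ciC nu E (fun x => (u x)%:C * herK (circle_val x) l +
        (h * ((u x)%:C * D x) + h ^+ 2 * ((u x)%:C * Q x))).
    apply: eq_ciC => x; rewrite /Q /D /herK.
    have x1 := circle_sub_neq0 (normc_circle x) l1.
    have x2 := circle_sub_neq0 (normc_circle x) lh1.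
    by field; rewrite x1 x2.
  rewrite (ciCD nu mE bcK (cbmfD bhD bhQ)) (ciCD nu mE bhD bhQ).
  rewrite (ciCZ nu mE h bcD) (ciCZ nu mE (h ^+ 2) bcQ).
  move: (ciC _ _ _) (ciC _ _ _) (ciC _ _ _) => X Y Z.
  by clear; ring.
rewrite normcM normcX.
have QB x : normc ((u x)%:C * Q x) <= B.
  rewrite normcM normc_real /B ler_pM ?normc_ge0//.
    by rewrite (le_trans (MuP x))// ler_norm.
  have ll : normc l <= normc l + t by rewrite lerDl ltW.
  have x1 := far x _ ll; have x2 := far x _ lh.
  rewrite /Q normcM normcV [normc (2 * _)]normcM [normc (_ ^+ 2 * _)]normcM.
  rewrite [normc (_ ^+ 2)]normcX normc_circle mulr1.
  have -> : normc (2 : R[i]) = 2.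
    have -> : (2 : R[i]) = (2 : R)%:C by rewrite rmorphMn rmorph1.
    by rewrite normc_real normr_nat.
  rewrite ler_pM2l// lef_pV2 ?posrE; last 2 first.
  - by rewrite mulr_gt0 ?exprn_gt0// (lt_le_trans t0).
  - exact: exprn_gt0.
  by rewrite [leLHS]exprSr ler_pM// ?exprn_ge0 ?(ltW t0)// ler_pXn2r ?nnegrE ?normc_ge0 ?(ltW t0).
have := @ciC_bound _ _ _ nu E mE _ B (cbmfM bc bQ) QB B0; rewrite -/tv => C1.
rewrite expr2 -mulrA mulrC ler_wpM2r ?normc_ge0//.
apply: (@le_trans _ _ (normc h * (B * tv))); first by rewrite ler_wpM2l ?normc_ge0.
apply: (@le_trans _ _ (normc h * (B * tv + 1))); first by rewrite ler_wpM2l ?normc_ge0// lerDl.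
by rewrite -ler_pdivlMr// ltW.
Qed.

End HerglotzKernel.

(** * The generator of h . (z - phi) *)

Section HerglotzIdentity.
Context {R : realType}.
Local Notation c2pi := ((2 * pi)^-1%:C : R[i]).

Lemma hquadE n (a : 'rV[R[i]]_n) (b : 'rV[R]_n) (l : R[i]) j :
  hquad a b l 0 j = l ^+ 2 * conjc (a 0 j) + l * (b 0 j)%:C + a 0 j.
Proof. by rewrite !mxE. Qed.

(** The real number [conjc x * h x] for [x] on the circle, a trigonometric polynomial of degree
    one. *)
Definition wgt n (a : 'rV[R[i]]_n) (b : 'rV[R]_n) j (x : circle R) : R :=
  b 0 j + 2 * Re (conjc (a 0 j) * circle_val x).

Lemma conj_hquad n (a : 'rV[R[i]]_n) (b : 'rV[R]_n) j x :
  conjc (circle_val x) * hquad a b (circle_val x) 0 j = (wgt a b j x)%:C.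
Proof.
rewrite hquadE /wgt; have := circle_mulJ x; move: (circle_val x) => v vv.
have -> : conjc v * (v ^+ 2 * conjc (a 0 j) + v * (b 0 j)%:C + a 0 j) =
  (v * conjc v) * (v * conjc (a 0 j)) + (v * conjc v) * (b 0 j)%:C + conjc v * a 0 j by ring.
rewrite vv !mul1r; case: v {vv} => c d; case: (a 0 j) => e f.
by apply: complex_eqP; rewrite /=; ring.
Qed.

Lemma wgt_bmf n (a : 'rV[R[i]]_n) (b : 'rV[R]_n) j : bmf (wgt a b j).
Proof.
apply: bmfD; first exact: bmf_cst.
apply: bmfZ; apply: (@bmf_circle_Re R (fun z => conjc (a 0 j) * z)).
by apply: dif_circle_cont => z _; apply: difM; [exact: dif_cst|exact: dif_id].
Qed.

Lemma dot_measure_le0 n (a : 'rV[R[i]]_n) (b : 'rV[R]_n)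
    (kappa : 'I_n -> signed_measure R) (h : R[i] -> 'rV[R[i]]_n) E :
  (forall l, h l = hquad a b l) -> measurable E ->
  dot_measure (fun l => conjc (circle_val l) *: h (circle_val l)) kappa E =
  (\sum_j ci (kappa j) E (wgt a b j))%:C.
Proof.
move=> hE mE; rewrite /dot_measure rmorph_sum; apply: eq_bigr => j _.
have -> : (fun x : circle R => (conjc (circle_val x) *: h (circle_val x)) 0 j) =
    (fun x => (wgt a b j x)%:C).
  by apply/funext => x; rewrite mxE hE conj_hquad.
by apply: complex_eqP => //=; rewrite ci0.
Qed.

Lemma arc_herK_complex (l : R[i]) : normc l < 1 ->
  ciC (@arc_charge R) setT (fun x => herK (circle_val x) l) = (2 * pi)%:C.
Proof.
move=> l1; pose r := (1 + normc l) / 2.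
have lr : normc (conjc l) <= r.
  by rewrite normc_conjc /r ler_pdivlMr//; clear -l1; lra.
have r0 : 0 < r by rewrite divr_gt0// ltr_wpDr// normc_ge0.
have r1 : r < 1 by rewrite /r ltr_pdivrMr//; clear -l1; lra.
apply: complex_eqP => /=.
  by rewrite -(arc_herK r0 r1 lr); apply: eq_ci => x _; rewrite herK_conj// Re_conjc.
have r1' : 1 < r^-1 by rewrite invf_gt1.
have H := @arc_mean R (fun z => 'i * ((1 + conjc l * z) / (1 - conjc l * z))) r^-1 r1'.
rewrite (_ : 0 = 2 * pi * Re ('i * ((1 + conjc l * 0) / (1 - conjc l * 0)))); last first.
  by rewrite mulr0 addr0 subr0 divr1 mulr1 /= mulr0.
rewrite -H; last first.
  move=> z zr; apply: difM; first exact: dif_cst; apply: difM.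
    by apply: difD; [exact: dif_cst|apply: difM; [exact: dif_cst|exact: dif_id]].
  apply: difV; last exact: mul_neq1 lr zr r0.
  by apply: difB; [exact: dif_cst|apply: difM; [exact: dif_cst|exact: dif_id]].
by apply: eq_ci => x _; rewrite herK_conj// Im_conjc cReM /=; ring.
Qed.

Variables (n : nat) (phi : R[i] -> 'rV[R[i]]_n)
  (mu : 'I_n -> signed_measure R).
Hypothesis phi_mu : boundary_measure phi mu.
Variables (a : 'rV[R[i]]_n) (b : 'rV[R]_n).
Local Notation kap z := (Re_arc_minus z mu).

Lemma ciC_Re_arc_minus (z : 'rV[R[i]]_n) j E f : measurable E -> cbmf f ->
  ciC (kap z j) E f =
  (Re (z 0 j))%:C * ciC (@arc_charge R) E f - ciC (mu j) E f.
Proof.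
move=> mE [f1 f2]; apply: complex_eqP; rewrite /= ci_Re_arc_minus//; first by ring.
by rewrite mul0r addr0.
Qed.

Lemma c2pi_unit : (2 * pi)%:C != 0 :> R[i].
Proof.
have : 0 < 2 * pi :> R by rewrite mulr_gt0// pi_gt0.
by apply: contraTneq => /(congr1 (@Re R)) /= ->; rewrite ltxx.
Qed.

Lemma herglotz_diff (z : 'rV[R[i]]_n) j : exists beta : R, forall l, normc l < 1 ->
  z 0 j - phi l 0 j =
  c2pi * ciC (kap z j) setT (fun x => herK (circle_val x) l) + 'i * beta%:C.
Proof.
have [alpha alphaP] := phi_mu j.
exists (Im (z 0 j) - alpha) => l l1.
rewrite alphaP ?unit_discE//.
have -> : herglotz (mu j) l =
  c2pi * ciC (mu j) setT (fun x => herK (circle_val x) l) by [].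
rewrite ciC_Re_arc_minus//; last exact: herK_cbmf.
rewrite arc_herK_complex// mulrBr mulrCA fmorphV mulVf ?c2pi_unit// mulr1.
rewrite {1}[z 0 j]complexE complexiE rmorphB /=.
move: (ciC _ _ _) => X; ring.
Qed.

Lemma herglotz_identity (z : 'rV[R[i]]_n) : exists G : R[i] -> R[i],
  [/\ forall l, normc l < 1 -> differentiable G l,
   forall l, normc l < 1 ->
     \sum_j hquad a b l 0 j * (z 0 j - phi l 0 j) =
     l * G l + (\sum_j a 0 j * (z 0 j - phi 0 0 j)) -
       conjc (\sum_j a 0 j * (z 0 j - phi 0 0 j)) * l ^+ 2
   & forall l, normc l < 1 -> Re (G l) = (2 * pi)^-1 *
     \sum_j ci (kap z j) setT
       (fun x => Re (herK (circle_val x) l) * wgt a b j x)].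
Proof.
have [beta betaP] := @choice _ _ (fun j (be : R) => forall l, normc l < 1 ->
  z 0 j - phi l 0 j =
  c2pi * ciC (kap z j) setT (fun x => herK (circle_val x) l) + 'i * be%:C)
  (herglotz_diff z).
pose I1 j := ciC (kap z j) setT (fun=> 1).
pose S j := ciC (kap z j) setT
  (fun x => conjc (a 0 j) * circle_val x - a 0 j * conjc (circle_val x)).
pose Iq j l := ciC (kap z j) setT
  (fun x => (wgt a b j x)%:C * herK (circle_val x) l).
pose Gj j l := c2pi * Iq j l - c2pi * S j + 'i * (beta j)%:C * (b 0 j)%:C.
have cid : circle_cont (@id R[i]) by apply: dif_circle_cont => x _; exact: dif_id.
have bid : cbmf (fun x : circle R => circle_val x) by exact: (circle_cont_cbmf cid).
have bidc : cbmf (fun x : circle R => conjc (circle_val x)).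
  split; [under eq_fun do rewrite Re_conjc|under eq_fun do rewrite Im_conjc].
    exact: bid.1.
  by apply: bmfN; exact: bid.2.
have bS j : cbmf (fun x : circle R => conjc (a 0 j) * circle_val x - a 0 j * conjc (circle_val x)).
  have -> : (fun x : circle R => conjc (a 0 j) * circle_val x - a 0 j * conjc (circle_val x)) =
     (fun x => conjc (a 0 j) * circle_val x + (- a 0 j) * conjc (circle_val x)).
    by apply/funext => x; rewrite mulNr.
  by apply: cbmfD; (apply: cbmfM; first exact: cbmf_cst).
have bqK j l : normc l < 1 -> cbmf (fun x => (wgt a b j x)%:C * herK (circle_val x) l).
  by move=> l1; apply: cbmfM; [exact/cbmf_real/wgt_bmf|exact: herK_cbmf].
have ReS j : Re (S j) = 0.
  rewrite /S /= -(ci0 (kap z j) (@measurableT _ (circle R))); apply: eq_ci => x _.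
  by case: (a 0 j) => c d; case: (circle_val x) => e f /=; ring.
have ImI1 j : Im (I1 j) = 0 by rewrite /I1 /= ci0.
have z0 j : z 0 j - phi 0 0 j = c2pi * I1 j + 'i * (beta j)%:C.
  rewrite betaP ?normc0//; congr (_ * _ + _); apply: eq_ciC => x.
  rewrite /herK addr0 subr0 divff// -normc_gt0 normc_circle//.
have key j l : normc l < 1 ->
    hquad a b l 0 j * ciC (kap z j) setT (fun x => herK (circle_val x) l) =
    l * Iq j l - l * S j + (a 0 j - conjc (a 0 j) * l ^+ 2) * I1 j.
  move=> l1; have bK := herK_cbmf l1; have bq := bqK j l l1.
  have b1 := @cbmf_cst _ (circle R) R 1.
  have bl1 := cbmfM (@cbmf_cst _ (circle R) R l) bq.
  have bl2 := cbmfM (@cbmf_cst _ (circle R) R (- l)) (bS j).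
  have bl3 := cbmfM (@cbmf_cst _ (circle R) R (a 0 j - conjc (a 0 j) * l ^+ 2)) b1.
  rewrite -(ciCZ (kap z j) measurableT _ bK).
  have -> : ciC (kap z j) setT (fun x => hquad a b l 0 j * herK (circle_val x) l) =
     ciC (kap z j) setT (fun x => l * ((wgt a b j x)%:C * herK (circle_val x) l) +
       ((- l) * (conjc (a 0 j) * circle_val x - a 0 j * conjc (circle_val x)) +
        (a 0 j - conjc (a 0 j) * l ^+ 2) * 1)).
    apply: eq_ciC => x; rewrite -conj_hquad !hquadE /herK.
    have xl := circle_sub_neq0 (normc_circle x) l1.
    rewrite -(circle_inv (normc_circle x)).
    have x0 : circle_val x != 0 by rewrite -normc_gt0 normc_circle.
    by field; rewrite x0 xl.
  rewrite (ciCD _ measurableT bl1 (cbmfD bl2 bl3)) (ciCD _ measurableT bl2 bl3).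
  rewrite (ciCZ _ measurableT _ bq) (ciCZ _ measurableT _ (bS j)) (ciCZ _ measurableT _ b1).
  rewrite -/(I1 j) -/(S j) -/(Iq j l); ring.
exists (fun l => \sum_j Gj j l); split.
- move=> l l1; apply: dif_sum => j.
  apply: difD; last exact: dif_cst.
  apply: difB; last exact: dif_cst.
  apply: difM; first exact: dif_cst.
  exact: (differentiable_herglotz (kap z j) measurableT (wgt_bmf a b j) l1).
- move=> l l1.
  have conj_sum (F : 'I_n -> R[i]) : conjc (\sum_j F j) = \sum_j conjc (F j).
    exact: rmorph_sum.
  rewrite mulr_sumr conj_sum mulr_suml -big_split -sumrB.
  apply: eq_bigr => j _; rewrite betaP// mulrDr mulrCA key// z0 hquadE /Gj.
  have Jz : conjc (a 0 j * (c2pi * I1 j + 'i * (beta j)%:C)) =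
      conjc (a 0 j) * (c2pi * I1 j - 'i * (beta j)%:C).
    have -> : I1 j = (Re (I1 j))%:C by apply: complex_eqP; [|rewrite ImI1].
    rewrite -complexiE; case: (a 0 j) => c d.
    by move: (Re (I1 j)) (2 * pi)^-1 => X Y; apply: complex_eqP => /=; clear; ring.
  rewrite Jz; move: (I1 j) (S j) (Iq j l) (a 0 j) => X Y Z A; rewrite /=; ring.
- move=> l l1; rewrite mulr_sumr.
  have ReSum (F : 'I_n -> R[i]) : Re (\sum_j F j) = \sum_j Re (F j).
    by apply: (big_morph (@Re R)) => // x y; exact: cReD.
  rewrite ReSum; apply: eq_bigr => j _; rewrite /Gj cReD cReB !cReZ ReS mulr0 subr0.
  have -> : Re ('i * (beta j)%:C * (b 0 j)%:C) = 0.
    by rewrite -complexiE /=; ring.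
  rewrite addr0; congr (_ * _); apply: eq_ci => x _.
  by rewrite cReZ mulrC.
Qed.

End HerglotzIdentity.

Lemma absorb_half (R : realType) (n X Y e : R) : X <= n * (e / 2 * n) ->
  n ^+ 2 * (Y - e) + X <= n ^+ 2 * (Y - e / 2).
Proof. by move=> H; rewrite expr2; nra. Qed.

Lemma quarter_bound (R : realType) (e X Y : R) : 0 < e -> (e / 2 - Y) / 4 <= X ->
  - X + - 4^-1 * Y <= 0.
Proof. by rewrite ler_pdivrMr// => e0 XY; lra. Qed.

(* [G] and [w] come from [herglotz_identity], so that
   [E l = hquad a b l . (z - phi l) - e l]; the root of [E] is the value at [z]
   of an approximate left inverse of [phi]. *)
Section RootOfGenerator.
Context {R : realType}.
Variables (G : R[i] -> R[i]) (w : R[i]) (e : R).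
Hypothesis dG : forall l, normc l < 1 -> differentiable G l.
Hypothesis G0 : forall l, normc l < 1 -> Re (G l) <= 0.
Hypothesis e0 : 0 < e.

Let E (l : R[i]) : R[i] := l * G l + w - conjc w * l ^+ 2 - e%:C * l.

Let dE l : normc l < 1 -> differentiable E l.
Proof.
move=> l1; apply: difB; last by apply: difM; [exact: dif_cst|exact: dif_id].
apply: difB.
  apply: difD; last exact: dif_cst.
  by apply: difM; [exact: dif_id|exact: dG].
apply: difM; first exact: dif_cst.
have -> : (fun x : R[i] => x ^+ 2) = (fun x => x * x) by apply/funext => x; rewrite expr2.
by apply: difM; exact: dif_id.
Qed.

Let boundary_radius : exists2 r0 : R, 1 / 2 <= r0 < 1 & forall r, r0 <= r -> r < 1 ->
  normc w * (1 - r ^+ 2) <= e / 2 * r.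
Proof.
have w1 : 0 < normc w + 1 by rewrite ltr_wpDl// normc_ge0.
(* This yields [normc w * (1 - r ^+ 2) <= e / 4], and [e / 4 <= e / 2 * r] because [1 / 2 <= r]. *)
pose d := e / (8 * (normc w + 1)).
have d0 : 0 < d by rewrite divr_gt0// mulr_gt0.
exists (Num.max (1 / 2) (1 - d)).
  rewrite le_max lexx /= gt_max; apply/andP; split; last by rewrite gtrBl.
  by rewrite ltr_pdivrMr// mul1r ltr1n.
move=> r; rewrite ge_max => /andP[r2 rd] r1.
have dr : 1 - r ^+ 2 <= 2 * d.
  have -> : 1 - r ^+ 2 = (1 - r) * (1 + r) by ring.
  rewrite mulrC; apply: ler_pM; lra.
apply: (@le_trans _ _ ((normc w + 1) * (2 * d))).
  by apply: ler_pM; rewrite ?normc_ge0 ?lerDl// subr_ge0 expr_le1//; lra.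
have -> : (normc w + 1) * (2 * d) = e / 2 * (1 / 2) by rewrite /d; field; rewrite gt_eqF.
by rewrite ler_pM2l// divr_gt0.
Qed.

(** [conjc l * (w - conjc w * l ^+ 2)] is imaginary on the unit circle; inside, its real part
    carries the factor [1 - |l|^2], which near the circle costs at most half of [e]. *)
Let Re_conj_E l : normc l < 1 -> normc w * (1 - normc l ^+ 2) <= e / 2 * normc l ->
  Re (conjc l * E l) <= normc l ^+ 2 * (Re (G l) - e / 2).
Proof.
move=> l1 wl.
have -> : Re (conjc l * E l) = normc l ^+ 2 * (Re (G l) - e) +
    Re (conjc l * w) * (1 - normc l ^+ 2).
  rewrite /E sqr_normc_Re_Im; case: (G l) => p q; case: w => c d; case: l {l1 wl} => x y /=; ring.
have l2 : 0 <= 1 - normc l ^+ 2 by rewrite subr_ge0 expr_le1// ?normc_ge0// ltW.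
have : Re (conjc l * w) * (1 - normc l ^+ 2) <= normc l * (e / 2 * normc l).
  apply: (@le_trans _ _ (normc l * normc w * (1 - normc l ^+ 2))).
    rewrite ler_wpM2r// -(normc_conjc l) -normcM (le_trans (ler_norm _))//.
    exact: ler_Re_normc.
  by rewrite -mulrA ler_wpM2l ?normc_ge0.
exact: absorb_half.
Qed.

Let disc_cE r : r < 1 -> forall l, normc (l - 0) <= r -> {for l, continuous E}.
Proof.
move=> r1 l; rewrite subr0 => lr; apply: differentiable_continuous; apply: dE.
exact: le_lt_trans lr r1.
Qed.

(** Without a zero of [E], the function [l / E l] would be holomorphic and vanish at 0, while its
    real part, which has the sign of [Re (conjc l * E l)], is bounded by a negative constant on a
    circle. The maximum principle forbids this. *)
Let root_exists : exists2 l0, normc l0 < 1 & E l0 = 0.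
Proof.
have [r /andP[r2 r1] rP] := boundary_radius.
have r0 : 0 < r by apply: lt_le_trans r2; rewrite divr_gt0.
apply: contrapT => nroot.
have En l : normc l < 1 -> E l != 0 by move=> l1; apply/eqP => El; apply: nroot; exists l.
have [zm _ zmP] := @disc_max R (fun z => normc (E z)) 0 r (ltW r0)
  (fun l lr => continuous_normc (@disc_cE r r1 l lr)).
set M := normc (E zm) in zmP.
have M0 : 0 < M.
  apply: lt_le_trans (zmP 0 _); last by rewrite subrr normc0 ltW.
  by rewrite normc_gt0 En// normc0.
have dq l : normc (l - 0) <= r -> differentiable (fun z : R[i] => z / E z) l.
  rewrite subr0 => lr; have l1 := le_lt_trans lr r1.
  by apply: difM; [exact: dif_id|apply: difV; [exact: dE|exact: En]].
have := @max_principle R (fun z : R[i] => z / E z) 0 1 r (- (e / 2 * r ^+ 2 / M ^+ 2)) (ltW r0).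
move=> /(_ (fun l lr => differentiable_continuous (dq l lr)))
  /(_ (fun l lr _ => dq l lr)) H.
have pos : 0 < e / 2 * r ^+ 2 / M ^+ 2 by rewrite !mulr_gt0// ?invr_gt0 ?exprn_gt0.
suff : Re ((0 : R[i]) / E 0) <= - (e / 2 * r ^+ 2 / M ^+ 2).
  by rewrite mul0r /= oppr_ge0 leNgt pos.
apply: H; last by rewrite subrr normc0 ltW.
move=> l; rewrite subr0 => lr; have l1 : normc l < 1 by rewrite lr.
have El := En l l1; have nE : 0 < normc (E l) by rewrite normc_gt0.
have -> : Re (l / E l) = Re (conjc l * E l) / normc (E l) ^+ 2.
  have -> : l / E l = ((normc (E l) ^+ 2)^-1)%:C * (l * conjc (E l)).
    have : conjc (E l) != 0 by rewrite conjc_eq0.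
    by rewrite fmorphV /= -mulcJ; move: (conjc _) => c c0; field; rewrite El c0.
  rewrite cReZ mulrC; congr (_ / _).
  by case: (E l) => ? ?; case: l {lr l1 El nE} => ? ? /=; ring.
have H1 := Re_conj_E l1; rewrite lr in H1; have {}H1 := H1 (rP r (lexx _) r1).
rewrite ler_pdivrMr ?exprn_gt0//; apply: (le_trans H1).
have : normc (E l) ^+ 2 / M ^+ 2 <= 1.
  rewrite ler_pdivrMr ?exprn_gt0// mul1r ler_pXn2r ?nnegrE ?normc_ge0//.
  by apply: zmP; rewrite subr0 lr.
have G1 := G0 l1; have rr : 0 < r ^+ 2 by rewrite exprn_gt0.
have -> : - (e / 2 * r ^+ 2 / M ^+ 2) * normc (E l) ^+ 2 =
  - (r ^+ 2 * (e / 2)) * (normc (E l) ^+ 2 / M ^+ 2) by ring.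
move: (_ / _) => X X1; rewrite mulrBr -subr_ge0.
have -> : - (r ^+ 2 * (e / 2)) * X - (r ^+ 2 * Re (G l) - r ^+ 2 * (e / 2)) =
  r ^+ 2 * (e / 2) * (1 - X) + r ^+ 2 * - Re (G l) by ring.
by rewrite addr_ge0// mulr_ge0 ?oppr_ge0 ?subr_ge0 ?(ltW rr)// mulr_ge0 ?(ltW rr)// divr_ge0// ltW.
Qed.

(* dividing E by (l - l0) (r^2 - conj l0 l) = l |l - l0|^2 on |l| = r leaves a
   zero-free function whose real part is controlled by the maximum principle *)
Let root_factor l0 r : normc l0 < r -> 1 / 2 <= r -> r < 1 ->
  normc w * (1 - r ^+ 2) <= e / 2 * r -> E l0 = 0 ->
  exists p : R[i] -> R[i], forall l, normc l <= r ->
    [/\ E l = - (l - l0) * ((r ^+ 2)%:C - conjc l0 * l) * p l,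
        e / 8 <= Re (p l) & - Re (G l) / 4 <= Re (p l)].
Proof.
move=> l0r r2 r1 wr El0.
have r0 : 0 < r by apply: lt_le_trans r2; rewrite divr_gt0.
have l01 := lt_trans l0r r1.
have [q [Eq cq dq]] := removable (dE l01).
have {}Eq l : E l = (l - l0) * q l by rewrite -Eq El0 subr0.
have den l : normc l <= r -> (r ^+ 2)%:C - conjc l0 * l != 0.
  move=> lr; rewrite subr_eq0; apply/eqP => /(congr1 (@normc R)).
  rewrite normc_real ger0_norm ?sqr_ge0// normcM normc_conjc => H.
  suff : normc l0 * normc l < r ^+ 2 by rewrite -H ltxx.
  by rewrite expr2 (@le_lt_trans _ _ (normc l0 * r))// ?ler_wpM2l ?normc_ge0// ltr_pM2r.
pose p l := - q l / ((r ^+ 2)%:C - conjc l0 * l).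
have pE l : normc l <= r -> E l = - (l - l0) * ((r ^+ 2)%:C - conjc l0 * l) * p l.
  by move=> /den; rewrite Eq /p; move: ((r ^+ 2)%:C - _) => d d0; field.
have dden l : differentiable (fun z : R[i] => (r ^+ 2)%:C - conjc l0 * z) l.
  by apply: difB; [exact: dif_cst|apply: difM; [exact: dif_cst|exact: dif_id]].
have dp l : normc l <= r -> l != l0 -> differentiable p l.
  move=> lr ll0; apply: difM; last by apply: difV; [exact: dden|exact: den].
  by apply: difN; apply: (dq _ ll0); apply: dE; exact: le_lt_trans lr r1.
have cp0 : {for l0, continuous p}.
  have dV : differentiable (fun z : R[i] => ((r ^+ 2)%:C - conjc l0 * z)^-1) l0.
    by apply: difV; [exact: dden|exact/den/ltW].
  by apply: (@continuousM _ _ (fun z => - q z)); [exact: continuousN|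
    exact: differentiable_continuous dV].
have cp l : normc l <= r -> {for l, continuous p}.
  move=> lr; have [->|ll0] := eqVneq l l0; first exact: cp0.
  by apply: differentiable_continuous; exact: dp.
have bd l : normc l = r -> (e / 2 - Re (G l)) / 4 <= Re (p l).
  move=> lr; have l1 : normc l < 1 by rewrite lr.
  have G1 := G0 l1; have H1 := Re_conj_E l1; rewrite lr in H1; have {}H1 := H1 wr.
  have ll0 : 0 < normc (l - l0).
    by rewrite normc_gt0 subr_eq0; apply/eqP => ll0; rewrite -ll0 lr ltxx in l0r.
  have ll2 : normc (l - l0) ^+ 2 <= 4.
    have -> : 4 = 2 ^+ 2 :> R by rewrite expr2 -natrM.
    rewrite ler_pXn2r ?nnegrE ?normc_ge0// (le_trans (le_normcD _ _))// normcN lr.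
    by lra.
  have E1 : Re (conjc l * E l) = - (r ^+ 2 * normc (l - l0) ^+ 2) * Re (p l).
    rewrite pE ?lr//; rewrite -lr !sqr_normc_Re_Im.
    case: (p l) => x y; case: l0 {l0r El0 l01 Eq cq dq den p pE dden dp cp0 cp ll0 ll2} => a b.
    by case: l {lr l1 G1 H1} => c d /=; ring.
  have rr : 0 < r ^+ 2 by rewrite exprn_gt0.
  have H2 : e / 2 - Re (G l) <= normc (l - l0) ^+ 2 * Re (p l).
    rewrite -(ler_pM2l rr); move: H1; rewrite E1.
    by move: (Re (G l)) (Re (p l)) (normc _ ^+ 2) => X Y Z; lra.
  have gp : 0 < e / 2 - Re (G l).
    by apply: lt_le_trans (_ : e / 2 <= _); rewrite ?divr_gt0// lerBrDr gerDl.
  have pp : 0 < Re (p l).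
    by rewrite -(pmulr_rgt0 _ (exprn_gt0 2 ll0)) (lt_le_trans gp).
  by rewrite ler_pdivrMr// (le_trans H2)// mulrC ler_pM2l.
exists p => l lr; split; first exact: pE.
- rewrite -lerN2 -cReN.
  apply: (@max_principle R (fun z : R[i] => - p z) 0 l0 r (- (e / 8)) (ltW r0)).
  + by move=> z; rewrite subr0 => /cp; exact: continuousN.
  + by move=> z; rewrite subr0 => zr zl; apply: difN; exact: dp.
  + move=> z; rewrite subr0 => zr; rewrite cReN lerN2; apply: le_trans (bd _ zr).
    have : Re (G z) <= 0 by apply: G0; rewrite zr.
    by move: (Re _) => X; lra.
  + by rewrite subr0.
- rewrite -subr_ge0 -oppr_le0.
  have -> : - (Re (p l) - - Re (G l) / 4) =
    Re (- p l + (- 4^-1)%:C * G l) by rewrite cReD cReN cReZ; ring.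
  apply: (@max_principle R (fun z : R[i] => - p z + (- 4^-1)%:C * G z) 0 l0 r 0 (ltW r0)).
  + move=> z; rewrite subr0 => zr; apply: continuousD.
      exact/continuousN/cp.
    apply: continuous_cmull; apply: differentiable_continuous; apply: dG.
    exact: le_lt_trans zr r1.
  + move=> z; rewrite subr0 => zr zl; apply: difD; first by apply: difN; exact: dp.
    by apply: difM; [exact: dif_cst|apply: dG; exact: le_lt_trans zr r1].
  + move=> z; rewrite subr0 => zr; rewrite cReD cReN cReZ; have := bd _ zr.
    exact: quarter_bound e0.
  + by rewrite subr0.
Qed.

(** Both bounds come from taking moduli in [root_factor]. The first gives uniqueness of the zero, a
    nonzero derivative there and Lipschitz dependence on [z]; the constant of the second is
    independent of [e], which makes the zero converge as [e] tends to 0. *)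
Lemma generator_root : exists l0, [/\ normc l0 < 1, E l0 = 0,
  forall l, normc l < 1 -> (1 - normc l0) * e / 32 * normc (l - l0) <= normc (E l)
  & forall l, normc l < 1 ->
      (1 - normc l) / 16 * - Re (G l) * normc (l - l0) <= normc (E l)].
Proof.
have [l0 l01 El0] := root_exists; exists l0.
have [r0 /andP[r02 r01] r0P] := boundary_radius.
(* The radius is adapted to [l]; the final bounds no longer mention it. *)
have fac l : normc l < 1 -> exists r p, [/\ 1 / 2 <= r, (1 + normc l0) / 2 <= r,
    (1 + normc l) / 2 <= r, r < 1 & [/\ E l = - (l - l0) * ((r ^+ 2)%:C - conjc l0 * l) * p,
    e / 8 <= Re p & - Re (G l) / 4 <= Re p]].
  move=> l1; pose r := Num.max r0 (Num.max ((1 + normc l0) / 2) ((1 + normc l) / 2)).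
  have r1 : r < 1.
    by rewrite !gt_max r01 !ltr_pdivrMr//; apply/andP; split; lra.
  have rr0 : r0 <= r by rewrite le_max lexx.
  have rl0 : (1 + normc l0) / 2 <= r by rewrite !le_max lexx orbT.
  have rl : (1 + normc l) / 2 <= r by rewrite !le_max lexx !orbT.
  have l0r : normc l0 < r.
    by apply: lt_le_trans rl0; rewrite ltr_pdivlMr//; lra.
  have lr : normc l <= r.
    by apply: le_trans rl; rewrite ler_pdivlMr//; lra.
  have [p /(_ l lr) pP] := root_factor l0r (le_trans r02 rr0) r1 (r0P r rr0 r1) El0.
  by exists r, (p l); split=> //; exact: le_trans r02 rr0.
(* The modulus is at least [r * (r - m)], where [1 / 2 <= r] and [(1 - m) / 2 <= r - m]. The first
   bound takes [m = |l0|], the second [m = |l|]. *)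
have low (l : R[i]) (r m : R) : 1 / 2 <= r -> normc l0 * normc l <= r * m ->
    (1 + m) / 2 <= r -> m <= 1 -> (1 - m) / 4 <= normc ((r ^+ 2)%:C - conjc l0 * l).
  move=> r2 lm mr m1.
  have := le_normcD ((r ^+ 2)%:C - conjc l0 * l) (conjc l0 * l).
  rewrite subrK normc_real ger0_norm ?sqr_ge0// normcM normc_conjc.
  have : 0 <= (r - 1 / 2) * (r - m) by rewrite mulr_ge0// subr_ge0//; lra.
  by move: lm; move: (normc l0 * normc l) (normc _) => X Y; lra.
have big (l : R[i]) (r c p k : R) : 0 <= c -> c <= r -> 0 <= k -> k <= p ->
    c * k * normc (l - l0) <= normc (l - l0) * r * p.
  move=> c0 cr k0 kp; rewrite mulrC -mulrA ler_wpM2l ?normc_ge0//.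
  by apply: ler_pM.
have nE (l p : R[i]) r : E l = - (l - l0) * ((r ^+ 2)%:C - conjc l0 * l) * p ->
    normc (E l) = normc (l - l0) * normc ((r ^+ 2)%:C - conjc l0 * l) * normc p.
  by move=> ->; rewrite !normcM normcN.
split=> // l l1; have [r [p [r2 rl0 rl r1 [Ep p1 p2]]]] := fac l l1; rewrite (nE _ _ _ Ep).
- have -> : (1 - normc l0) * e / 32 = (1 - normc l0) / 4 * (e / 8) by field.
  apply: big.
  + by rewrite divr_ge0// subr_ge0 ltW.
  + apply: low => //; last exact: ltW.
    rewrite mulrC ler_wpM2r ?normc_ge0//.
    by lra.
  + by rewrite divr_ge0// ltW.
  + by apply: (le_trans p1); rewrite (le_trans (ler_norm _))// ler_Re_normc.
- have -> : (1 - normc l) / 16 * - Re (G l) =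
    (1 - normc l) / 4 * (- Re (G l) / 4) by field.
  apply: big.
  + by rewrite divr_ge0// subr_ge0 ltW.
  + apply: low => //; last exact: ltW.
    by rewrite ler_wpM2r ?normc_ge0//; lra.
  + by rewrite divr_ge0// oppr_ge0 G0.
  + by apply: (le_trans p2); rewrite (le_trans (ler_norm _))// ler_Re_normc.
Qed.

End RootOfGenerator.

Lemma square_real_part (R : realType) (be : R) (x : R[i]) :
  (be + 2 * Re x) ^+ 2 =
  Re ((4 * be)%:C * x + 2%:C * (x * x)) + (be ^+ 2 + 2 * normc x ^+ 2).
Proof. by rewrite sqr_normc_Re_Im; case: x => p q /=; ring. Qed.

Lemma strict_room (R : realType) (d C g L T K : R) : 0 < C -> 0 <= d ->
  d * L <= - g -> L ^+ 2 <= C * L -> L ^+ 2 = T + K -> g + d / C * T <= - (d / C * K).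
Proof.
move=> C0 d0 H1 H2 H3; have : d / C * L ^+ 2 <= d * L.
  by rewrite -mulrA ler_wpM2l// mulrC ler_pdivrMr// mulrC.
by rewrite H3 mulrDr; move: (d / C * T) (d / C * K) (d * L) H1 => X Y Z; lra.
Qed.

(* [L^2 = beta^2 + 2 |alpha nu|^2 + Re (4 beta alpha nu + 2 alpha^2 nu^2)] for
   [L = beta + 2 Re (alpha nu)]: subtracting the holomorphic part leaves a
   strictly negative bound on a small circle. *)
Lemma strict_neg (R : realType) (G : R[i] -> R[i]) (c1 d : R) (al s : R[i]) :
  (forall l, normc l < 1 -> differentiable G l) -> 0 < d -> (al != 0) || (c1 != 0) ->
  (forall l, normc l < 1 -> l != 0 ->
     d * `|c1 + 2 * Re (l * al)| <= - Re (G l)) ->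
  normc s < 1 -> s != 0 -> Re (G s) < 0.
Proof.
move=> dG d0 ac H s1 s0; have ns0 : 0 < normc s by rewrite normc_gt0.
(* The disc of radius [rho] about [s] stays in the unit disc and away from 0, where [H] gives no
   information. *)
pose rho := Num.min (normc s / 2) ((1 - normc s) / 2).
have rho0 : 0 < rho by rewrite lt_min !divr_gt0// subr_gt0.
have rho1 : rho <= normc s / 2 by rewrite ge_min lexx.
have rho2 : rho <= (1 - normc s) / 2 by rewrite ge_min lexx orbT.
have {rho1} rs : rho < normc s by apply: le_lt_trans rho1 _; rewrite ltr_pdivrMr//; lra.
have in1 l : normc (l - s) <= rho -> normc l < 1.
  move=> lr; have := le_normcD (l - s) s; rewrite subrK => /le_lt_trans; apply.
  move: (lerD lr (lexx (normc s))) => /le_lt_trans; apply.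
  by move: rho2; rewrite ler_pdivlMr//; move: rho ns0 s1 {lr rs rho0} => t; lra.
pose be := c1 + 2 * Re (s * al).
(* [C] bounds the modulus of [c1 + 2 * Re (l * al)], so the linear estimate in [H] dominates [d / C]
   times its square. *)
pose C := `|c1| + 2 * normc al + 1.
have C0 : 0 < C by rewrite ltr_wpDl// addr_ge0// mulr_ge0// normc_ge0.
pose K := be ^+ 2 + 2 * (normc al * rho) ^+ 2.
have K0 : 0 < K.
  have := ac; have [a0 /= c0|a0 _] := eqVneq al 0.
    rewrite /K /be a0 mulr0 /= mulr0 addr0 ltr_wpDr//; first by rewrite mulr_ge0// sqr_ge0.
    by rewrite exprn_even_gt0.
  by rewrite /K ltr_wpDl// ?sqr_ge0// mulr_gt0// exprn_gt0// mulr_gt0// normc_gt0.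
pose T l := (4 * be)%:C * (al * (l - s)) + 2%:C * (al * (l - s) * (al * (l - s))).
pose q l := G l + (d / C)%:C * T l.
have dT l : differentiable T l.
  have dx : differentiable (fun z : R[i] => al * (z - s)) l.
    by apply: difM; [exact: dif_cst|apply: difB; [exact: dif_id|exact: dif_cst]].
  apply: difD; first by apply: difM; [exact: dif_cst|exact: dx].
  by apply: difM; [exact: dif_cst|apply: difM; exact: dx].
have dq l : normc (l - s) <= rho -> differentiable q l.
  move=> lr; apply: difD; first exact/dG/in1.
  by apply: difM; [exact: dif_cst|exact: dT].
suff : Re (q s) <= - (d / C * K).
  rewrite /q /T subrr !mulr0 addr0 mulr0 addr0 => /le_lt_trans; apply.
  by rewrite oppr_lt0 mulr_gt0// divr_gt0.
apply: (@max_principle R q s 0 rho _ (ltW rho0)).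
- by move=> l lr; apply: differentiable_continuous; exact: dq.
- by move=> l lr _; exact: dq.
- move=> l lr; have l1 : normc l < 1 by apply: in1; rewrite lr.
  have l0 : l != 0.
    by apply/eqP => l0; move: lr rs; rewrite l0 sub0r normcN => ->; rewrite ltxx.
  rewrite cReD cReZ; apply: (strict_room C0 (ltW d0) (H l l1 l0)).
    rewrite expr2 ler_wpM2r// (le_trans (ler_normD _ _))// /C -addrA lerD2l.
    rewrite normrM ger0_norm// ler_wpDr// ler_wpM2l// (le_trans (ler_Re_normc _))//.
    by rewrite normcM -[leRHS]mul1r ler_wpM2r ?normc_ge0// ltW.
  rewrite real_normK ?num_real// /K -lr -normcM -square_real_part; congr (_ ^+ 2).
  by rewrite /be -addrA -mulrDr -cReD; congr (_ + _ * Re _); ring.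
- by rewrite subrr normc0 ltW.
Qed.

(** * Differentiability on row vectors; tube domains *)

Section RowVectors.
Context {R : realType} (n : nat).
Implicit Types (z v : 'rV[R[i]]_n) (D : set 'rV[R[i]]_n).

Lemma row_nbhsP z (P : set 'rV[R[i]]_n) : (exists2 t : R, 0 < t &
  forall w : 'rV[R[i]]_n, (forall j, normc (w 0 j - z 0 j) < t) -> P w) -> nbhs z P.
Proof.
move=> [t t0 tP]; apply/nbhs_ballP; exists t%:C; first by rewrite /= ltcR.
move=> w [_ zw]; apply: tP => j; have := zw 0 j.
by rewrite -ball_normE /ball_/= norm_normc ltcR normcB.
Qed.

Lemma normc_row_le v j : (normc (v 0 j))%:C <= `|v|.
Proof.
rewrite -norm_normc [leRHS]/Num.Def.normr /= mx_normE.
have : `|v 0 j|%:nng <= \big[Num.max/0%:nng]_i `|v i.1 i.2|%:nng.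
  exact: (le_bigmax _ (fun i : 'I_1 * 'I_n => `|v i.1 i.2|%:nng) (0, j)).
by rewrite -num_le.
Qed.

Lemma row_differentiable (f : 'rV[R[i]]_n -> R[i]) z (L : 'I_n -> R[i]) :
  (forall e : R, 0 < e -> exists2 t : R, 0 < t & forall v, (forall j, normc (v 0 j) < t) ->
     normc (f (z + v) - f z - \sum_j L j * v 0 j) <= e * \sum_j normc (v 0 j)) ->
  differentiable f z.
Proof.
move=> fL.
have dlin : linear (fun v : 'rV[R[i]]_n => \sum_j L j * v 0 j).
  move=> a u v; rewrite /GRing.scale /= mulr_sumr -big_split /=.
  by apply: eq_bigr => j _; rewrite !mxE mulrDr mulrCA.
pose df : {linear 'rV[R[i]]_n -> R[i]} :=
  HB.pack (fun v : 'rV[R[i]]_n => \sum_j L j * v 0 j) (GRing.isLinear.Build _ _ _ _ _ dlin).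
have cdf : continuous df.
  move=> x; apply: differentiable_continuous.
  by apply: dif_sum => j; apply: difM; [exact: dif_cst|exact: dif_coord].
have fE : f \o shift z = cst (f z) + (df : 'rV[R[i]]_n -> R[i]) +o_ (0 : 'rV[R[i]]_n) id.
  apply/eqaddoP => _/gt0cP[e e0 ->].
  have n0 : 0 < n%:R + 1 :> R by rewrite ltr_wpDl.
  have [t t0 tP] := fL (e / (n%:R + 1)) (divr_gt0 e0 n0).
  apply: row_nbhsP; exists t => // v vt.
  have {}vt j : normc (v 0 j) < t by have := vt j; rewrite mxE subr0.
  have := tP v vt; rewrite /= !fctE [v + z]addrC.
  rewrite -[f (z + v) - f z - _]addrA -opprD norm_normc -lecR => /le_trans; apply.
  rewrite rmorphM rmorph_sum /=.
  apply: (@le_trans _ _ ((e / (n%:R + 1))%:C * \sum_(j < n) `|v|)).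
    rewrite ler_wpM2l ?ler0c ?divr_ge0 ?(ltW e0) ?(ltW n0)//.
    by apply: ler_sum => j _; exact: normc_row_le.
  rewrite sumr_const card_ord -[`|v| *+ n]mulr_natl mulrA ler_wpM2r//.
  rewrite -(rmorph_nat (real_complex R)) -rmorphM lecR -mulrA ler_piMr ?(ltW e0)//.
  by rewrite mulrC ler_pdivrMr// mul1r lerDl.
apply/diff_locallyP; rewrite (diff_unique cdf fE); split => //.
Qed.

Lemma dif_row (f : R[i] -> 'rV[R[i]]_n) s :
  (forall j, differentiable (fun l => f l 0 j) s) -> differentiable f s.
Proof.
move=> df; have -> : f = \sum_j (fun l => f l 0 j *: delta_mx 0 j).
  apply/funext => l; rewrite fct_sumE; exact: row_sum_delta.
apply: differentiable_sum => j.
exact/differentiableZl.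
Qed.

Lemma tube_open D : convex_tube_domain D -> forall z, D z -> exists2 t : R, 0 < t &
  forall w : 'rV[R[i]]_n, (forall j, `|Re (w 0 j) - Re (z 0 j)| < t) -> D w.
Proof.
move=> [Om [[oO _ _] _ ->]] z Dz.
have /nbhs_ballP[t /= t0 tP] : nbhs (Re_vec z) Om by apply: open_nbhs_nbhs.
exists t => // w wz; apply: tP; split=> // i j; rewrite !mxE ord1.
by rewrite -ball_normE /ball_/= distrC.
Qed.

Lemma tube_convex D : convex_tube_domain D -> forall z w (t : R), D z -> D w ->
  0 <= t -> t <= 1 -> D (t%:C *: z + (1 - t)%:C *: w).
Proof.
move=> [Om [_ cO ->]] z w t Dz Dw t0 t1.
have := cO _ _ (Itv01 t0 t1) (mem_set Dz) (mem_set Dw); rewrite inE.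
congr (Om _); apply/rowP => j; rewrite /conv /= !mxE cReD !cReZ.
by [].
Qed.

End RowVectors.

(** * Approximate left inverses *)

Section LeftInverse.
Context {R : realType} (n : nat) (D : set 'rV[R[i]]_n) (phi : R[i] -> 'rV[R[i]]_n)
  (mu : 'I_n -> signed_measure R) (a : 'rV[R[i]]_n) (b : 'rV[R]_n).
Hypothesis tubeD : convex_tube_domain D.
Hypothesis phi_holo : holomorphic_maps unit_disc D phi.
Hypothesis phi_mu : boundary_measure phi mu.
Hypothesis neg : forall z, D z -> forall E, measurable E ->
  \sum_j ci (Re_arc_minus z mu j) E (wgt a b j) <= 0.
Hypothesis ab0 : exists j, (a 0 j != 0) || (b 0 j != 0).

Let F (z : 'rV[R[i]]_n) (l : R[i]) : R[i] := \sum_j hquad a b l 0 j * (z 0 j - phi l 0 j).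
Let W (z : 'rV[R[i]]_n) := \sum_j a 0 j * (z 0 j - phi 0 0 j).

Let is_generator z (G : R[i] -> R[i]) := [/\ forall l, normc l < 1 -> differentiable G l,
  forall l, normc l < 1 -> F z l = l * G l + W z - conjc (W z) * l ^+ 2
  & forall l, normc l < 1 -> Re (G l) <= 0].

Let generator z : D z -> exists G, is_generator z G.
Proof.
move=> Dz; have [G [dG FG RG]] := herglotz_identity phi_mu a b z.
exists G; split=> // l l1; rewrite RG// mulr_ge0_le0 ?invr_ge0 ?mulr_ge0 ?pi_ge0//.
apply: (@ci_sum_weight _ _ R _ (Re_arc_minus z mu) (wgt a b)
  (fun x => Re (herK (circle_val x) l))) => //.
- by move=> j; exact: wgt_bmf.
- exact: (herK_cbmf l1).1.
- by move=> x; rewrite ltW// Re_herK_gt0// normc_circle.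
- exact: neg.
Qed.

Let FD z (t : R[i]) j l :
  F (z + t *: delta_mx 0 j) l = F z l + t * hquad a b l 0 j.
Proof.
rewrite /F (bigD1 j)//= [in RHS](bigD1 j)//= !mxE !eqxx mulr1.
rewrite (eq_bigr (fun i => hquad a b l 0 i * (z 0 i - phi l 0 i))); first by ring.
by move=> i ij; rewrite !mxE (negbTE ij) /= mulr0 addr0.
Qed.

Let WD z (t : R[i]) j : W (z + t *: delta_mx 0 j) = W z + t * a 0 j.
Proof.
rewrite /W (bigD1 j)//= [in RHS](bigD1 j)//= !mxE !eqxx mulr1.
rewrite (eq_bigr (fun i => a 0 i * (z 0 i - phi 0 0 i))); first by ring.
by move=> i ij; rewrite !mxE (negbTE ij) /= mulr0 addr0.
Qed.

(** [D] contains [z] shifted by [d] and by [- d] along a coordinate [j], and a shift by [e] adds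
    [e * (b + 2 Re (l * conjc a))] to [Re G]. Both results are nonpositive, so [- Re G] is at least
    [d] times the modulus of that factor, as [strict_neg] requires. *)
Let generator_lt0 z G s : D z -> is_generator z G -> normc s < 1 -> s != 0 ->
  Re (G s) < 0.
Proof.
move=> Dz [dG FG RG] s1 s0; have [j abj] := ab0.
have [t t0 tP] := tube_open tubeD Dz.
pose d := t / 2; have d0 : 0 < d by rewrite divr_gt0.
have shift e : `|e| = d -> forall l, normc l < 1 -> l != 0 ->
    Re (G l) + e * (b 0 j + 2 * Re (l * conjc (a 0 j))) <= 0.
  move=> ed l l1 l0.
  have De : D (z + e%:C *: delta_mx 0 j).
    apply: tP => i; rewrite !mxE eqxx /=.
    have -> : Re (z 0 i + e%:C * ((i == j)%:R)) - Re (z 0 i) =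
      e * (i == j)%:R by rewrite cReD cReZ; case: (i == j) => /=; ring.
    case: (i == j); rewrite ?mulr1 ?mulr0 ?normr0// ed /d ltr_pdivrMr//.
    by rewrite ltr_pMr// ltr1n.
  have [G' [_ FG' RG']] := generator De.
  have -> : Re (G l) + e * (b 0 j + 2 * Re (l * conjc (a 0 j))) =
      Re (G' l); last exact: RG'.
  have : l * G' l = l * (G l + e%:C * ((b 0 j)%:C + 2%:C * (l * conjc (a 0 j)))).
    have cD : conjc (W z + e%:C * a 0 j) = conjc (W z) + e%:C * conjc (a 0 j).
      by case: (W z) (a 0 j) => [? ?] [? ?]; apply: complex_eqP => /=; ring.
    have := FG' l l1; rewrite FD WD FG// hquadE cD => H.
    move: H; move: (W z) (conjc (W z)) (conjc (a 0 j)) => w wc ac H.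
    have -> : l * G' l = (l * G' l + (w + e%:C * a 0 j) - (wc + e%:C * ac) * l ^+ 2) -
       (w + e%:C * a 0 j) + (wc + e%:C * ac) * l ^+ 2 by ring.
    by rewrite -H; ring.
  by move/(mulfI l0) => ->; rewrite cReD cReZ cReD cReZ /=.
apply: (@strict_neg _ G (b 0 j) d (conjc (a 0 j)) s) => //.
- by rewrite conjc_eq0.
- move=> l l1 l0; have := shift d (gtr0_norm d0) l l1 l0.
  have := shift (- d) _ l l1 l0; rewrite normrN gtr0_norm// => /(_ erefl).
  move: (b 0 j + _) (Re (G l)) => X Y.
  by case: (ger0P X) => _; lra.
Qed.

Let E (e : R) z l := F z l - e%:C * l.
(** For [z] in [D] and [e > 0] the root exists and is unique, so neither the choice nor the default
    0 matters there. *)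
Let inv (e : R) z := xget 0 [set l | normc l < 1 /\ E e z l = 0].

Let inv_spec e z G : 0 < e -> is_generator z G ->
  [/\ normc (inv e z) < 1, E e z (inv e z) = 0,
    forall l, normc l < 1 -> (1 - normc (inv e z)) * e / 32 * normc (l - inv e z) <=
      normc (E e z l)
  & forall l, normc l < 1 -> (1 - normc l) / 16 * - Re (G l) *
      normc (l - inv e z) <= normc (E e z l)].
Proof.
move=> e0 [dG FG RG]; have [l0 [l01 El0 B1 B2]] := generator_root (W z) dG RG e0.
have eE l : normc l < 1 -> l * G l + W z - conjc (W z) * l ^+ 2 - e%:C * l = E e z l.
  by move=> l1; rewrite /E FG.
have [i1 Ei] : normc (inv e z) < 1 /\ E e z (inv e z) = 0.
  rewrite /inv; case: xgetP => [l -> []//|/(_ l0)]; case; split=> //.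
  by rewrite -eE.
have c0 : 0 < (1 - normc l0) * e / 32 by rewrite divr_gt0// mulr_gt0// subr_gt0.
have il0 : inv e z = l0.
  apply/eqP; rewrite -subr_eq0 -normc_eq0; apply/eqP/le_anti; rewrite normc_ge0 andbT.
  by have := B1 _ i1; rewrite eE// Ei normc0 pmulr_rle0.
by split=> // l l1; rewrite -eE// il0; [exact: B1|exact: B2].
Qed.

Let inv_phi s : normc s < 1 -> exists2 C, 0 <= C & forall e, 0 < e ->
  normc (inv e (phi s) - s) <= e * C.
Proof.
move=> s1; have Ds : D (phi s) by apply: phi_holo.2; rewrite unit_discE.
have [G gG] := generator Ds.
have Es e : E e (phi s) s = - (e%:C * s).
  rewrite /E /F big1 ?sub0r// => j _; by rewrite subrr mulr0.
have [sz|s0] := eqVneq s 0.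
  exists 0 => // e e0; have [i1 Ei B _] := inv_spec e0 gG; have := B _ s1.
  have c0 : 0 < (1 - normc (inv e (phi s))) * e / 32.
    by rewrite divr_gt0// mulr_gt0// subr_gt0.
  have es : e%:C * s = 0 by rewrite sz mulr0.
  by rewrite Es es oppr0 normc0 (pmulr_rle0 _ c0) normcB mulr0.
have G0 := generator_lt0 Ds gG s1 s0.
have c0 : 0 < (1 - normc s) / 16 * - Re (G s).
  by rewrite mulr_gt0 ?oppr_gt0// divr_gt0// subr_gt0.
exists (normc s / ((1 - normc s) / 16 * - Re (G s))).
  by rewrite divr_ge0 ?normc_ge0// ltW.
move=> e e0; have [_ _ _ B] := inv_spec e0 gG; have := B _ s1.
rewrite Es normcN normcM normc_real gtr0_norm// normcB => H.
by rewrite mulrA ler_pdivlMr// mulrC.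
Qed.

Let hb := \sum_j (2 * normc (a 0 j) + `|b 0 j|).

Let hb_ge j : 2 * normc (a 0 j) + `|b 0 j| <= hb.
Proof.
rewrite /hb (bigD1 j)//= lerDl sumr_ge0// => i _.
by rewrite addr_ge0// mulr_ge0// normc_ge0.
Qed.

Let hquad_bound l j : normc l < 1 -> normc (hquad a b l 0 j) <= hb.
Proof.
move=> l1; apply: le_trans (hb_ge j); rewrite hquadE.
have l2 := ltW l1.
apply: le_trans (le_normcD _ _) _; apply: le_trans (lerD (le_normcD _ _) (lexx _)) _.
rewrite (normcM (l ^+ 2)) (normcM l (b 0 j)%:C) normc_conjc normc_real.
have : normc (l ^+ 2) * normc (a 0 j) <= normc (a 0 j).
  by rewrite normcX ler_piMl ?normc_ge0// expr_le1// normc_ge0.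
have : normc l * `|b 0 j| <= `|b 0 j| by rewrite ler_piMl.
have := normc_ge0 (a 0 j).
by move: (normc l * `|b 0 j|) (normc (l ^+ 2) * normc (a 0 j)) => X Y; lra.
Qed.

Let hquad_lip l l' j : normc l < 1 -> normc l' < 1 ->
  normc (hquad a b l 0 j - hquad a b l' 0 j) <= hb * normc (l' - l).
Proof.
move=> l1 l1'; rewrite !hquadE.
have -> : l ^+ 2 * conjc (a 0 j) + l * (b 0 j)%:C + a 0 j -
  (l' ^+ 2 * conjc (a 0 j) + l' * (b 0 j)%:C + a 0 j) =
  ((l + l') * conjc (a 0 j) + (b 0 j)%:C) * (l - l') by ring.
rewrite normcM normcB ler_wpM2r ?normc_ge0// (le_trans _ (hb_ge j))//.
apply: le_trans (le_normcD _ _) _; rewrite normcM normc_conjc normc_real lerD2r.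
by rewrite ler_wpM2r ?normc_ge0// (le_trans (le_normcD _ _))// lerD// ltW.
Qed.

Let sum_bound (h v : 'I_n -> R[i]) (B : R) : (forall j, normc (h j) <= B) ->
  normc (\sum_j h j * v j) <= B * \sum_j normc (v j).
Proof.
move=> hB; rewrite mulr_sumr.
elim/big_rec2 : _ => [|j X Y _ H]; first by rewrite normc0.
by apply: le_trans (le_normcD _ _) _; rewrite normcM lerD// ler_wpM2r ?normc_ge0.
Qed.

Let dE e z l : normc l < 1 -> differentiable (E e z) l.
Proof.
move=> l1; apply: difB; last by apply: difM; [exact: dif_cst|exact: dif_id].
apply: dif_sum => j; apply: difM.
  have -> : (fun x => hquad a b x 0 j) =
      (fun x => x * x * conjc (a 0 j) + x * (b 0 j)%:C + a 0 j).
    by apply/funext => x; rewrite hquadE expr2.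
  apply: difD; last exact: dif_cst; apply: difD; apply: difM; try exact: dif_cst.
    by apply: difM; exact: dif_id.
  exact: dif_id.
apply: difB; first exact: dif_cst.
by apply/dif_entry/phi_holo.1; rewrite unit_discE.
Qed.

(** The implicit function theorem for a simple root, by hand. [E] changes by [h l . v] when [z]
    moves by [v]; the lower bound for [E] at [z] gives both [d != 0] and [|l' - l0| <= Q * N]. The
    derivative is therefore [v |-> - (h l0 . v) / d]. *)
Let inv_differentiable e z : 0 < e -> D z -> differentiable (inv e) z.
Proof.
move=> e0 Dz; have [G gG] := generator Dz.
have [i1 Ei B _] := inv_spec e0 gG; set l0 := inv e z in i1 Ei B.
set c := (1 - normc l0) * e / 32 in B.
have c0 : 0 < c by rewrite divr_gt0// mulr_gt0// subr_gt0.
have [d dP] := (differentiable_normcP _ _).1 (dE e z i1).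
have d0 : 0 < normc d.
  rewrite normc_gt0; apply/eqP => dz.
  have [t t0 /= tP] := dP (c / 2) (divr_gt0 c0 (ltr0n _ 2)).
  pose k := Num.min (t / 2) ((1 - normc l0) / 2).
  have k0 : 0 < k by rewrite lt_min !divr_gt0// subr_gt0.
  have kt : k < t by rewrite gt_min ltr_pdivrMr// ltr_pMr// ltr1n.
  have nk : normc k%:C = k by rewrite normc_real gtr0_norm.
  have l1 : normc (l0 + k%:C) < 1.
    apply: le_lt_trans (le_normcD _ _) _; rewrite nk.
    have : k <= (1 - normc l0) / 2 by rewrite ge_min lexx orbT.
    by rewrite ler_pdivlMr//; move: i1; move: (normc l0) (k) => X Y; lra.
  have := tP k%:C; rewrite nk => /(_ kt); rewrite Ei dz mul0r !subr0.
  have := B _ l1; rewrite [l0 + _]addrC addrK nk => H1 /(le_trans H1).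
  by rewrite ler_pM2r// ler_pdivlMr// ger_pMr// lern1.
have hb0 : 0 <= hb.
  by apply: sumr_ge0 => j _; rewrite addr_ge0// mulr_ge0// normc_ge0.
have [t1 t10 t1P] := tube_open tubeD Dz.
pose Q := hb / c + 1; have Q0 : 0 < Q by rewrite ltr_wpDl// divr_ge0// ltW.
apply: (row_differentiable (L := fun j => - hquad a b l0 0 j / d)) => e1 e10.
(* Half of the admissible error pays for the linearization of [E] at [l0], half for replacing [h l']
   by [h l0]. *)
pose m := normc d * e1 / 2.
have m0 : 0 < m by rewrite divr_gt0// mulr_gt0.
have [t2 t20 t2P] := dP (m / Q) (divr_gt0 m0 Q0).
pose tau := Num.min (t2 / Q) (m / (hb + 1) / Q).
have hb1 : 0 < hb + 1 by rewrite ltr_wpDl.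
have tau0 : 0 < tau by rewrite lt_min (divr_gt0 t20 Q0) (divr_gt0 (divr_gt0 m0 hb1) Q0).
have n0 : 0 < n%:R + 1 :> R by rewrite ltr_wpDl.
exists (Num.min t1 (tau / (n%:R + 1))); first by rewrite lt_min t10 divr_gt0.
move=> v vt; set N := \sum_j normc (v 0 j).
have N0 : 0 <= N by apply: sumr_ge0 => j _; exact: normc_ge0.
have Nt : N < tau.
  apply: (@le_lt_trans _ _ (\sum_(j < n) (tau / (n%:R + 1)))).
    by apply: ler_sum => j _; have := vt j; rewrite lt_min => /andP[_ /ltW].
  rewrite sumr_const card_ord -[_ *+ n]mulr_natl mulrCA gtr_pMr//.
  by rewrite ltr_pdivrMr// mul1r ltrDl.
have Dv : D (z + v).
  apply: t1P => j; rewrite mxE cReD addrAC subrr add0r.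
  apply: le_lt_trans (ler_Re_normc _) _.
  by have := vt j; rewrite lt_min => /andP[].
have [G' gG'] := generator Dv; have [i1' Ei' _ _] := inv_spec e0 gG'.
set l' := inv e (z + v) in i1' Ei' *.
have El' : E e z l' = - \sum_j hquad a b l' 0 j * v 0 j.
  have : E e (z + v) l' = E e z l' + \sum_j hquad a b l' 0 j * v 0 j.
    rewrite /E [RHS]addrAC; congr (_ - _); rewrite /F -big_split /=.
    apply: eq_bigr => j _; have -> : (z + v) 0 j = z 0 j + v 0 j by rewrite mxE.
    by ring.
  by rewrite Ei' => /esym/eqP; rewrite addr_eq0 => /eqP.
have kQ : normc (l' - l0) <= Q * N.
  apply: (@le_trans _ _ (hb / c * N)); last by rewrite ler_wpM2r// lerDl.
  rewrite mulrAC ler_pdivlMr// mulrC (le_trans (B _ i1'))// El' normcN.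
  by apply: (@sum_bound _ (fun j => v 0 j)) => j; exact: hquad_bound.
have NQ1 : Q * N < t2.
  by move: Nt; rewrite lt_min => /andP[+ _]; rewrite ltr_pdivlMr// mulrC.
have NQ2 : hb * (Q * N) <= m.
  move: Nt; rewrite lt_min => /andP[_ /ltW].
  rewrite (ler_pdivlMr _ _ Q0) (ler_pdivlMr _ _ hb1) => H.
  apply: le_trans H; rewrite mulrC [N * Q]mulrC ler_wpM2l ?mulr_ge0 ?(ltW Q0)//.
  by rewrite lerDl.
have lk := t2P _ (le_lt_trans kQ NQ1).
rewrite [l0 + _]addrC subrK Ei subr0 El' in lk.
have -> : l' - l0 - \sum_j - hquad a b l0 0 j / d * v 0 j =
  d^-1 * - ((- (\sum_j hquad a b l' 0 j * v 0 j) - d * (l' - l0)) +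
    \sum_j (hquad a b l' 0 j - hquad a b l0 0 j) * v 0 j).
  have -> : \sum_j - hquad a b l0 0 j / d * v 0 j =
      - d^-1 * \sum_j hquad a b l0 0 j * v 0 j.
    by rewrite mulr_sumr; apply: eq_bigr => j _; ring.
  have -> : \sum_j (hquad a b l' 0 j - hquad a b l0 0 j) * v 0 j =
      \sum_j hquad a b l' 0 j * v 0 j - \sum_j hquad a b l0 0 j * v 0 j.
    by rewrite -sumrB; apply: eq_bigr => j _; ring.
  by move: (\sum_j _) (\sum_j _) => X Y; field; rewrite -normc_gt0.
rewrite normcM normcN normcV mulrC ler_pdivrMr//.
apply: le_trans (le_normcD _ _) _.
have -> : e1 * N * normc d = m * N + m * N by rewrite /m; field.
apply: lerD.
  apply: (le_trans lk); apply: (@le_trans _ _ (m / Q * (Q * N))).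
    by rewrite ler_wpM2l// divr_ge0 ?(ltW m0) ?(ltW Q0).
  by rewrite mulrA divfK// gt_eqF.
apply: (@le_trans _ _ (hb * (Q * N) * N)); last by rewrite ler_wpM2r.
apply: (@sum_bound _ (fun j => v 0 j)) => j; apply: le_trans (hquad_lip j i1' i1) _.
by rewrite normcB ler_wpM2l.
Qed.

Lemma approximate_left_inverse s t (eta : R) : normc s < 1 -> normc t < 1 -> 0 < eta ->
  exists2 f, holomorphic_maps D unit_disc f &
    normc (f (phi s) - s) <= eta /\ normc (f (phi t) - t) <= eta.
Proof.
move=> s1 t1 eta0; have [C C0 CP] := inv_phi s1; have [C' C'0 CP'] := inv_phi t1.
have D0 : 0 < C + C' + 1 by rewrite ltr_wpDl// addr_ge0.
pose e := eta / (C + C' + 1); have e0 : 0 < e by rewrite divr_gt0.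
have eE : eta = e * C + e * C' + e by rewrite /e; field; rewrite gt_eqF.
exists (inv e).
  split=> [z Dz|z Dz]; first exact: inv_differentiable.
  by have [G gG] := generator Dz; have [i1 _ _ _] := inv_spec e0 gG; rewrite unit_discE.
have eC : 0 <= e * C by rewrite mulr_ge0// ltW.
have eC' : 0 <= e * C' by rewrite mulr_ge0// ltW.
split; [apply: le_trans (CP e e0) _|apply: le_trans (CP' e e0) _].
  by rewrite eE -addrA lerDl addr_ge0// ltW.
by rewrite eE -addrA addrCA lerDl addr_ge0// ltW.
Qed.

End LeftInverse.

Lemma pinch (R : realType) (A X Y Z k : R) :
  A <= X + 2 * k -> Z <= k -> 4 * k = A - Y -> Y + 2 * Z <= X.
Proof. lra. Qed.

(** * Poincare and Caratheodory distances *)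

Section ApproximateInverse.
Context {R : realType}.

Lemma poincareE (z w : R[i]) : poincare z w =
  ln ((1 + normc ((z - w) / (1 - conjc w * z))) /
      (1 - normc ((z - w) / (1 - conjc w * z)))) / 2.
Proof. by rewrite /poincare Re_norm. Qed.

Lemma poincare_ge0 (z w : R[i]) : normc z < 1 -> normc w < 1 -> 0 <= poincare z w.
Proof.
move=> z1 w1; rewrite poincareE.
have := atanh_le (lexx 0) (normc_ge0 ((z - w) / (1 - conjc w * z))) (mobius_lt1 w1 z1).
by rewrite addr0 subr0 divr1 ln1 mul0r.
Qed.

Lemma poincare_lower (z w : R[i]) (y : R) : normc z < 1 -> normc w < 1 -> 0 <= y ->
  y < poincare z w -> exists2 k : R, 0 < k & forall z' w', normc z' < 1 -> normc w' < 1 ->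
    normc (z' - z) <= k -> normc (w' - w) <= k -> y <= poincare z' w'.
Proof.
(* [m1] is [tanh y], the pseudo-hyperbolic distance corresponding to [y]. *)
move=> z1 w1 y0 yL; pose m1 := (expR (2 * y) - 1) / (expR (2 * y) + 1).
have e1 : 1 <= expR (2 * y) by rewrite -expR0 ler_expR mulr_ge0.
have e0 : 0 < expR (2 * y) + 1 by rewrite ltr_wpDl// expR_ge0.
have m10 : 0 <= m1 by rewrite divr_ge0 ?subr_ge0// ltW.
have m11 : m1 < 1 by rewrite ltr_pdivrMr// mul1r ltrBlDr -addrA ltrDl.
have yE : y = ln ((1 + m1) / (1 - m1)) / 2.
  have -> : (1 + m1) / (1 - m1) = expR (2 * y).
    rewrite /m1; move: (expR _) e0 e1 => X X0 X1.
    have X2 : X + 1 != 0 by rewrite gt_eqF.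
    field; rewrite X2 /=; apply/eqP; lra.
  by rewrite expRK; field.
set A := normc (z - w); set B := normc (1 - conjc w * z).
have B0 : 0 < B by rewrite normc_gt0; exact: neq0_1BJM.
have mA : m1 * B < A.
  rewrite -ltr_pdivlMr// -/A -/B.
  have -> : A / B = normc ((z - w) / (1 - conjc w * z)) by rewrite normcM normcV.
  rewrite ltNge; apply: contraTN yL => mm; rewrite -leNgt yE poincareE.
  by apply: atanh_le => //; exact: normc_ge0.
(* Numerator and denominator of the quotient each change by at most [2 * k], and [m1 <= 1], so the
   slack [A - m1 * B] is divided by 4. *)
exists ((A - m1 * B) / 4); first by rewrite divr_gt0// subr_gt0.
set k := _ / 4 => z' w' z1' w1' zk wk; rewrite yE poincareE; apply: atanh_le => //; last first.
  exact: mobius_lt1.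
have B'0 : 0 < normc (1 - conjc w' * z') by rewrite normc_gt0; exact: neq0_1BJM.
rewrite normcM normcV ler_pdivlMr//.
have A' : A <= normc (z' - w') + 2 * k.
  have -> : A = normc ((z' - w') + ((z - z') + (w' - w))) by congr normc; ring.
  apply: le_trans (le_normcD _ _) _; rewrite lerD2l; apply: le_trans (le_normcD _ _) _.
  by rewrite mulr2n mulrDl mul1r lerD// normcB.
have B' : normc (1 - conjc w' * z') <= B + 2 * k.
  have -> : 1 - conjc w' * z' = (1 - conjc w * z) + (conjc w * (z - z') + conjc (w - w') * z').
    rewrite (_ : conjc (w - w') = conjc w - conjc w'); first by ring.
    by case: (w) (w') => [? ?] [? ?]; apply: complex_eqP => /=; ring.
  apply: le_trans (le_normcD _ _) _; rewrite lerD2l; apply: le_trans (le_normcD _ _) _.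
  rewrite mulr2n mulrDl mul1r !normcM !normc_conjc; apply: lerD.
    by rewrite -[leRHS]mul1r ler_pM ?normc_ge0 ?(ltW w1)// normcB.
  by rewrite -[leRHS]mulr1 ler_pM ?normc_ge0 ?(ltW z1')// normcB.
apply: (@le_trans _ _ (m1 * (B + 2 * k))); first by rewrite ler_wpM2l.
have : m1 * k <= k by rewrite ler_piMl ?(ltW m11)// divr_ge0// subr_ge0 ltW.
have : 4 * k = A - m1 * B by rewrite /k; field.
move=> H4 Hm; have -> : m1 * (B + 2 * k) = m1 * B + 2 * (m1 * k) by ring.
exact: pinch A' Hm H4.
Qed.

(** The upper bound is the contraction property of [f \o phi]. For the lower bound, functions nearly
    inverting [phi] at the two points approach the supremum, by [poincare_lower]. *)
Lemma approximate_inverse_geodesic n (D : set 'rV[R[i]]_n) (phi : R[i] -> 'rV[R[i]]_n) :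
  holomorphic_maps unit_disc D phi ->
  (forall s t (eta : R), normc s < 1 -> normc t < 1 -> 0 < eta ->
    exists2 f, holomorphic_maps D unit_disc f &
      normc (f (phi s) - s) <= eta /\ normc (f (phi t) - t) <= eta) ->
  complex_geodesic D phi.
Proof.
move=> phi_holo inv; split=> // z w; rewrite !(@unit_discE R) => z1 w1; apply/eqP; rewrite eq_le; apply/andP; split.
  apply: ge_ereal_sup => _ [f [df fD] <-]; rewrite lee_fin.
  apply: (@poincare_contract R (fun x => f (phi x))).
  - split=> [x x1|x x1].
      apply: (dif_comp (f := phi)); first exact: phi_holo.1.
      by apply: df; exact: phi_holo.2.
    by apply: fD; exact: phi_holo.2.
  - by rewrite unit_discE.
  - by rewrite unit_discE.
have phiD s : normc s < 1 -> D (phi s) by move=> s1; apply: phi_holo.2; rewrite unit_discE.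
have fd f s : holomorphic_maps D unit_disc f -> normc s < 1 -> normc (f (phi s)) < 1.
  by move=> [_ fD] s1; have := fD _ (phiD _ s1); rewrite unit_discE.
apply/lee_addgt0Pr => e e0.
(* [poincare_lower] asks for a nonnegative threshold; when the distance is at most [e], any
   competitor will do. *)
have [small|big] := leP (poincare z w) e.
  have [f hf _] := inv z w 1 z1 w1 ltr01.
  apply: (@le_trans _ _ (0%:E + e%:E)%E); first by rewrite -EFinD lee_fin add0r.
  rewrite leeD2r//; apply: (@le_trans _ _ (poincare (f (phi z)) (f (phi w)))%:E).
    by rewrite lee_fin poincare_ge0//; exact: fd.
  by apply: ereal_sup_ubound; exists f.
have y0 : 0 <= poincare z w - e by rewrite subr_ge0 ltW.
have yL : poincare z w - e < poincare z w by rewrite gtrBl.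
have [k k0 kP] := poincare_lower z1 w1 y0 yL.
have [f hf [fz fw]] := inv z w k z1 w1 k0.
rewrite -(subrK e (poincare z w)) EFinD leeD2r//.
apply: (@le_trans _ _ (poincare (f (phi z)) (f (phi w)))%:E).
  by rewrite lee_fin; apply: kP => //; exact: fd.
by apply: ereal_sup_ubound; exists f.
Qed.

End ApproximateInverse.

(** * The extremal functional of a geodesic *)

Section Perturbation.
Context {R : realType} (n : nat) (D : set 'rV[R[i]]_n) (phi : R[i] -> 'rV[R[i]]_n)
  (mu : 'I_n -> signed_measure R).
Hypothesis n_gt0 : (0 < n)%N.
Hypothesis tubeD : convex_tube_domain D.
Hypothesis phi_holo : holomorphic_maps unit_disc D phi.
Hypothesis phi_mu : boundary_measure phi mu.
Variables (z : 'rV[R[i]]_n) (u : circle R -> R).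
Hypothesis Dz : D z.
Hypothesis bu : bmf u.
Hypothesis u01 : forall x, 0 <= u x <= 1.
Local Notation kap := (Re_arc_minus z mu).
Local Notation pois l := (fun x : circle R => Re (herK (circle_val x) l)).

(** Up to imaginary constants, the map with boundary measure [(1 - u) dmu + u Re z dL]: the fraction
    [u] of [mu] is exchanged for the boundary measure of the constant map [z]. *)
Definition perturbed (l : R[i]) : 'rV[R[i]]_n := \row_j (phi l 0 j + (2 * pi)^-1%:C *
  ciC (kap j) setT (fun x => (u x)%:C * herK (circle_val x) l)).

Let Re_phi l j : normc l < 1 ->
  2 * pi * Re (phi l 0 j) = ci (mu j) setT (pois l).
Proof.
move=> l1; have [alpha alphaP] := phi_mu j; rewrite alphaP ?unit_discE// cReD cReZ.
have -> : Re ('i * alpha%:C) = 0 by rewrite -complexiE /=; ring.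
rewrite addr0 mulrA mulfV ?mul1r//.
by rewrite gt_eqF// mulr_gt0// pi_gt0.
Qed.

Let pois_bmf l : normc l < 1 -> bmf (pois l).
Proof. by move=> l1; exact: (herK_cbmf l1).1. Qed.

Let pois_gt0 l x : normc l < 1 -> 0 < pois l x.
Proof. by move=> l1; rewrite Re_herK_gt0// normc_circle. Qed.

Let arc_pois l : normc l < 1 -> ci (@arc_charge R) setT (pois l) = 2 * pi.
Proof. by move=> /arc_herK_complex /(congr1 (@Re R)). Qed.

Let perturbedE l j : normc l < 1 -> 2 * pi * Re (perturbed l 0 j) =
  ci (mu j) setT (fun x => pois l x * (1 - u x)) +
  Re (z 0 j) * ci (@arc_charge R) setT (fun x => pois l x * u x).
Proof.
move=> l1; rewrite mxE cReD cReZ mulrDr Re_phi// mulrA mulfV ?mul1r; last first.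
  by rewrite gt_eqF// mulr_gt0// pi_gt0.
have bp := pois_bmf l1; have bpu := bmfM bp bu.
have -> : Re (ciC (kap j) setT
    (fun x => (u x)%:C * herK (circle_val x) l)) =
    ci (kap j) setT (fun x => pois l x * u x).
  by apply: eq_ci => x _; rewrite cReZ mulrC.
rewrite ci_Re_arc_minus//.
have -> : ci (mu j) setT (fun x => pois l x * (1 - u x)) =
    ci (mu j) setT (fun x => pois l x - pois l x * u x).
  by apply: eq_ci => x _; rewrite mulrBr mulr1.
by rewrite (ciB _ measurableT bp bpu); ring.
Qed.

(* The half-space [el . w <= c] passes from [phi] to the signed measure
   [el . mu - c L], which is therefore negative. *)
Let perturbed_halfspace (el : 'I_n -> R) c l :
  (forall w, D w -> \sum_j el j * Re (w 0 j) <= c) -> normc l < 1 ->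
  \sum_j el j * Re (perturbed l 0 j) <= c.
Proof.
move=> Dc l1; have pi0 : 0 < 2 * pi :> R by rewrite mulr_gt0// pi_gt0.
(* Arc length joins the [mu j] as an extra member with coefficient [- c], so that [poisson_neg]
   applies to the combination. *)
pose nu (i : 'I_n.+1) := if unlift ord0 i is Some j then mu j else @arc_charge R.
pose cc (i : 'I_n.+1) : R := if unlift ord0 i is Some j then el j else - c.
have sumE f : \sum_i cc i * ci (nu i) setT f =
    \sum_j el j * ci (mu j) setT f - c * ci (@arc_charge R) setT f.
  rewrite big_ord_recl /nu /cc unlift_none addrC mulNr; congr (_ - _).
  by apply: eq_bigr => j _; rewrite liftK.
have H1 : forall E, measurable E -> \sum_i cc i * ci (nu i) setT \1_E <= 0.
  apply: poisson_neg => w w1; rewrite sumE arc_pois// subr_le0.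
  rewrite (eq_bigr (fun j => 2 * pi * (el j * Re (phi w 0 j)))); last first.
    by move=> j _; rewrite -Re_phi//; ring.
  by rewrite -mulr_sumr mulrC ler_pM2r// Dc//; apply: phi_holo.2; rewrite unit_discE.
have H2 P : bmf P -> (forall x, 0 <= P x) -> \sum_i cc i * ci (nu i) setT P <= 0.
  move=> bP P0; have := @ci_sum_weight _ _ R _ nu (fun i _ => cc i) P
    (fun i => @bmf_cst _ _ R (cc i)) bP P0 _ setT measurableT.
  rewrite (eq_bigr (fun i => cc i * ci (nu i) setT P)); last first.
    by move=> i _; rewrite -ciZ//; apply: eq_ci => x _; rewrite mulrC.
  apply=> E mE; apply: le_trans (H1 E mE); rewrite le_eqVlt; apply/orP; left; apply/eqP.
  apply: eq_bigr => i _; rewrite -ciZ; [|exact: measurableT|exact: bmf_indic].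
  by rewrite -[E in LHS]setTI -ci_indic; apply: eq_ci => x _; rewrite mulrC.
have bp := pois_bmf l1; have bpu := bmfM bp bu.
have bpu' : bmf (fun x => pois l x * (1 - u x)).
  by apply: bmfM => //; apply: bmfB => //; exact: bmf_cst.
have pu0 x : 0 <= pois l x * (1 - u x).
  by have /andP[_ ux] := u01 x; rewrite mulr_ge0 ?subr_ge0 ?(ltW (pois_gt0 _ l1)).
have := H2 _ bpu' pu0; rewrite sumE => H3.
have arcs : ci (@arc_charge R) setT (fun x => pois l x * (1 - u x)) +
    ci (@arc_charge R) setT (fun x => pois l x * u x) = 2 * pi.
  by rewrite -(arc_pois l1) -ciD//; apply: eq_ci => x _; ring.
have a0 : 0 <= ci (@arc_charge R) setT (fun x => pois l x * u x).
  rewrite arc_chargeE//; apply: Rintegral_ge0 => x _.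
  by have /andP[ux _] := u01 x; rewrite mulr_ge0// (ltW (pois_gt0 _ l1)).
rewrite -(ler_pM2l pi0) mulr_sumr.
rewrite (eq_bigr (fun j => el j * ci (mu j) setT (fun x => pois l x * (1 - u x)) +
  el j * Re (z 0 j) * ci (@arc_charge R) setT (fun x => pois l x * u x))); last first.
  by move=> j _; rewrite mulrCA perturbedE//; ring.
rewrite big_split /= -mulr_suml.
have := ler_wpM2r a0 (Dc z Dz); rewrite subr_le0 in H3; move/(lerD H3) => /le_trans; apply.
by rewrite -mulrDr arcs mulrC.
Qed.

(** Half-spaces place [perturbed l] in the closure of [D] only; mixing with the interior point [z]
    brings it inside. Otherwise a functional separating the mixture from [D] at level [c] would be
    at most [c] at [perturbed l] and strictly below [c] at [z], yet equal to [c] at the mixture. *)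
Lemma perturbed_mix (t : R) l : 0 <= t -> t < 1 -> normc l < 1 ->
  D (t%:C *: perturbed l + (1 - t)%:C *: z).
Proof.
move=> t0 t1 l1; have [Om [_ cO DOm]] := tubeD.
rewrite DOm; apply: contrapT => nD.
have cvx (v w : 'rV[R]_n) (r : R) : Om v -> Om w -> 0 < r -> r < 1 ->
    Om (r *: v + (1 - r) *: w).
  move=> Ov Ow r0 r1.
  by have := cO v w (Itv01 (ltW r0) (ltW r1)) (mem_set Ov) (mem_set Ow); rewrite inE.
have [el el0 elP] := separation n_gt0 cvx nD.
set p := Re_vec _ in elP; set c := dotv el p in elP.
have Dc w : D w -> \sum_j el 0 j * Re (w 0 j) <= c.
  rewrite DOm => /elP; congr (_ <= _); apply: eq_bigr => j _; by rewrite mxE.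
(* As [D] is open, [z] can be moved in the direction [el], which strictly raises the functional. *)
have zc : \sum_j el 0 j * Re (z 0 j) < c.
  have [tz tz0 tzP] := tube_open tubeD Dz.
  pose S := \sum_j `|el 0 j|; have S0 : 0 <= S by apply: sumr_ge0.
  have S1 : 0 < S + 1 by rewrite ltr_wpDl.
  pose r := tz / (S + 1); have r0 : 0 < r by rewrite divr_gt0.
  have : D (z + \row_j (r * el 0 j)%:C).
    apply: tzP => j; rewrite !mxE cReD addrAC subrr add0r /= normrM (gtr0_norm r0).
    rewrite /r mulrAC ltr_pdivrMr// ltr_pM2l// ltr_pwDr// /S (bigD1 j)//= lerDl.
    by apply: sumr_ge0.
  move=> /Dc; rewrite (eq_bigr (fun j => el 0 j * Re (z 0 j) +
    r * (el 0 j * el 0 j))); last first.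
    by move=> j _; rewrite !mxE cReD /=; ring.
  rewrite big_split /= -mulr_sumr; apply: lt_le_trans.
  by rewrite ltrDl mulr_gt0//; exact: dotv_gt0.
have pc := perturbed_halfspace Dc l1.
have : c = t * (\sum_j el 0 j * Re (perturbed l 0 j)) +
    (1 - t) * (\sum_j el 0 j * Re (z 0 j)).
  rewrite /c /p /dotv !mulr_sumr -big_split /=; apply: eq_bigr => j _.
  have -> : Re_vec (t%:C *: perturbed l + (1 - t)%:C *: z) 0 j =
     t * Re (perturbed l 0 j) + (1 - t) * Re (z 0 j).
    by rewrite mxE; move: (perturbed l) => v; rewrite !mxE cReD !cReZ.
  by ring.
have : (1 - t) * (\sum_j el 0 j * Re (z 0 j)) < (1 - t) * c.
  by rewrite ltr_pM2l// subr_gt0.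
have := ler_wpM2l t0 pc.
by move: c (\sum_j _) (\sum_j _) {elP Dc zc pc} => c X Y; lra.
Qed.

Lemma perturbed_mix_holo (t : R) : 0 <= t -> t < 1 ->
  holomorphic_maps unit_disc D (fun l => t%:C *: perturbed l + (1 - t)%:C *: z).
Proof.
move=> t0 t1; split=> l; rewrite unit_discE => l1; last exact: perturbed_mix.
apply: dif_row => j.
have -> : (fun l => (t%:C *: perturbed l + (1 - t)%:C *: z) 0 j) =
  (fun l => t%:C * (phi l 0 j + (2 * pi)^-1%:C *
    ciC (kap j) setT (fun x => (u x)%:C * herK (circle_val x) l)) + (1 - t)%:C * z 0 j).
  by apply/funext => w; rewrite !mxE.
apply: difD; last exact: dif_cst.
apply: difM; first exact: dif_cst; apply: difD.
  by apply/dif_entry/phi_holo.1; rewrite unit_discE.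
by apply: difM; [exact: dif_cst|exact: differentiable_herglotz].
Qed.

End Perturbation.

Section Extremal.
Context {R : realType} (n : nat) (D : set 'rV[R[i]]_n) (phi : R[i] -> 'rV[R[i]]_n).
Hypothesis n_gt0 : (0 < n)%N.
Hypothesis tubeD : convex_tube_domain D.
Hypothesis phi_geo : complex_geodesic D phi.
Implicit Types psi : R[i] -> 'rV[R[i]]_n.
Local Notation s := ((2^-1)%:C : R[i]).

Let incr psi (c : R) j : R[i] := psi (c%:C * s) 0 j - psi 0 0 j.

(** The imaginary part of [psi 0] is left out: a tube is invariant under imaginary translations,
    which adjust it freely. *)
Let triple psi (c : R) : 'rV[R]_(n + n + n) :=
  row_mx (row_mx (\row_j Re (psi 0 0 j)) (\row_j Re (incr psi c j)))
    (\row_j Im (incr psi c j)).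

Let attained : set 'rV[R]_(n + n + n) := [set x | exists psi (c : R),
  [/\ holomorphic_maps unit_disc D psi, 0 <= c, c < 1 & x = triple psi c]].

(** Precomposition with the contractions [l |-> k1 l] and [l |-> k2 l] makes both maps use the
    larger of the two parameters; this is why [c] varies in an interval. *)
Let attained_convex x y (t : R) : attained x -> attained y -> 0 < t -> t < 1 ->
  attained (t *: x + (1 - t) *: y).
Proof.
move=> [p1 [c1 [hp1 c10 c11 ->]]] [p2 [c2 [hp2 c20 c21 ->]]] t0 t1.
pose c := Num.max c1 c2; pose k1 := c1 / c; pose k2 := c2 / c.
have c0 : 0 <= c by rewrite le_max c10.
(* If [c = 0], the smaller parameter vanishes too and the convention [0 / 0 = 0] gives an admissible
   factor. *)
have kc k : 0 <= k -> k <= c -> [/\ 0 <= k / c, k / c <= 1 & k / c * c = k].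
  move=> k0 kc; have [cz|cn0] := eqVneq c 0.
    have -> : k = 0 by apply/le_anti; rewrite k0 -cz kc.
    by rewrite !mul0r ler01.
  have cp : 0 < c by rewrite lt_def cn0.
  by rewrite divr_ge0// ler_pdivrMr// mul1r kc divfK.
have [k10 k11 k1c] : [/\ 0 <= k1, k1 <= 1 & k1 * c = c1] by apply: kc; rewrite // le_max lexx.
have [k20 k21 k2c] : [/\ 0 <= k2, k2 <= 1 & k2 * c = c2] by apply: kc; rewrite // le_max lexx orbT.
have disc k (l : R[i]) : 0 <= k -> k <= 1 -> normc l < 1 -> unit_disc (k%:C * l).
  move=> k0 kle l1; rewrite unit_discE normcM normc_real ger0_norm//.
  by apply: le_lt_trans l1; rewrite ler_piMl// normc_ge0.
pose psi l := t%:C *: p1 (k1%:C * l) + (1 - t)%:C *: p2 (k2%:C * l).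
have psiE l j : psi l 0 j = t%:C * p1 (k1%:C * l) 0 j + (1 - t)%:C * p2 (k2%:C * l) 0 j.
  by rewrite /psi; move: (p1 _) (p2 _) => v w; rewrite !mxE.
have psiV l : psi l = t%:C *: p1 (k1%:C * l) + (1 - t)%:C *: p2 (k2%:C * l) by [].
clearbody psi; exists psi, c; split; last 1 first.
- have incrE j : incr psi c j = t%:C * incr p1 c1 j + (1 - t)%:C * incr p2 c2 j.
    rewrite /incr !psiE !mulr0 !mulrA -!rmorphM /= k1c k2c; ring.
  rewrite /triple !scale_row_mx !add_row_mx; congr row_mx; first congr row_mx;
    apply/rowP => j; rewrite !mxE.
  + by rewrite psiE !mulr0 cReD !cReZ.
  + by apply/esym; rewrite incrE cReD !cReZ.
  + by apply/esym; rewrite incrE cImD !cImZ.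
- split=> l; rewrite unit_discE => l1; last first.
    by rewrite psiV; apply: tube_convex; rewrite ?ltW//; [apply: hp1.2|apply: hp2.2]; exact: disc.
  apply: dif_row => j.
  have -> : (fun l => psi l 0 j) =
    (fun l => t%:C * p1 (k1%:C * l) 0 j + (1 - t)%:C * p2 (k2%:C * l) 0 j).
    by apply/funext => w; exact: psiE.
  have dk p k : holomorphic_maps unit_disc D p -> 0 <= k -> k <= 1 ->
      differentiable (fun l : R[i] => p (k%:C * l) 0 j) l.
    move=> hp k0 kle; apply: dif_entry.
    apply: (@dif_comp _ _ _ _ (fun l : R[i] => k%:C * l) p).
      by apply: difM; [exact: dif_cst|exact: dif_id].
    by apply: hp.1; exact: disc.
  by apply: difD; (apply: difM; first exact: dif_cst); exact: dk.
- exact: c0.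
- by rewrite gt_max c11.
Qed.

Let incr1 psi j : incr psi 1 j = psi s 0 j - psi 0 0 j.
Proof. by rewrite /incr rmorph1 mul1r. Qed.

Let normc_s : normc s = 2^-1.
Proof. by rewrite normc_real gtr0_norm. Qed.

Let poincare_0 (l : R[i]) : poincare l 0 = ln ((1 + normc l) / (1 - normc l)) / 2.
Proof. by rewrite poincareE conjc0 mul0r !subr0 divr1. Qed.

(* A competitor through [phi 0] and [phi s] at the smaller parameter [c s]
   would, by Schwarz-Pick, bound the Caratheodory distance strictly below
   [poincare s 0]. *)
Let not_attained : ~ attained (triple phi 1).
Proof.
move=> [psi [c [hpsi c0 c1]]] /eq_row_mx[/eq_row_mx[/rowP H1 /rowP H2] /rowP H3].
have {}H1 j : Re (psi 0 0 j) = Re (phi 0 0 j) by have := H1 j; rewrite !mxE.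
have incrE j : incr psi c j = incr phi 1 j.
  by have := H2 j; have := H3 j; rewrite !mxE => ? ?; apply: complex_eqP.
(* The real parts at 0 agree, so [tau] is purely imaginary and the translate stays in the tube. *)
pose tau : 'rV[R[i]]_n := \row_j (phi 0 0 j - psi 0 0 j).
pose psi' l := psi l + tau.
have psiE l j : psi' l 0 j = psi l 0 j + (phi 0 0 j - psi 0 0 j) by rewrite /psi' !mxE.
have s1 : normc s < 1 by rewrite normc_s invf_lt1// ltr1n.
have psi0 : psi' 0 = phi 0 by apply/rowP => j; rewrite psiE addrC subrK.
have psis : psi' (c%:C * s) = phi s.
  apply/rowP => j; rewrite psiE addrCA; have := incrE j; rewrite incr1 /incr => ->.
  by rewrite addrC subrK.
have psiD l : normc l < 1 -> D (psi' l).
  move=> l1; have [Om [_ _ DOm]] := tubeD.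
  have : D (psi l) by apply: hpsi.2; rewrite unit_discE.
  rewrite DOm; congr (Om _); apply/rowP => j; rewrite mxE [RHS]mxE psiE cReD cReB H1.
  by rewrite subrr addr0.
have dpsi l : normc l < 1 -> differentiable psi' l.
  move=> l1; apply: dif_row => j.
  have -> : (fun l => psi' l 0 j) = (fun l => psi l 0 j + (phi 0 0 j - psi 0 0 j)).
    by apply/funext => w; exact: psiE.
  apply: difD; last exact: dif_cst.
  by apply/dif_entry/hpsi.1; rewrite unit_discE.
have ncs : normc (c%:C * s) = c / 2 by rewrite normcM normc_s normc_real ger0_norm.
have cs1 : normc (c%:C * s) < 1.
  by rewrite ncs ltr_pdivrMr// mul1r (lt_trans c1)// ltr1n.
have n01 : normc (0 : R[i]) < 1 by rewrite normc0.
have [_ /(_ s 0)] := phi_geo; rewrite !(@unit_discE R) => /(_ s1 n01) H.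
pose P := poincare (c%:C * s) 0; pose C := caratheodory D (phi s) (phi 0).
have : (C <= P%:E)%E.
  apply: ge_ereal_sup => _ [f [df fD] <-]; rewrite lee_fin -psi0 -psis.
  apply: (@poincare_contract R (fun x => f (psi' x))).
  - split=> x; rewrite (@unit_discE R) => x1.
      by apply: (dif_comp (f := psi')); [exact: dpsi|apply: df; exact: psiD].
    by apply: fD; exact: psiD.
  - by rewrite unit_discE.
  - by rewrite unit_discE.
rewrite /C H lee_fin leNgt /P !poincare_0 atanh_lt//; first exact: normc_ge0.
by rewrite ncs normc_s ltr_pdivrMr// mulVf.
Qed.

(** Separation controls competitors at the parameters [c < 1]; being continuous at [s], they satisfy
    the same inequality at [c = 1]. *)
Lemma extremal_functional : exists (A : 'I_n -> R) (B : 'I_n -> R[i]),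
  (exists j, (A j != 0) || (B j != 0)) /\
  forall psi, holomorphic_maps unit_disc D psi ->
    \sum_j (A j * Re (psi 0 0 j) + Re (B j * (psi s 0 j - psi 0 0 j))) <=
    \sum_j (A j * Re (phi 0 0 j) + Re (B j * (phi s 0 j - phi 0 0 j))).
Proof.
have nnn : (0 < n + n + n)%N by rewrite !addn_gt0 n_gt0.
have [l l0 lP] := separation nnn attained_convex not_attained.
pose A j := l 0 (lshift n (lshift n j)).
(* The sign makes [Re (B j * w)] the real pairing with the coordinates [Re w] and [Im w]. *)
pose B j : R[i] := l 0 (lshift n (rshift n j)) +i* - l 0 (rshift (n + n) j).
exists A, B; split.
  apply: contrapT => H; have {}H j : A j = 0 /\ B j = 0.
    have [//|nAB] := pselect (A j = 0 /\ B j = 0); exfalso; apply: H; exists j.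
    by apply/negPn; rewrite negb_or !negbK; apply/negP => /andP[/eqP ? /eqP ?]; apply: nAB.
  move/negP: l0; apply; apply/eqP/rowP => i; rewrite [RHS]mxE.
  case: (split_ordP i) => j ->.
    case: (split_ordP j) => k ->; first exact: (H k).1.
    by have [_ /(congr1 (@Re R))] := H k.
  have [_ /(congr1 (@Im R))] := H j => /= /eqP; rewrite oppr_eq0.
  by move/eqP.
have dotE psi c : dotv l (triple psi c) =
    \sum_j (A j * Re (psi 0 0 j) + Re (B j * incr psi c j)).
  rewrite /dotv !big_split_ord /= -!big_split /=; apply: eq_bigr => j _.
  rewrite row_mxEr !row_mxEl row_mxEr !mxE.
  by move: (psi 0 0 j) (incr psi c j) => X Y; rewrite cReM /A /B /=; ring.
move=> psi hpsi; rewrite leNgt; apply/negP.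
rewrite (eq_bigr (fun j => A j * Re (phi 0 0 j) + Re (B j * incr phi 1 j))); last first.
  by move=> j _; rewrite incr1.
rewrite -dotE => gap; have lep c : 0 <= c -> c < 1 -> dotv l (triple psi c) <= dotv l (triple phi 1).
  by move=> c0 c1; apply: lP; exists psi, c; split; [exact: hpsi|exact: c0|exact: c1|reflexivity].
rewrite -subr_gt0 in gap; set e := (X in 0 < X) in gap.
pose q l := \sum_j B j * psi l 0 j.
have cq : {for s, continuous q}.
  apply: differentiable_continuous; apply: dif_sum => j.
  apply: difM; first exact: dif_cst.
  by apply/dif_entry/hpsi.1; rewrite unit_discE normc_s invf_lt1// ltr1n.
have [t t0 tP] := (continuous_normcP _ _).1 cq e gap.
pose c := Num.max 0 (1 - t).
have c0 : 0 <= c by rewrite le_max lexx.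
have c1 : c < 1 by rewrite gt_max ltr01 gtrBl.
have := tP (c%:C * s); have -> : s - c%:C * s = (1 - c)%:C * s by rewrite rmorphB mulrBl mul1r.
rewrite normcM normc_s normc_real ger0_norm ?subr_ge0 ?(ltW c1)//.
have ct : (1 - c) / 2 < t.
  by rewrite ltr_pdivrMr// ltrBlDr -ltrBlDl; apply: lt_le_trans (_ : 1 - t <= _);
    [lra|rewrite le_max lexx orbT].
move=> /(_ ct); apply/negP; rewrite -leNgt.
apply: le_trans (le_trans (ler_norm _) (ler_Re_normc _)).
rewrite /e; apply: le_trans (lerB (lexx _) (lep c c0 c1)) _.
rewrite dotE -sumrB /q -sumrB.
rewrite (big_morph (@Re R) (@cReD R) (erefl _)) le_eqVlt; apply/orP; left; apply/eqP.
apply: eq_bigr => j _; rewrite /incr opprD addrACA subrr add0r -!cReB -!mulrBr.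
by congr (Re (_ * _)); ring.
Qed.

End Extremal.

Section GeodesicQuadratic.
Context {R : realType} (n : nat) (D : set 'rV[R[i]]_n) (phi : R[i] -> 'rV[R[i]]_n)
  (mu : 'I_n -> signed_measure R).
Hypothesis n_gt0 : (0 < n)%N.
Hypothesis tubeD : convex_tube_domain D.
Hypothesis phi_mu : boundary_measure phi mu.
Hypothesis phi_geo : complex_geodesic D phi.
Local Notation s := ((2^-1)%:C : R[i]).

Let s1 : normc s < 1.
Proof. by rewrite normc_real gtr0_norm// invf_lt1// ltr1n. Qed.

Let n01 : normc (0 : R[i]) < 1.
Proof. by rewrite normc0. Qed.

(** What the extremal functional makes of the Herglotz kernel; by linearity it is the density of the
    functional on perturbations of [phi]. *)
Let weight (A : R) (B : R[i]) (x : circle R) : R :=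
  A * Re (herK (circle_val x) 0) +
  Re (B * (herK (circle_val x) s - herK (circle_val x) 0)).

Let weight_bmf A B : bmf (weight A B).
Proof.
apply: bmfD; first by apply: bmfZ; exact: (herK_cbmf n01).1.
have H := cbmfM (@cbmf_cst _ (circle R) R B)
  (cbmfD (herK_cbmf s1) (cbmfM (@cbmf_cst _ (circle R) R (-1)) (herK_cbmf n01))).
have := H.1; congr bmf; apply/funext => x; congr (Re (_ * _)).
by rewrite mulN1r.
Qed.

Let weight_integral nu (u : circle R -> R) A B : bmf u ->
  A * Re (ciC nu setT (fun x => (u x)%:C * herK (circle_val x) 0)) +
  Re (B * (ciC nu setT (fun x => (u x)%:C * herK (circle_val x) s) -
    ciC nu setT (fun x => (u x)%:C * herK (circle_val x) 0))) =
  ci nu setT (fun x => u x * weight A B x).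
Proof.
move=> bu; have k0 := cbmfM (cbmf_real bu) (herK_cbmf n01).
have ks := cbmfM (cbmf_real bu) (herK_cbmf s1).
have kN := cbmfM (@cbmf_cst _ (circle R) R (-1)) k0.
have kD := cbmfD ks kN.
rewrite -[X in _ - X]mul1r -mulNr -(ciCZ nu measurableT _ k0) -(ciCD nu measurableT ks kN).
rewrite -(ciCZ nu measurableT _ kD) /= -(ciZ nu measurableT _ k0.1).
rewrite -(ciD nu measurableT (bmfZ _ k0.1) (cbmfM (@cbmf_cst _ (circle R) R B) kD).1).
apply: eq_ci => x _; rewrite /weight [RHS]mulrDr [in RHS]mulrCA; congr (_ * _ + _); first by rewrite cReZ.
by rewrite -[RHS]cReZ; congr Re; ring.
Qed.

Lemma geodesic_weight : exists (A : 'I_n -> R) (B : 'I_n -> R[i]),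
  (exists j, (A j != 0) || (B j != 0)) /\
  forall z, D z -> forall E, measurable E ->
    \sum_j ci (Re_arc_minus z mu j) E (weight (A j) (B j)) <= 0.
Proof.
have [A [B [AB0 ABP]]] := extremal_functional n_gt0 tubeD phi_geo.
exists A, B; split=> // z Dz E mE.
have bE : bmf (\1_E : circle R -> R) by exact: bmf_indic.
have uE (x : circle R) : 0 <= (\1_E x : R) <= 1.
  by rewrite indicE; case: (_ \in _); rewrite ?lexx ?ler01.
pose p := perturbed phi mu z \1_E.
pose L (psi : R[i] -> 'rV[R[i]]_n) := \sum_j (A j * Re (psi 0 0 j) +
  Re (B j * (psi s 0 j - psi 0 0 j))).
have LP psi : holomorphic_maps unit_disc D psi -> L psi <= L phi by exact: ABP.
pose S := \sum_j ci (Re_arc_minus z mu j) E (weight (A j) (B j)).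
have Lp : L p = L phi + (2 * pi)^-1 * S.
  rewrite /L /S mulr_sumr -big_split /=; apply: eq_bigr => j _.
  pose J l := ciC (Re_arc_minus z mu j) setT
    (fun x => (\1_E x)%:C * herK (circle_val x) l).
  have pE l : p l 0 j = phi l 0 j + (2 * pi)^-1%:C * J l by rewrite mxE.
  have -> : ci (Re_arc_minus z mu j) E (weight (A j) (B j)) =
      A j * Re (J 0) + Re (B j * (J s - J 0)).
    by rewrite -[E]setTI -ci_indic -(weight_integral _ _ _ bE).
  rewrite !pE; move: (J 0) (J s) (2 * pi)^-1 (phi 0 0 j) (phi s 0 j) => X Y c v w.
  have -> : w + c%:C * Y - (v + c%:C * X) = (w - v) + c%:C * (Y - X) by ring.
  by rewrite cReD cReZ mulrDr [B j * (_ + _)]mulrDr cReD [B j * (_ * _)]mulrCA cReZ; ring.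
(* [K] is the value of [L] at the constant map [z]. Since it is the mixtures with [z] that map into
   [D], the inequality for [p] is reached as [t] tends to 1. *)
pose K := \sum_j A j * Re (z 0 j).
have mix_holo t : 0 <= t -> t < 1 ->
    holomorphic_maps unit_disc D (fun l => t%:C *: p l + (1 - t)%:C *: z).
  exact: (perturbed_mix_holo n_gt0 tubeD phi_geo.1 phi_mu Dz bE uE).
clearbody p.
have mix t : 0 <= t -> t < 1 -> t * L p + (1 - t) * K <= L phi.
  move=> t0 t1; pose m l := t%:C *: p l + (1 - t)%:C *: z.
  have mJ l j : m l 0 j = t%:C * p l 0 j + (1 - t)%:C * z 0 j.
    by rewrite /m; move: (p l) => v; rewrite !mxE.
  apply: (@le_trans _ _ (L m)); last first.
    exact: (LP _ (mix_holo t t0 t1)).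
  rewrite le_eqVlt; apply/orP; left; apply/eqP.
  rewrite /L /K !mulr_sumr -big_split /=; apply: eq_bigr => j _.
  rewrite !mJ; move: (p 0 0 j) (p s 0 j) => v w.
  have -> : t%:C * w + (1 - t)%:C * z 0 j - (t%:C * v + (1 - t)%:C * z 0 j) = t%:C * (w - v).
    by ring.
  by rewrite cReD !cReZ [B j * (_ * _)]mulrCA cReZ; ring.
have {}Lp0 : L p <= L phi.
  apply/ler_addgt0Pr => e e0; have [KL|LK] := leP (L p) K.
    have := mix 0 (lexx _) ltr01; rewrite mul0r add0r subr0 mul1r => Kp.
    by apply: le_trans KL (le_trans Kp _); rewrite lerDl ltW.
  pose d := L p - K; have d0 : 0 < d by rewrite subr_gt0.
  (* Chosen so that [(1 - t) * d = e * t], which is at most [e]. *)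
  pose t := d / (d + e); have de : 0 < d + e by rewrite addr_gt0.
  have t0 : 0 <= t by rewrite divr_ge0 ?ltW.
  have t1 : t < 1 by rewrite ltr_pdivrMr// mul1r ltrDl.
  have := mix t t0 t1; have -> : t * L p + (1 - t) * K = L p - (1 - t) * d by rewrite /d; ring.
  rewrite lerBlDr => /le_trans; apply; rewrite lerD2l.
  have -> : (1 - t) * d = e * t by rewrite /t; field; rewrite gt_eqF.
  by rewrite ler_piMr ?(ltW e0)// ltW.
have c0 : 0 < (2 * pi)^-1 :> R by rewrite invr_gt0 mulr_gt0// pi_gt0.
by move: Lp0; rewrite Lp gerDl (pmulr_rle0 _ c0).
Qed.

(* For [s = 1/2], [herK x s - herK x 0 = 1 / (x - s)], which [|x - s|^2] turns
   into [conjc (x - s)]. *)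
Let weight_wgt (a : 'rV[R[i]]_n) (b : 'rV[R]_n) (A : R) (B : R[i]) j (x : circle R) :
  a 0 j = s * (B - A%:C) -> b 0 j = 5 / 4 * A - Re B / 2 ->
  normc (circle_val x - s) ^+ 2 * weight A B x = wgt a b j x.
Proof.
move=> aj bj; rewrite /weight /wgt aj bj /herK; have x1 := normc_circle x.
have xs := circle_sub_neq0 x1 s1; move: (circle_val x) x1 xs => v v1 vs.
have v0 : v != 0 by rewrite -normc_gt0 v1.
have -> : (v + 0) / (v - 0) = 1 by rewrite addr0 subr0 divff.
have -> : (v + s) / (v - s) - 1 = (v - s)^-1.
  apply: (mulIf vs); rewrite mulrBl divfK// mulVf// mul1r.
  by apply: complex_eqP; case: (v) => c d /=; field.
have H : (normc (v - s) ^+ 2)%:C * (B * (v - s)^-1) = B * conjc (v - s).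
  by rewrite -mulcJ mulrC mulrA divfK.
move/(congr1 (@Re R)) in H; rewrite cReZ in H.
rewrite mulrDr H; have := sqr_normc_Re_Im v; rewrite v1 expr1n sqr_normc_Re_Im.
case: v {v1 vs v0 H} => c d; case: B {aj bj} => e f /= E.
have -> : (c - 2^-1) ^+ 2 + (d - 0) ^+ 2 = 5 / 4 - c.
  by have -> : 5 / 4 - c = (c ^+ 2 + d ^+ 2) + 1 / 4 - c :> R; [by rewrite -E; field|by field].
by field.
Qed.

Lemma geodesic_quadratic : exists (a : 'rV[R[i]]_n) (b : 'rV[R]_n),
  (exists j, (a 0 j != 0) || (b 0 j != 0)) /\
  forall z, D z -> forall E, measurable E ->
    \sum_j ci (Re_arc_minus z mu j) E (wgt a b j) <= 0.
Proof.
have [A [B [[j0 AB0] ABP]]] := geodesic_weight.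
(* On the circle [|x - s|^2 = 5 / 4 - Re x]; writing [(5 / 4 - Re x) * A + Re (B * conjc (x - s))]
   as [b + 2 * Re (conjc a * x)] gives these coefficients. If both vanish, [B] equals the real
   number [A] and [b = 3 / 4 * A], so [A] and [B] vanish too. *)
pose a : 'rV[R[i]]_n := \row_j (s * (B j - (A j)%:C)).
pose b : 'rV[R]_n := \row_j (5 / 4 * A j - Re (B j) / 2).
exists a, b; split.
  exists j0; apply: contraTT AB0; rewrite !negb_or !negbK !mxE => /andP[/eqP a0 /eqP b0].
  have Bj : B j0 = (A j0)%:C.
    apply/eqP; rewrite -subr_eq0; have /eqP := a0; rewrite mulf_eq0 => /orP[/eqP s0|//].
    by have := congr1 (@Re R) s0 => /= /eqP; rewrite invr_eq0 pnatr_eq0.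
  have A0 : A j0 = 0.
    by move: b0; rewrite Bj /= => H; move: (A j0) H => X; lra.
  by rewrite Bj A0 !eqxx.
move=> z Dz E mE.
have bP : bmf (fun x : circle R => normc (circle_val x - s) ^+ 2).
  have cv : circle_cont (fun v : R[i] => v - s).
    by apply: dif_circle_cont => v _; apply: difB; [exact: dif_id|exact: dif_cst].
  have -> : (fun x : circle R => normc (circle_val x - s) ^+ 2) =
    (fun x => Re (circle_val x - s) * Re (circle_val x - s) +
       Im (circle_val x - s) * Im (circle_val x - s)).
    by apply/funext => x; rewrite sqr_normc_Re_Im !expr2.
  by apply: bmfD; apply: bmfM; [exact: (bmf_circle_Re cv)|exact: (bmf_circle_Re cv)|
    exact: (bmf_circle_Im cv)|exact: (bmf_circle_Im cv)].
have := @ci_sum_weight _ _ R _ (Re_arc_minus z mu) (fun j => weight (A j) (B j)) _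
  (fun j => weight_bmf _ _) bP (fun x => sqr_ge0 _) (ABP z Dz) E mE.
congr (_ <= 0); apply: eq_bigr => j _; apply: eq_ci => x _.
by apply: weight_wgt; rewrite mxE.
Qed.

End GeodesicQuadratic.

(** * The characterization of geodesics *)

Lemma hquad_neq0 (R : realType) n (a : 'rV[R[i]]_n) (b : 'rV[R]_n) :
  (exists j, (a 0 j != 0) || (b 0 j != 0)) <-> exists l, hquad a b l != 0.
Proof.
split=> [[j ab]|[l hl]]; last first.
  apply: contrapT => H; move/negP: hl; apply; apply/eqP/rowP => j; rewrite hquadE mxE.
  have [a0 b0] : a 0 j = 0 /\ b 0 j = 0.
    have [//|nab] := pselect (a 0 j = 0 /\ b 0 j = 0); exfalso; apply: H; exists j.
    by apply/negPn; rewrite negb_or !negbK; apply/negP => /andP[/eqP ? /eqP ?]; apply: nab.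
  by rewrite a0 b0 conjc0 !mulr0 !addr0.
(* The value at 0 is [a]; when [a 0 j = 0], the value at 1 reads off [b 0 j]. *)
have [a0|a0] := eqVneq (a 0 j) 0; last first.
  exists 0; apply: contraNneq a0 => /rowP/(_ j); rewrite hquadE mxE => <-.
  by rewrite expr0n !mul0r !add0r.
exists 1; apply: contraTneq ab => /rowP/(_ j); rewrite hquadE mxE a0.
rewrite conjc0 mulr0 add0r mul1r addr0 => /(congr1 (@Re R)) /= ->.
by rewrite !eqxx.
Qed.

Theorem theorem1p1 (R : realType) (n : nat) (n_gt0 : (0 < n)%N)
    (D : set 'rV[R[i]]_n) (phi : R[i] -> 'rV[R[i]]_n)
    (mu : 'I_n -> {charge set (circle R) -> \bar R})
    (tubeD : convex_tube_domain D) (tautD : taut D)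
    (phi_holo : holomorphic_maps unit_disc D phi)
    (phi_mu : boundary_measure phi mu) :
  complex_geodesic D phi <->
  exists h : R[i] -> 'rV[R[i]]_n,
    [/\ exists (a : 'rV[R[i]]_n) (b : 'rV[R]_n), forall l, h l = hquad a b l,
        exists l, h l != 0 &
        forall z, D z ->
          negative_measure
            (dot_measure (fun l => conjc (circle_val l) *: h (circle_val l))
               (Re_arc_minus z mu))].
Proof.
split=> [phi_geo|[h [[a [b hE]] [l hl] neg]]].
  have [a [b [ab0 neg]]] := geodesic_quadratic n_gt0 tubeD phi_mu phi_geo.
  exists (hquad a b); split; [by exists a, b|exact/hquad_neq0|].
  move=> z Dz E mE; rewrite (dot_measure_le0 _ (fun=> erefl) mE) -[leRHS]/(0%:C) lecR.
  exact: neg.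
have ab0 : exists j, (a 0 j != 0) || (b 0 j != 0).
  by apply/hquad_neq0; exists l; rewrite -hE.
have neg' z : D z -> forall E, measurable E ->
    \sum_j charge_integral (Re_arc_minus z mu j) E (wgt a b j) <= 0.
  move=> Dz E mE; have := neg z Dz E mE.
  by rewrite (dot_measure_le0 _ hE mE) -[leRHS]/(0%:C) lecR.
apply: approximate_inverse_geodesic => // s t eta s1 t1 eta0.
exact: (approximate_left_inverse tubeD phi_holo phi_mu neg' ab0 s1 t1 eta0).
Qed.
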